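(* Let $\varphi=\frac{1+\sqrt5}{2}$, $\mathbb{T}^2=\mathbb{R}^2/\mathbb{Z}^2$, let $R_{\mathcal{U}}$ be the $\mathbb{Z}^2$-action on $\mathbb{T}^2$ given by $R_{\mathcal{U}}^{n}(x)=x+\varphi^{-2}n$ for $n\in\mathbb{Z}^2$, let $\mathcal{U}$ be the set of 19 Wang tiles and $\mathcal{P}_{\mathcal{U}}=\{P_u\}_{u\in\mathcal{U}}$ the topological partition of $\mathbb{T}^2$ described in the context, let $\mathcal{X}_{\mathcal{P}_{\mathcal{U}},R_{\mathcal{U}}}$ be the symbolic dynamical system corresponding to $\mathcal{P}_{\mathcal{U}},R_{\mathcal{U}}$, let $\sigma$ be the shift action, and let $\Omega_{\mathcal{U}}$ be the Wang shift of $\mathcal{U}$. Then: (i) the subshift $\mathcal{X}_{\mathcal{P}_{\mathcal{U}},R_{\mathcal{U}}}$ is minimal, aperiodic and is equal to $\Omega_{\mathcal{U}}$; (ii) $\mathcal{P}_{\mathcal{U}}$ is a Markov partition for the dynamical system $(\mathbb{T}^2,\mathbb{Z}^2,R_{\mathcal{U}})$; (iii) $(\mathbb{T}^2,\mathbb{Z}^2,R_{\mathcal{U}})$ is the maximal equicontinuous factor of $(\Omega_{\mathcal{U}},\mathbb{Z}^2,\sigma)$; (iv) the set of fiber cardinalities of the factor map $f_{\mathcal{U}}:\Omega_{\mathcal{U}}\to\mathbb{T}^2$ is $\{1,2,8\}$; (v) the dynamical system $(\Omega_{\mathcal{U}},\mathbb{Z}^2,\sigma)$ is strictly ergodic (uniquely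 ergodic and minimal), and the measure-preserving dynamical system $(\Omega_{\mathcal{U}},\mathbb{Z}^2,\sigma,\nu)$ is isomorphic to $(\mathbb{T}^2,\mathbb{Z}^2,R_{\mathcal{U}},\lambda)$, where $\nu$ is the unique shift-invariant probability measure on $\Omega_{\mathcal{U}}$ and $\lambda$ is the Haar (probability) measure on $\mathbb{T}^2$.
   Context: Subshifts. For a finite set $\mathcal{A}$, $\mathcal{A}^{\mathbb{Z}^2}$ has the product topology and the shift action $(\sigma^{n}(x))_{m}=x_{m+n}$. A subshift is a closed shift-invariant subset; it is a shift of finite type (SFT) if it is the set of configurations avoiding some finite set of forbidden finite patterns. A nonempty subshift is aperiodic if the shift action on it is free; it is minimal if it contains no nonempty proper closed shift-invariant subset. Wang shifts. A Wang tile is a quadruple $\tau=(a,b,c,d)$ = (right, top, left, bottom) colors. For a finite set $\mathcal{T}$ of Wang tiles, the Wang shift $\Omega_{\mathcal{T}}\subset\mathcal{T}^{\mathbb{Z}^2}$ is the set of all $x:\mathbb{Z}^2\to\mathcal{T}$ such that for all $n$: right color of $x_{n}$ = left color of $x_{n+(1,0)}$ and top color of $x_n$ = bottom color of $x_{n+(0,1)}$. The tiles $\mathcal{U}=\{u_0,\dots,u_{18}\}$ (right, top, left, bottom): $u_0=(F,O,J,O)$, $u_1=(F,O,H,L)$, $u_2=(J,M,F,P)$, $u_3=(D,M,F,K)$, $u_4=(H,P,J,P)$, $u_5=(H,P,H,N)$, $u_6=(H,K,F,P)$, $u_7=(H,K,D,P)$, $u_8=(B,O,I,O)$, $u_9=(G,L,E,O)$,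 $u_{10}=(G,L,C,L)$, $u_{11}=(A,L,I,O)$, $u_{12}=(E,P,G,P)$, $u_{13}=(E,P,I,P)$, $u_{14}=(I,P,G,K)$, $u_{15}=(I,P,I,K)$, $u_{16}=(I,K,B,M)$, $u_{17}=(I,K,A,K)$, $u_{18}=(C,N,I,P)$. The partition $\mathcal{P}_{\mathcal{U}}$. Put $\alpha=\varphi^{-2}=2-\varphi$. Let $\mathcal{Y}=\{Y_i\}$, $i\in\{A,\dots,J\}$, and $\mathcal{Z}=\{Z_j\}$, $j\in\{K,\dots,P\}$, be the topological partitions of $\mathbb{T}^2$ whose atoms are the images of the interiors of the following polygons in $[0,1]^2$ (vertices in order). $Y_A$: $(0,2\alpha),(\alpha,\alpha),(0,1)$. $Y_B$: $(0,\alpha),(\alpha,\alpha),(0,2\alpha)$. $Y_C$: $(2\alpha,1),(1,2\alpha),(1,1)$. $Y_D$: $(\alpha,0),(1-\alpha,0),(\alpha,\alpha)$. $Y_E$: $(1,\alpha),(1,2\alpha),(2\alpha,1),(1-\alpha,1)$. $Y_F$: $(0,0),(\alpha,0),(\alpha,\alpha),(0,\alpha)$. $Y_G$: $(\alpha,\alpha),(\alpha,1),(0,1)$. $Y_H$: $(2\alpha,0),(1,0),(1,\alpha),(\alpha,\alpha)$. $Y_I$: $(\alpha,\alpha),(1,\alpha),(1-\alpha,1),(\alpha,1)$. $Y_J$: $(1-\alpha,0),(2\alpha,0),(\alpha,\alpha)$. $Z_K$: $(2\alpha,0),(1,0),(\alpha,1),(\alpha,\alpha)$. $Z_L$: $(\alpha,\alpha),(\alpha,1),(0,1),(0,2\alpha)$.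 $Z_M$: $(\alpha,0),(2\alpha,0),(\alpha,\alpha)$. $Z_N$: $(2\alpha,1),(1,2\alpha),(1,1)$. $Z_O$: $(0,0),(\alpha,0),(\alpha,\alpha),(0,2\alpha)$. $Z_P$: $(1,0),(1,2\alpha),(2\alpha,1),(\alpha,1)$. For a quadruple $u=(i,j,k,\ell)$ let $P_u=Y_i\cap Z_j\cap R_{\mathcal{U}}^{(1,0)}(Y_k)\cap R_{\mathcal{U}}^{(0,1)}(Z_\ell)$. The quadruples for which $P_u\ne\varnothing$ are exactly the elements of $\mathcal{U}$, and $\mathcal{P}_{\mathcal{U}}=\{P_u\}_{u\in\mathcal{U}}$. Symbolic dynamical systems. A topological partition of a compact metric space $M$ is a finite collection $\mathcal{P}=\{P_a\}_{a\in\mathcal{A}}$ of disjoint open sets with $M=\bigcup_a\overline{P_a}$. Given a continuous $\mathbb{Z}^2$-action $R$ on $M$, a pattern $w\in\mathcal{A}^S$ ($S\subset\mathbb{Z}^2$ finite) is allowed if $\bigcap_{k\in S}R^{-k}(P_{w_k})\neq\varnothing$. The symbolic dynamical system $\mathcal{X}_{\mathcal{P},R}\subset\mathcal{A}^{\mathbb{Z}^2}$ corresponding to $\mathcal{P},R$ is the unique subshift whose language is the set of allowed patterns. For $w\in\mathcal{X}_{\mathcal{P},R}$ let $D_n(w)=\bigcap_{\|k\|\le n}R^{-k}(P_{w_k})$ with $\|k\|=|k_1|+|k_2|$. $\mathcal{P}$ gives a symbolic representation of $(M,\mathbb{Z}^2,R)$ if for every $w\in\mathcal{X}_{\mathcal{P},R}$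 the set $\bigcap_{n\ge0}\overline{D_n(w)}$ consists of exactly one point. In that case, the factor map $f:\mathcal{X}_{\mathcal{P},R}\to M$ sends $w$ to this point; $f_{\mathcal{U}}$ denotes this map for $\mathcal{P}_{\mathcal{U}},R_{\mathcal{U}}$. $\mathcal{P}$ is a Markov partition for $(M,\mathbb{Z}^2,R)$ if $\mathcal{P}$ gives a symbolic representation of $(M,\mathbb{Z}^2,R)$ and $\mathcal{X}_{\mathcal{P},R}$ is an SFT. Factors. A factor map between dynamical systems is a continuous, onto, equivariant map. An equicontinuous factor is a factor on which the group acts equicontinuously. The maximal equicontinuous factor of $(X,G,T)$ is an equicontinuous factor $\pi_{\max}:X\to X_{\max}$ such that every equicontinuous factor map $\theta:X\to Y$ factors as $\theta=\psi\circ\pi_{\max}$ for a unique factor map $\psi:X_{\max}\to Y$. The set of fiber cardinalities of a factor map $\theta:X\to Y$ is $\{\mathrm{card}(\theta^{-1}(y)):y\in Y\}$. Isomorphism of measure-preserving systems is in the usual sense (a measure-preserving equivariant measurable bijection between invariant sets of full measure). *)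

(* Defs.v *)
From HB Require Import structures.
From mathcomp Require Import all_boot all_order all_algebra.
From mathcomp Require Import finmap.
From mathcomp Require Import all_classical all_reals all_analysis.
Import Order.TTheory GRing.Theory Num.Theory.
Import numFieldNormedType.Exports.

Set Implicit Arguments.
Unset Strict Implicit.
Unset Printing Implicit Defensive.

Local Open Scope classical_set_scope.
Local Open Scope ring_scope.

Notation Z2 := (int * int)%type.

(* A dynamical system (X, Z2, T) is given by an action T on an ambient space S
   together with a closed invariant subset X of S: a subshift for S the full
   shift, and setT for a system on the whole space. *)

Record is_action (S : topologicalType) (T : Z2 -> S -> S) : Prop := {
  action_continuous : forall n, continuous (T n);
  action0 : forall x, T 0 x = x;
  actionD : forall m n x, T (m + n) x = T m (T n x) }.

Definition invariant_set (S : Type) (T : Z2 -> S -> S) (X : set S) :=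
  forall n, T n @` X `<=` X.

Definition minimal (S : topologicalType) (T : Z2 -> S -> S) (X : set S) :=
  [/\ closed X, invariant_set T X &
    forall X' : set S, closed X' -> invariant_set T X' -> X' `<=` X ->
      X' !=set0 -> X' = X].

Definition aperiodic (S : Type) (T : Z2 -> S -> S) (X : set S) :=
  X !=set0 /\ forall n x, X x -> T n x = x -> n = 0.

Definition factor_map (S M : topologicalType) (X : set S) (T : Z2 -> S -> S)
    (U : Z2 -> M -> M) (f : S -> M) :=
  [/\ {within X, continuous f}, f @` X = setT &
    forall n x, X x -> f (T n x) = U n (f x)].

(* On a compact Hausdorff space the uniformity is unique, so that
   equicontinuity does not depend on the choice of a compatible metric. *)
Definition equicontinuous_system (M : puniformType) (U : Z2 -> M -> M) :=
  [/\ compact [set: M], hausdorff_space M, is_action U & equicontinuous setT U].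

(* Hausdorff factors of a compact metrizable system are compact metrizable;
   hence letting Y range over compact Hausdorff uniform spaces amounts to
   letting it range over compact metric spaces. *)
Definition maximal_equicontinuous_factor (S : topologicalType)
    (M : puniformType) (X : set S) (T : Z2 -> S -> S) (U : Z2 -> M -> M) :=
  equicontinuous_system U /\
  exists pi_max : S -> M, factor_map X T U pi_max /\
    forall (Y : puniformType) (V : Z2 -> Y -> Y) (theta : S -> Y),
      equicontinuous_system V -> factor_map X T V theta ->
      exists! psi : M -> Y, factor_map setT U V psi /\
        forall x, X x -> theta x = psi (pi_max x).

Definition fiber_cardinalities (S M : Type) (X : set S) (f : S -> M)
    (K : set nat) :=
  (forall y, exists2 k, K k & (X `&` f @^-1` [set y] #= `I_k)%card) /\
  (forall k, K k -> exists y, (X `&` f @^-1` [set y] #= `I_k)%card).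

Notation borel S := (g_sigma_algebraType (@open S)).

(* Borel probability measures on a closed subset X of S are identified with
   the Borel probability measures on S giving full mass to X. *)
Definition invariant_probability (R : realType) (S : ptopologicalType)
    (T : Z2 -> S -> S) (X : set S) (mu : probability (borel S) R) :=
  mu X = 1%E /\
  forall n (A : set (borel S)), measurable A -> mu (T n @^-1` A) = mu A.

Definition uniquely_ergodic (R : realType) (S : ptopologicalType)
    (T : Z2 -> S -> S) (X : set S) :=
  exists mu : probability (borel S) R, invariant_probability T X mu /\
    forall mu' : probability (borel S) R, invariant_probability T X mu' ->
      forall A : set (borel S), measurable A -> mu' A = mu A.

Definition strictly_ergodic (R : realType) (S : ptopologicalType)
    (T : Z2 -> S -> S) (X : set S) :=
  uniquely_ergodic R T X /\ minimal T X.

Definition isomorphic_mps (R : realType) (S M : ptopologicalType)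
    (T : Z2 -> S -> S) (mu : probability (borel S) R)
    (U : Z2 -> M -> M) (nu : probability (borel M) R) :=
  exists (X : set (borel S)) (Y : set (borel M)) (f : borel S -> borel M),
    [/\ [/\ measurable X, invariant_set T X & mu X = 1%E],
        [/\ measurable Y, invariant_set U Y & nu Y = 1%E],
        set_bij X Y f /\ (forall n x, X x -> f (T n x) = U n (f x)),
        measurable_fun X f /\
        (forall A, measurable A -> A `<=` X -> measurable (f @` A)) &
        forall B, measurable B -> mu (X `&` f @^-1` B) = nu B].

(* The torus R^2/Z^2, with the quotient group structure, the quotient topology
   and the quotient uniformity. *)

Definition lattice (R : realType) : {pred R * R} :=
  [pred x : R * R | (x.1 \is a Num.int) && (x.2 \is a Num.int)].

Lemma lattice_zmod_closed (R : realType) : zmod_closed (@lattice R).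
Proof.
split=> [|x y]; rewrite !inE /=; first by rewrite !rpred0.
by move=> /andP[x1 x2] /andP[y1 y2]; rewrite !rpredB.
Qed.

HB.instance Definition _ (R : realType) :=
  GRing.isZmodClosed.Build (R * R)%type (@lattice R) (@lattice_zmod_closed R).

Definition torus (R : realType) : Type :=
  Quotient.quot (@lattice R : zmodClosed (R * R)%type).

HB.instance Definition _ (R : realType) := GRing.Zmodule.on (torus R).
HB.instance Definition _ (R : realType) := Quotient.on (torus R).
HB.instance Definition _ (R : realType) := isPointed.Build (torus R) 0.

Lemma subr_shift (V : zmodType) (x y y' z : V) :
  x - (z + (y - y')) = (x - y) + (y' - z).
Proof.
rewrite opprD opprB -addrA; congr (_ + _).
by rewrite addrCA [RHS]addrCA [- z - y]addrC.
Qed.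

Section torus_topology.
Context (R : realType).
Local Notation pi := (\pi_(torus R)%qT : (R * R)%type -> torus R).

Definition torus_open (V : set (torus R)) := open (pi @^-1` V).

Lemma torus_openT : torus_open setT.
Proof. by rewrite /torus_open preimage_setT; exact: openT. Qed.

Lemma torus_openI : setI_closed torus_open.
Proof. by move=> V W; exact: openI. Qed.

Lemma torus_open_bigU (I : Type) (V : I -> set (torus R)) :
  (forall i, torus_open (V i)) -> torus_open (\bigcup_i V i).
Proof. by move=> oV; apply: bigcup_open => i _; exact: oV. Qed.

HB.instance Definition _ := isOpenTopological.Build (torus R)
  torus_openT torus_openI torus_open_bigU.

Lemma torus_piE (x y : R * R) : pi x = pi y <-> x - y \in @lattice R.
Proof.
have e := Quotient.idealrBE (@lattice R : zmodClosed (R * R)%type) x y.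
by split=> [xy|/[1!e]/eqP//]; rewrite e; apply/eqP.
Qed.

Lemma torus_pi_shift (x y z : R * R) : pi x = pi y -> pi (z + (x - y)) = pi z.
Proof. by move=> /torus_piE xy; apply/torus_piE; rewrite addrAC subrr add0r. Qed.

Let cl (e : R) : set (torus R * torus R) :=
  [set pq | exists x y, [/\ pi x = pq.1, pi y = pq.2 & `|x - y| < e]].

Definition torus_entourage : set_system (torus R * torus R) :=
  [set E | entourage [set xy : (R * R) * (R * R) | E (pi xy.1, pi xy.2)]].

Let torus_entourageP E :
  torus_entourage E <-> exists2 e : R, 0 < e & cl e `<=` E.
Proof.
rewrite /torus_entourage/= -entourage_ballE; split=> -[e e0 eE].
  exists e => // -[_ _] [x [y [/= <- <- xy]]]; apply: (eE (x, y)) => /=.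
  by rewrite -ball_normE.
exists e => // -[x y] /=; rewrite -ball_normE/= => xy.
by apply: eE; exists x, y.
Qed.

Lemma torus_entourage_filter : Filter torus_entourage.
Proof.
split; rewrite /torus_entourage/=; first exact: filterT.
- by move=> E F EE EF; exact: filterI.
- by move=> E F EF; apply: filterS => -[x y]; exact: EF.
Qed.

Lemma torus_entourage_diagonal E :
  torus_entourage E -> (diagonal `<=` E)%relation.
Proof.
move=> Er [p q]; rewrite /diagonal/= => ->.
by rewrite -(reprK q); exact: (@entourage_refl _ _ (repr q) Er).
Qed.

Lemma torus_entourage_inv E :
  torus_entourage E -> torus_entourage (E^-1)%relation.
Proof. exact: entourage_inv. Qed.

Lemma torus_entourage_split E : torus_entourage E ->
  exists2 B, torus_entourage B & (B \; B `<=` E)%relation.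
Proof.
move=> /torus_entourageP[e e0 eE].
exists (cl (e / 2)); first by apply/torus_entourageP; exists (e / 2); rewrite ?divr_gt0.
move=> [p q] [r [x [y [/= xp yr xy]]] [y' [z [/= yr' zq yz]]]]; apply: eE.
exists x, (z + (y - y')); split => //=; first by rewrite torus_pi_shift ?yr ?yr'.
rewrite [e]splitr (_ : x - _ = (x - y) + (y' - z)).
  by rewrite (le_lt_trans (ler_normD _ _))// ltrD.
exact: subr_shift.
Qed.

Lemma torus_nbhsE : @nbhs _ (torus R) = nbhs_ torus_entourage.
Proof.
apply/funext => p; apply/seteqP; split=> [A|A [E /torus_entourageP[e e0 eE] EA]].
  rewrite nbhsE => -[B [oB Bp] BA].
  have /nbhs_ballP[e /= e0 eB] : nbhs (repr p) (pi @^-1` B).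
    by apply: open_nbhs_nbhs; split; rewrite //= reprK.
  exists (cl e); first by apply/torus_entourageP; exists e.
  move=> q /set_mem[x [y [/= xp <- xy]]]; apply: BA.
  rewrite -(@torus_pi_shift (repr p) x) ?reprK ?xp//; apply: eB.
  by rewrite -ball_normE/= opprD [- y + _]addrC addrA opprB addrA [_ + x]addrC addrK.
rewrite nbhsE; exists [set q | cl e (p, q)]; last first.
  by move=> q pq; apply: EA; apply/mem_set/eE.
split; last by exists (repr p), (repr p); rewrite /= reprK subrr normr0.
rewrite /open/= /torus_open openE => y [x' [y' [/= xp yy xy]]].
apply/nbhs_ballP; exists (e - `|x' - y'|); first by rewrite /= subr_gt0.
move=> z; rewrite -ball_normE/= ltrBrDl => yz.
exists x', (z + (y' - y)); split => //=; first exact: torus_pi_shift.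
rewrite (_ : x' - _ = (x' - y') + (y - z)) ?(le_lt_trans (ler_normD _ _))//.
exact: subr_shift.
Qed.

HB.instance Definition _ := Nbhs_isUniform_mixin.Build (torus R)
  torus_entourage_filter torus_entourage_diagonal torus_entourage_inv
  torus_entourage_split torus_nbhsE.

End torus_topology.

Definition haar_probability (R : realType)
    (mu : probability (borel (torus R)) R) :=
  forall x (A : set (borel (torus R))), measurable A ->
    mu (+%R (x : torus R) @^-1` A) = mu A.

Definition config (A : choiceType) : Type :=
  prod_topology (fun _ : Z2 => discrete_topology A).
HB.instance Definition _ A := Uniform.on (config A).
HB.instance Definition _ (A : pointedType) := Pointed.on (config A).

Definition shift_action (A : choiceType) (n : Z2) (x : config A) : config A :=
  fun m => x (m + n).

Definition subshift (A : choiceType) (X : set (config A)) :=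
  closed X /\ invariant_set (@shift_action A) X.

(* A pattern in A^S, for a finite subset S of Z2, is the finite map of domain
   S. *)
Notation pattern A := {fmap Z2 -> A}.

Definition occurs (A : choiceType) (w : pattern A) (x : config A) :=
  forall k : domf w, x (val k) = w k.

Definition language (A : choiceType) (X : set (config A)) : set (pattern A) :=
  [set w | exists2 x, X x & occurs w x].

Definition shift_of_finite_type (A : finType) (X : set (config A)) :=
  exists F : seq (pattern A),
    X = [set x | forall w, w \in F -> forall n, ~ occurs w (shift_action n x)].

Definition topological_partition (A : finType) (M : topologicalType)
    (P : A -> set M) :=
  [/\ forall a, open (P a), trivIset setT P &
    \bigcup_a closure (P a) = setT].

Definition allowed (A : finType) (M : topologicalType) (P : A -> set M)
    (T : Z2 -> M -> M) : set (pattern A) :=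
  [set w | \bigcap_(k : domf w) (T (- val k) @` P (w k)) !=set0].

(* The default value set0 is taken only if there is no such subshift; there is
   at most one, since a subshift is determined by its language. *)
Definition symbolic_system (A : finType) (M : topologicalType)
    (P : A -> set M) (T : Z2 -> M -> M) : set (config A) :=
  xget set0 [set X | subshift X /\ language X = allowed P T].

Definition cylinder_atom (A : finType) (M : topologicalType) (P : A -> set M)
    (T : Z2 -> M -> M) (w : config A) (n : nat) : set M :=
  \bigcap_(k in [set k : Z2 | (`|k.1| + `|k.2| <= n)%N])
    (T (- k) @` P (w k)).

Definition symbolic_representation (A : finType) (M : topologicalType)
    (P : A -> set M) (T : Z2 -> M -> M) :=
  forall w, symbolic_system P T w ->
    exists p, \bigcap_n closure (cylinder_atom P T w n) = [set p].

Definition symbolic_factor (A : finType) (M : ptopologicalType)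
    (P : A -> set M) (T : Z2 -> M -> M) (w : config A) : M :=
  get (\bigcap_n closure (cylinder_atom P T w n)).

Definition markov_partition (A : finType) (M : topologicalType)
    (P : A -> set M) (T : Z2 -> M -> M) :=
  [/\ topological_partition P, symbolic_representation P T &
    shift_of_finite_type (symbolic_system P T)].

Variant color :=
  cA | cB | cC | cD | cE | cF | cG | cH | cI | cJ | cK | cL | cM | cN | cO | cP.

Definition color_code (c : color) : nat :=
  match c with
  | cA => 0 | cB => 1 | cC => 2 | cD => 3 | cE => 4 | cF => 5 | cG => 6
  | cH => 7 | cI => 8 | cJ => 9 | cK => 10 | cL => 11 | cM => 12 | cN => 13
  | cO => 14 | cP => 15
  end.

Definition color_decode (n : nat) : color :=
  nth cA [:: cA; cB; cC; cD; cE; cF; cG; cH; cI; cJ; cK; cL; cM; cN; cO; cP] n.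

Lemma color_codeK : cancel color_code color_decode.
Proof. by case. Qed.

HB.instance Definition _ := Countable.copy color (can_type color_codeK).

Definition wang_tile (C : Type) : Type := (C * C * C * C)%type.
Definition right_color C (t : wang_tile C) : C := t.1.1.1.
Definition top_color C (t : wang_tile C) : C := t.1.1.2.
Definition left_color C (t : wang_tile C) : C := t.1.2.
Definition bottom_color C (t : wang_tile C) : C := t.2.
HB.instance Definition _ (C : choiceType) := Choice.on (wang_tile C).

Definition wang_shift (C : choiceType) (T : {fset wang_tile C}) :
    set (config T) :=
  [set x | forall n : Z2,
    right_color (val (x n)) = left_color (val (x (n + (1, 0)))) /\
    top_color (val (x n)) = bottom_color (val (x (n + (0, 1))))].

Arguments wang_shift {C} T.

Definition tilesU_seq : seq (wang_tile color) := [::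
  (cF, cO, cJ, cO); (cF, cO, cH, cL); (cJ, cM, cF, cP); (cD, cM, cF, cK);
  (cH, cP, cJ, cP); (cH, cP, cH, cN); (cH, cK, cF, cP); (cH, cK, cD, cP);
  (cB, cO, cI, cO); (cG, cL, cE, cO); (cG, cL, cC, cL); (cA, cL, cI, cO);
  (cE, cP, cG, cP); (cE, cP, cI, cP); (cI, cP, cG, cK); (cI, cP, cI, cK);
  (cI, cK, cB, cM); (cI, cK, cA, cK); (cC, cN, cI, cP)].

Definition tilesU : {fset wang_tile color} := [fset t in tilesU_seq]%fset.

Fact tilesU_point : (cF, cO, cJ, cO) \in tilesU.
Proof. by rewrite in_fset; exact: mem_head. Qed.

HB.instance Definition _ := isPointed.Build tilesU [` tilesU_point]%fset.

Definition phi (R : realType) : R := (1 + Num.sqrt 5) / 2.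

Definition alpha (R : realType) : R := phi R ^- 2.

Definition rotU (R : realType) (n : Z2) (x : torus R) : torus R :=
  x + \pi_(torus R)%qT (alpha R * n.1%:~R, alpha R * n.2%:~R).

(* The convex hull of the vertices vs; every polygon below is convex. *)
Definition polygon (R : realType) (vs : seq (R * R)) : set (R * R) :=
  [set x | exists t : 'I_(size vs) -> R,
    [/\ forall i, 0 <= t i, \sum_i t i = 1,
        x.1 = \sum_i t i * (vs`_i).1 & x.2 = \sum_i t i * (vs`_i).2]].

Definition torus_polygon (R : realType) (vs : seq (R * R)) : set (torus R) :=
  \pi_(torus R)%qT @` (polygon vs)°.

(* The atoms Y_i are indexed by the colors A to J and the atoms Z_j by the
   colors K to P; the remaining indices get an empty list of vertices, whose
   polygon is empty. *)
Definition atomY (R : realType) (c : color) : set (torus R) :=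
  let a := alpha R in
  torus_polygon match c with
  | cA => [:: (0, 2 * a); (a, a); (0, 1)]
  | cB => [:: (0, a); (a, a); (0, 2 * a)]
  | cC => [:: (2 * a, 1); (1, 2 * a); (1, 1)]
  | cD => [:: (a, 0); (1 - a, 0); (a, a)]
  | cE => [:: (1, a); (1, 2 * a); (2 * a, 1); (1 - a, 1)]
  | cF => [:: (0, 0); (a, 0); (a, a); (0, a)]
  | cG => [:: (a, a); (a, 1); (0, 1)]
  | cH => [:: (2 * a, 0); (1, 0); (1, a); (a, a)]
  | cI => [:: (a, a); (1, a); (1 - a, 1); (a, 1)]
  | cJ => [:: (1 - a, 0); (2 * a, 0); (a, a)]
  | _ => [::]
  end.

Definition atomZ (R : realType) (c : color) : set (torus R) :=
  let a := alpha R in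
  torus_polygon match c with
  | cK => [:: (2 * a, 0); (1, 0); (a, 1); (a, a)]
  | cL => [:: (a, a); (a, 1); (0, 1); (0, 2 * a)]
  | cM => [:: (a, 0); (2 * a, 0); (a, a)]
  | cN => [:: (2 * a, 1); (1, 2 * a); (1, 1)]
  | cO => [:: (0, 0); (a, 0); (a, a); (0, 2 * a)]
  | cP => [:: (1, 0); (1, 2 * a); (2 * a, 1); (a, 1)]
  | _ => [::]
  end.

Arguments atomY : clear implicits.
Arguments atomZ : clear implicits.

Definition partitionU (R : realType) (u : tilesU) : set (torus R) :=
  let t := val u in
  atomY R (right_color t) `&` atomZ R (top_color t) `&`
  (rotU (1, 0) @` atomY R (left_color t)) `&`
  (rotU (0, 1) @` atomZ R (bottom_color t)).

(* Main.v *)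
Require Import Defs.
From HB Require Import structures.
From mathcomp Require Import all_boot all_order all_algebra.
From mathcomp Require Import finmap.
From mathcomp Require Import all_classical all_reals all_analysis measurable_realfun.
From Stdlib Require Import BinInt.
From mathcomp Require Import ring lra ssrZ zify.
Import Order.TTheory GRing.Theory Num.Theory.
Import numFieldNormedType.Exports.

(** The atoms of the partition are bounded by lines on which one of the four
    forms x1, x2, x1 + x2 and (2 - alpha) x1 + x2 takes a value in Z[alpha].
    Hence a point x of the plane together with a direction v that is parallel
    to none of these lines, thought of as x displaced infinitesimally towards
    v, lies strictly on one side of each of them. It has a well defined tile,
    and reading the tiles along its orbit gives a configuration code x v. The
    whole theorem follows from a description of the Wang shift Omega: its
    elements are the codes, and it is enough to take v among eight
    directions, one in each sector between the four lines.

    That codes are tilings is built into the definition of the tiles. The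
    converse comes from self-similarity. There is an inflation, which replaces
    each tile by a rectangle of one or two by one or two tiles, such that
    every tiling is the image of another tiling (desubstitution). On the
    torus the same inflation is performed by the affine contraction
    x |-> (1 - alpha)(1 - x), which maps orbits of the rotation into orbits
    (realized_inflate). Two desubstitutions roughly halve the size of a
    window, so that each finite window of a tiling comes from a block of size
    two by two. There are 50 blocks left after an elementary elimination, and
    all of them are exhibited along an orbit (blocks_seen). Therefore every
    window of a tiling is seen along an orbit (realized_all), the language of
    Omega is the set of allowed patterns, and Omega is the symbolic dynamical
    system (symbolic_systemE).

    The finite facts about the partition are checked by computation. They are
    expressed as decision trees, which inspect a point only by asking on which
    side of a line with threshold in Z[alpha] it lies; verify explores such a
    tree, discarding the answers that contradict the linear relations between
    the four forms, and verifyP transfers the result to displaced points.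

    The remaining parts are soft. By compactness of the torus each element w
    of Omega is code x v for a point x = f w and one of the eight directions
    (Omega_code). Orbits are dense because Z[alpha] is dense in the real line:
    this gives minimality, and it makes any two elements of a fiber of f
    proximal, so that every equicontinuous factor factors through f
    (factor_unique). Two directions give the same code at x exactly when they
    are on the same side of the lines through x along which the form has a
    value in Z[alpha] (code_dir8). The number of such lines is 0, 1 or 4, as
    2 - alpha is a unit of Z[alpha], and the fibers have 1, 2 or 8 elements.
    Finally, a probability on the torus that is invariant under the rotations
    is invariant under all translations by semicontinuity (rotation_haar),
    hence unique by a convolution argument (haar_unique); it gives measure 0
    to the lines just mentioned, which have infinitely many disjoint
    translates (haar_line). Outside of them f is injective, and its inverse
    coding is a Borel map, so that an invariant probability on Omega is the
    image of the Haar probability and f is an isomorphism. *)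

Set Implicit Arguments.
Unset Strict Implicit.
Unset Printing Implicit Defensive.

(* The binary integers rebind this delimiter. *)
Delimit Scope nat_scope with N.
Local Open Scope classical_set_scope.
Local Open Scope ring_scope.

(** * The ring Z[alpha] *)

(** (p, q) stands for p + q alpha. Binary integers make the finite
    verifications below computable. *)
Definition knum : Type := (Z * Z)%type.
Definition kvec : Type := (knum * knum)%type.

Definition kadd (s t : knum) : knum := (Z.add s.1 t.1, Z.add s.2 t.2).
Definition kopp (s : knum) : knum := (Z.opp s.1, Z.opp s.2).
Definition ksub (s t : knum) : knum := kadd s (kopp t).
(** From alpha^2 = 3 alpha - 1. *)
Definition kmul (s t : knum) : knum :=
  (Z.sub (Z.mul s.1 t.1) (Z.mul s.2 t.2),
   Z.add (Z.add (Z.mul s.1 t.2) (Z.mul s.2 t.1)) (Z.mul 3 (Z.mul s.2 t.2))).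
Definition kint (z : Z) : knum := (z, Z0).
Notation k0 := (kint 0).
Notation k1 := (kint 1).
Definition kalpha : knum := (Z0, Zpos xH).
Definition kphi : knum := (Zpos 2, Zneg 1).
Definition kphiV : knum := (Zpos 1, Zneg 1).

(** A sound but incomplete test: alpha is replaced by one of the Fibonacci
    quotients 144/377 and 233/610 that enclose it. *)
Definition kgt0 (s : knum) : bool :=
  if Z.leb 0 s.2 then Z.ltb 0 (Z.add (Z.mul 377 s.1) (Z.mul 144 s.2))
  else Z.ltb 0 (Z.add (Z.mul 610 s.1) (Z.mul 233 s.2)).
Definition kge0 (s : knum) : bool :=
  kgt0 s || Z.eqb s.1 0 && Z.eqb s.2 0.

Definition zr (R : realType) (z : Z) : R := (int_of_Z z)%:~R.
Definition kr (R : realType) (s : knum) : R := zr R s.1 + zr R s.2 * alpha R.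

Section Alpha.
Context (R : realType).
Local Notation a := (alpha R).

Lemma phi_sqr : phi R ^+ 2 = phi R + 1.
Proof.
have h : Num.sqrt (5 : R) ^+ 2 = 5 by rewrite sqr_sqrtr.
by rewrite /phi; field: h.
Qed.

Lemma phi_ge1 : 1 <= phi R.
Proof.
have : 1 <= Num.sqrt (5 : R) by rewrite -[X in X <= _]sqrtr1 ler_sqrt; lra.
rewrite /phi; lra.
Qed.

Lemma phi_alpha : phi R = 2 - a.
Proof.
have p1 := phi_ge1; have e := phi_sqr.
rewrite /alpha; apply: (mulfI (_ : phi R ^+ 2 != 0)); first by nra.
rewrite mulrBr divff; last by nra.
rewrite e; nra.
Qed.

Lemma alpha_sqr : a ^+ 2 = 3 * a - 1.
Proof. have := phi_sqr; rewrite phi_alpha; nra. Qed.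

Lemma alpha_le1 : a <= 1.
Proof. have := phi_ge1; rewrite phi_alpha; lra. Qed.

Lemma alpha_bounds : 144 / 377 < a /\ a < 233 / 610.
Proof. have e := alpha_sqr; have l := alpha_le1; split; nra. Qed.

Lemma zr0 : zr R 0 = 0. Proof. by []. Qed.
Lemma zr1 : zr R 1 = 1. Proof. by []. Qed.
Lemma zrD x y : zr R (Z.add x y) = zr R x + zr R y.
Proof. by rewrite /zr -rmorphD /=; congr (_%:~R); lia. Qed.
Lemma zrN x : zr R (Z.opp x) = - zr R x.
Proof. by rewrite /zr -rmorphN /=; congr (_%:~R); lia. Qed.
Lemma zrM x y : zr R (Z.mul x y) = zr R x * zr R y.
Proof. by rewrite /zr -rmorphM /=; congr (_%:~R); lia. Qed.
Lemma zr_lt x y : Z.ltb x y -> zr R x < zr R y.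
Proof. by move=> h; rewrite /zr ltr_int; lia. Qed.
Lemma zr_le x y : Z.leb x y -> zr R x <= zr R y.
Proof. by move=> h; rewrite /zr ler_int; lia. Qed.

Lemma krD s t : kr R (kadd s t) = kr R s + kr R t.
Proof. by rewrite /kr /= !zrD; ring. Qed.
Lemma krN s : kr R (kopp s) = - kr R s.
Proof. by rewrite /kr /= !zrN; ring. Qed.
Lemma krB s t : kr R (ksub s t) = kr R s - kr R t.
Proof. by rewrite krD krN. Qed.
Lemma krM s t : kr R (kmul s t) = kr R s * kr R t.
Proof.
have e := alpha_sqr; case: s t => [p q] [r u].
rewrite /kr /kmul; cbn [fst snd]; rewrite /Z.sub !(zrD, zrN, zrM).
have -> : zr R 3 = 3 by [].
by ring: e.
Qed.
Lemma kr_int z : kr R (kint z) = zr R z.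
Proof. by rewrite /kr /= zr0 mul0r addr0. Qed.
Lemma kr_alpha : kr R kalpha = a.
Proof. by rewrite /kr /= zr0 add0r zr1 mul1r. Qed.
Lemma kr_phi : kr R kphi = 2 - a.
Proof.
have z2 : zr R 2 = 2 by [].
have zN1 : zr R (-1) = -1 by [].
by rewrite /kr /= z2 zN1 mulN1r.
Qed.
Lemma kr_phiV : kr R kphiV = 1 - a.
Proof.
have zN1 : zr R (-1) = -1 by [].
by rewrite /kr /= zr1 zN1 mulN1r.
Qed.

Lemma kgt0P s : kgt0 s -> 0 < kr R s.
Proof.
have [a1 a2] := alpha_bounds; case: s => p q; rewrite /kgt0 /kr; cbn [fst snd].
have z377 : zr R 377 = 377 by [].
have z144 : zr R 144 = 144 by [].
have z610 : zr R 610 = 610 by [].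
have z233 : zr R 233 = 233 by [].
case: ifP => [hq|/negbT hq] h; have := zr_lt h; rewrite zrD !zrM zr0.
  have := zr_le hq; rewrite zr0 z377 z144 => q0; nra.
have /zr_le : Z.leb q 0 by lia.
rewrite zr0 z610 z233 => q0; nra.
Qed.

Lemma kge0P s : kge0 s -> 0 <= kr R s.
Proof.
case/orP=> [/kgt0P/ltW//|]; rewrite /kr => /andP[h1 h2].
have -> : s.1 = Z0 by lia.
have -> : s.2 = Z0 by lia.
by rewrite zr0 mul0r addr0.
Qed.

End Alpha.

(** * Sides of lines *)

(** The four families of parallel lines that bound the atoms are the level
    sets of the forms lin dX, lin dY, lin dS and lin dG. *)
Inductive dir := dX | dY | dS | dG.

Definition klin (i : dir) (s : kvec) : knum :=
  match i with
  | dX => s.1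
  | dY => s.2
  | dS => kadd s.1 s.2
  | dG => kadd (kmul kphi s.1) s.2
  end.

Section Lex.
Context (R : realType).
Local Notation a := (alpha R).
Implicit Types (x v : (R * R)%type) (i : dir) (t : knum).

Definition lin i x : R :=
  match i with
  | dX => x.1
  | dY => x.2
  | dS => x.1 + x.2
  | dG => (2 - a) * x.1 + x.2
  end.

Definition kpt (s : kvec) : R * R := (kr R s.1, kr R s.2).

Lemma lin_kpt i (s : kvec) : lin i (kpt s) = kr R (klin i s).
Proof. by case: i => //=; rewrite krD // krM kr_phi. Qed.

Lemma linD i x y : lin i (x + y) = lin i x + lin i y.
Proof. by case: i => //=; ring. Qed.
Lemma linN i x : lin i (- x) = - lin i x.
Proof. by case: i => //=; ring. Qed.
Lemma linB i x y : lin i (x - y) = lin i x - lin i y.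
Proof. by rewrite linD linN. Qed.
Lemma linZ i c x : lin i (c *: x) = c * lin i x.
Proof. by case: i => //=; rewrite /GRing.scale/=; ring. Qed.

(** The sign of r + e epsilon, for an infinitesimal epsilon > 0. *)
Definition lexpos (r e : R) : bool := (0 < r) || (r == 0) && (0 < e).

Lemma lexposD r e r' e' :
  lexpos r e -> lexpos r' e' -> lexpos (r + r') (e + e').
Proof.
rewrite /lexpos => /orP[h|/andP[/eqP-> h]] /orP[h'|/andP[/eqP-> h']].
- by rewrite addr_gt0.
- by rewrite addr0 h.
- by rewrite add0r h'.
- by rewrite add0r eqxx addr_gt0 // orbT.
Qed.

Lemma lexposM c r e : 0 < c -> lexpos r e -> lexpos (c * r) (c * e).
Proof.
move=> c0 /orP[h|/andP[/eqP-> h]]; rewrite /lexpos; first by rewrite mulr_gt0.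
by rewrite mulr0 eqxx mulr_gt0 // orbT.
Qed.

Lemma lexposNN r e : lexpos r e -> ~~ lexpos (- r) (- e).
Proof.
rewrite /lexpos !oppr_gt0 oppr_eq0 => /orP[h|/andP[/eqP-> h]].
  by rewrite lt_gtF // gt_eqF.
by rewrite ltxx eqxx /= lt_gtF.
Qed.

Lemma lexpos_opp r e : e != 0 -> lexpos (- r) (- e) = ~~ lexpos r e.
Proof.
move=> e0; case h: (lexpos r e); first exact/negbTE/lexposNN.
move: h; rewrite /lexpos !oppr_gt0 oppr_eq0.
case: (ltgtP r 0) => //= _; case: (ltgtP e 0) e0 => //.
Qed.

Lemma lexpos_addl r e c : 0 <= c -> lexpos r e -> lexpos (r + c) e.
Proof.
move=> c0 /orP[h|/andP[/eqP-> h]]; rewrite /lexpos.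
  by rewrite ltr_wpDr.
by rewrite add0r h andbT; case: (ltgtP 0 c) c0.
Qed.

Definition transversal v := forall i, lin i v != 0.

(** The side of the line lin i = t on which x lies once it is displaced
    infinitesimally in the direction v. *)
Definition above x v i t : bool := lexpos (lin i x - kr R t) (lin i v).

(** Expressed by lexpos as well, rather than as a negation, so that bounds
    can be added by lexposD. *)
Definition below x v i t : bool := lexpos (kr R t - lin i x) (- lin i v).

Lemma belowE x v i t : transversal v -> below x v i t = ~~ above x v i t.
Proof. by move=> tv; rewrite /below -[_ - lin _ _]opprB lexpos_opp. Qed.
End Lex.

(** * Decision trees and their verification *)

(** A computation that knows a point only by asking on which side of the
    line lin i = t it lies, with t in Z[alpha]. The finite geometric facts
    are stated as trees returning a boolean. *)
Inductive dtree (A : Type) := Ret of A | Ask of dir & knum & (bool -> dtree A).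
Arguments Ret {A} _.
Arguments Ask {A} _ _ _.

Fixpoint eval A (o : dir -> knum -> bool) (t : dtree A) : A :=
  match t with Ret b => b | Ask i s k => eval o (k (o i s)) end.

Fixpoint bind A B (t : dtree A) (f : A -> dtree B) : dtree B :=
  match t with Ret b => f b | Ask i s k => Ask i s (fun b => bind (k b) f) end.

Lemma eval_bind A B o (t : dtree A) (f : A -> dtree B) :
  eval o (bind t f) = eval o (f (eval o t)).
Proof. by elim: t => //= i s k ->. Qed.

(** A lower and an upper bound for each of the four forms. *)
Definition bounds : Type :=
  ((knum * knum) * (knum * knum) * (knum * knum) * (knum * knum))%type.

Definition getb (b : bounds) (i : dir) : knum * knum :=
  match i with
  | dX => b.1.1.1 | dY => b.1.1.2 | dS => b.1.2 | dG => b.2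
  end.

Definition setb (b : bounds) (i : dir) (p : knum * knum) : bounds :=
  match i with
  | dX => (p, b.1.1.2, b.1.2, b.2)
  | dY => (b.1.1.1, p, b.1.2, b.2)
  | dS => (b.1.1, p, b.2)
  | dG => (b.1, p)
  end.

(** (s, c, i) stands for the form c lin i if s holds, and - c lin i
    otherwise. *)
Definition monomial : Type := (bool * knum * dir)%type.
Definition kphi2 := kmul kphi kphi.
Definition kphiV2 := kmul kphiV kphiV.

(** Any three of the four forms are linearly dependent, so that each form is
    in three ways a combination of two others. *)
Definition relations (i : dir) : seq (monomial * monomial) :=
  match i with
  | dX => [:: ((true, k1, dS), (false, k1, dY));
              ((true, kphi, dG), (false, kphi, dS));
              ((true, kphiV, dG), (false, kphiV, dY))]
  | dY => [:: ((true, k1, dS), (false, k1, dX));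
              ((true, k1, dG), (false, kphi, dX));
              ((true, kphi2, dS), (false, kphi, dG))]
  | dS => [:: ((true, k1, dX), (true, k1, dY));
              ((true, k1, dG), (false, kphiV, dX));
              ((true, kphiV, dG), (true, kphiV2, dY))]
  | dG => [:: ((true, kphi, dX), (true, k1, dY));
              ((true, k1, dS), (true, kphiV, dX));
              ((true, kphi, dS), (false, kphiV, dY))]
  end.

Definition mono_up (b : bounds) (m : monomial) : knum :=
  let: (s, c, j) := m in
  if s then kmul c (getb b j).2 else kopp (kmul c (getb b j).1).
Definition mono_lo (b : bounds) (m : monomial) : knum :=
  let: (s, c, j) := m in
  if s then kmul c (getb b j).1 else kopp (kmul c (getb b j).2).

(** Interval arithmetic on the three decompositions of lin i; this is all
    that is needed to prune the trees below. *)
Definition never_above (b : bounds) (i : dir) (t : knum) : bool :=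
  kge0 (ksub t (getb b i).2) ||
  has (fun r => kge0 (ksub t (kadd (mono_up b r.1) (mono_up b r.2))))
    (relations i).
Definition never_below (b : bounds) (i : dir) (t : knum) : bool :=
  kge0 (ksub (getb b i).1 t) ||
  has (fun r => kge0 (ksub (kadd (mono_lo b r.1) (mono_lo b r.2)) t))
    (relations i).

(** Explores the leaves that the known bounds do not rule out. A question
    that both answers survive refines the bounds. *)
Fixpoint verify (b : bounds) (t : dtree bool) : bool :=
  match t with
  | Ret r => r
  | Ask i s k =>
    if never_above b i s then verify b (k false)
    else if never_below b i s then verify b (k true)
    else if verify (setb b i (s, (getb b i).2)) (k true)
         then verify (setb b i ((getb b i).1, s)) (k false) else false
  end.

Section Soundness.
Context (R : realType).
Implicit Types (x v : (R * R)%type) (i : dir) (t : knum) (b : bounds).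

Definition bounded_by b x v :=
  forall i, above x v i (getb b i).1 /\ below x v i (getb b i).2.

Definition mono_val x (m : monomial) : R :=
  let: (s, c, j) := m in (if s then kr R c else - kr R c) * lin j x.
Definition mono_pos (m : monomial) : bool := kgt0 m.1.2.

Lemma relations_pos i :
  all (fun r => mono_pos r.1 && mono_pos r.2) (relations i).
Proof. by case: i. Qed.

Lemma relationsE i x r : List.In r (relations i) ->
  lin i x = mono_val x r.1 + mono_val x r.2.
Proof.
have e := alpha_sqr R.
by case: i => /= -[<-|[<-|[<-|//]]]; 
  rewrite /mono_val /kphi2 /kphiV2; cbn [fst snd];
  rewrite ?krM ?kr_phi ?kr_phiV ?kr_int ?zr1 /lin; ring: e.
Qed.

Lemma mono_upP b x v m : bounded_by b x v -> mono_pos m ->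
  lexpos (kr R (mono_up b m) - mono_val x m) (- mono_val v m).
Proof.
case: m => [[[] c] j] hb /kgt0P-/(_ R) /= c0; have [ha hl] := hb j.
  by rewrite krM -mulrBr -mulrN; exact: lexposM.
rewrite krN krM !mulNr opprK addrC -mulrBr opprK; exact: lexposM.
Qed.

Lemma mono_loP b x v m : bounded_by b x v -> mono_pos m ->
  lexpos (mono_val x m - kr R (mono_lo b m)) (mono_val v m).
Proof.
case: m => [[[] c] j] hb /kgt0P-/(_ R) /= c0; have [ha hl] := hb j.
  by rewrite krM -mulrBr; exact: lexposM.
rewrite krN krM !mulNr opprK addrC -mulrBr -mulrN; exact: lexposM.
Qed.

Lemma not_never_above b x v i t : transversal v -> bounded_by b x v ->
  above x v i t -> ~~ never_above b i t.
Proof.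
move=> tv hb ha; apply/negP => /orP[/(kge0P R)|/(has_nthP ((true, k0, dX), (true, k0, dX)))].
  rewrite krB => h; have [_] := hb i; rewrite belowE // => /negP; apply.
  have := lexpos_addl h ha; rewrite /above.
  by congr (is_true (lexpos _ _)); ring.
move=> [n ns /(kge0P R)]; set r := nth _ _ _; rewrite krB krD => h.
have rin : List.In r (relations i).
  by move: ns @r {h}; case: (i) => /=; case: n => [|[|[|n]]] //= _; auto.
have /andP[p1 p2] : mono_pos r.1 && mono_pos r.2.
  exact: (all_nthP _ (relations_pos i)).
have := lexposD (mono_upP hb p1) (mono_upP hb p2).
move=> /(lexposD ha)/(lexpos_addl h).
rewrite /lexpos !(relationsE _ rin).
set u := (X in 0 < X); set w := (X in _ && (0 < X)).
have -> : u = 0 by rewrite /u; ring.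
have -> : w = 0 by rewrite /w; ring.
by rewrite ltxx andbF.
Qed.

Lemma not_never_below b x v i t : transversal v -> bounded_by b x v ->
  below x v i t -> ~~ never_below b i t.
Proof.
move=> tv hb ha; apply/negP => /orP[/(kge0P R)|/(has_nthP ((true, k0, dX), (true, k0, dX)))].
  rewrite krB => h; have [+ _] := hb i; apply/negP; rewrite -belowE //.
  have := lexpos_addl h ha; rewrite /below.
  by congr (is_true (lexpos _ _)); ring.
move=> [n ns /(kge0P R)]; set r := nth _ _ _; rewrite krB krD => h.
have rin : List.In r (relations i).
  by move: ns @r {h}; case: (i) => /=; case: n => [|[|[|n]]] //= _; auto.
have /andP[p1 p2] : mono_pos r.1 && mono_pos r.2.
  exact: (all_nthP _ (relations_pos i)).
have := lexposD (mono_loP hb p1) (mono_loP hb p2).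
move=> /(lexposD ha)/(lexpos_addl h).
rewrite /lexpos !(relationsE _ rin).
set u := (X in 0 < X); set w := (X in _ && (0 < X)).
have -> : u = 0 by rewrite /u; ring.
have -> : w = 0 by rewrite /w; ring.
by rewrite ltxx andbF.
Qed.

Lemma bounded_by_setb b x v i p : bounded_by b x v ->
  above x v i p.1 -> below x v i p.2 -> bounded_by (setb b i p) x v.
Proof.
by move=> hb h1 h2 j; have := hb j; case: i h1 h2; case: j => //=.
Qed.

(** As lexpos is compatible with sums and positive multiples, the bounds can
    be propagated for the displaced point, and strict and weak inequalities
    need not be distinguished. *)
Lemma verifyP b x v (t : dtree bool) : transversal v -> bounded_by b x v ->
  verify b t -> eval (above x v) t.
Proof.
move=> tv; elim: t b => //= i s k IH b hb; have [h1 h2] := hb i.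
case: ifPn => [na|_].
  case E: (above x v i s); last exact: IH.
  by have := not_never_above tv hb E; rewrite na.
case: ifPn => [nb|_].
  case E: (above x v i s); first exact: IH.
  have : below x v i s by rewrite belowE ?E.
  by move=> /(not_never_below tv hb); rewrite nb.
case: ifP => // v1 v2; case E: (above x v i s).
  by apply: IH v1; apply: bounded_by_setb.
by apply: IH v2; apply: bounded_by_setb => //=; rewrite belowE ?E.
Qed.

End Soundness.

(** * Cells, tiles and the inflation *)

Definition tileC : Type := wang_tile color.

(** (i, t, s) is the half-plane where lin i exceeds t if s holds, and the
    opposite one otherwise. *)
Definition halfplane : Type := (dir * knum * bool)%type.

Notation kn p q := (p%Z, q%Z) (only parsing).

(** The polygons of atomY and atomZ, with coordinates in Z[alpha]. *)
Definition cell_vertices (c : color) : seq kvec :=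
  match c with
  | cA => [:: (kn 0 0, kn 0 2); (kn 0 1, kn 0 1); (kn 0 0, kn 1 0)]
  | cB => [:: (kn 0 0, kn 0 1); (kn 0 1, kn 0 1); (kn 0 0, kn 0 2)]
  | cC => [:: (kn 0 2, kn 1 0); (kn 1 0, kn 0 2); (kn 1 0, kn 1 0)]
  | cD => [:: (kn 0 1, kn 0 0); (kn 1 (-1), kn 0 0); (kn 0 1, kn 0 1)]
  | cE => [:: (kn 1 0, kn 0 1); (kn 1 0, kn 0 2); (kn 0 2, kn 1 0);
              (kn 1 (-1), kn 1 0)]
  | cF => [:: (kn 0 0, kn 0 0); (kn 0 1, kn 0 0); (kn 0 1, kn 0 1);
              (kn 0 0, kn 0 1)]
  | cG => [:: (kn 0 1, kn 0 1); (kn 0 1, kn 1 0); (kn 0 0, kn 1 0)]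
  | cH => [:: (kn 0 2, kn 0 0); (kn 1 0, kn 0 0); (kn 1 0, kn 0 1);
              (kn 0 1, kn 0 1)]
  | cI => [:: (kn 0 1, kn 0 1); (kn 1 0, kn 0 1); (kn 1 (-1), kn 1 0);
              (kn 0 1, kn 1 0)]
  | cJ => [:: (kn 1 (-1), kn 0 0); (kn 0 2, kn 0 0); (kn 0 1, kn 0 1)]
  | cK => [:: (kn 0 2, kn 0 0); (kn 1 0, kn 0 0); (kn 0 1, kn 1 0);
              (kn 0 1, kn 0 1)]
  | cL => [:: (kn 0 1, kn 0 1); (kn 0 1, kn 1 0); (kn 0 0, kn 1 0);
              (kn 0 0, kn 0 2)]
  | cM => [:: (kn 0 1, kn 0 0); (kn 0 2, kn 0 0); (kn 0 1, kn 0 1)]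
  | cN => [:: (kn 0 2, kn 1 0); (kn 1 0, kn 0 2); (kn 1 0, kn 1 0)]
  | cO => [:: (kn 0 0, kn 0 0); (kn 0 1, kn 0 0); (kn 0 1, kn 0 1);
              (kn 0 0, kn 0 2)]
  | cP => [:: (kn 1 0, kn 0 0); (kn 1 0, kn 0 2); (kn 0 2, kn 1 0);
              (kn 0 1, kn 1 0)]
  end.

(** The sides of these polygons in the same order: each side joins the
    vertex of the same rank to the next one. *)
Definition cell_sides (c : color) : seq halfplane :=
  match c with
  | cA => [:: (dS, kn 0 2, true); (dG, kn 1 0, false); (dX, k0, true)]
  | cB => [:: (dY, kn 0 1, true); (dS, kn 0 2, false); (dX, k0, true)]
  | cC => [:: (dS, kn 1 2, true); (dX, k1, false); (dY, k1, false)]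
  | cD => [:: (dY, k0, true); (dG, k1, false); (dX, kn 0 1, true)]
  | cE => [:: (dX, k1, false); (dS, kn 1 2, false); (dY, k1, false);
              (dG, kn 2 0, true)]
  | cF => [:: (dY, k0, true); (dX, kn 0 1, false); (dY, kn 0 1, false);
              (dX, k0, true)]
  | cG => [:: (dX, kn 0 1, false); (dY, k1, false); (dG, k1, true)]
  | cH => [:: (dY, k0, true); (dX, k1, false); (dY, kn 0 1, false);
              (dS, kn 0 2, true)]
  | cI => [:: (dY, kn 0 1, true); (dG, kn 2 0, false); (dY, k1, false);
              (dX, kn 0 1, true)]
  | cJ => [:: (dY, k0, true); (dS, kn 0 2, false); (dG, k1, true)]
  | cK => [:: (dY, k0, true); (dG, kn 2 (-1), false); (dX, kn 0 1, true);
              (dS, kn 0 2, true)]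
  | cL => [:: (dX, kn 0 1, false); (dY, k1, false); (dX, k0, true);
              (dS, kn 0 2, true)]
  | cM => [:: (dY, k0, true); (dS, kn 0 2, false); (dX, kn 0 1, true)]
  | cN => [:: (dS, kn 1 2, true); (dX, k1, false); (dY, k1, false)]
  | cO => [:: (dY, k0, true); (dX, kn 0 1, false); (dS, kn 0 2, false);
              (dX, k0, true)]
  | cP => [:: (dX, k1, false); (dS, kn 1 2, false); (dY, k1, false);
              (dG, kn 2 (-1), true)]
  end.

Definition colorsY := [:: cA; cB; cC; cD; cE; cF; cG; cH; cI; cJ].
Definition colorsZ := [:: cK; cL; cM; cN; cO; cP].

Fixpoint inside (hs : seq halfplane) : dtree bool :=
  match hs with
  | [::] => Ret true
  | (i, t, s) :: hs' =>
    Ask i t (fun b => if b == s then inside hs' else Ret false)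
  end.

(** The value c0 is reached only by points that are in none of the cells,
    which check_cells excludes on the unit square. *)
Fixpoint locate (c0 : color) (cs : seq color) : dtree color :=
  match cs with
  | [::] => Ret c0
  | c :: cs' =>
    bind (inside (cell_sides c)) (fun b => if b then Ret c else locate c0 cs')
  end.

Definition locateY := locate cA colorsY.
Definition locateZ := locate cK colorsZ.

(** Shift c is x |-> x + c, and Fold c is x |-> c - (1 - alpha) x. *)
Inductive amap := Shift of kvec | Fold of kvec.

Definition kvadd (c d : kvec) : kvec := (kadd c.1 d.1, kadd c.2 d.2).

Definition amap_shift (m : amap) (d : kvec) : amap :=
  match m with Shift c => Shift (kvadd c d) | Fold c => Fold (kvadd c d) end.

(** The question asked about the image of the point by m. For Fold c the
    threshold is multiplied by 2 - alpha, the inverse of 1 - alpha, and the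
    answer is reversed. *)
Definition ask_via (A : Type) (m : amap) (i : dir) (t : knum)
    (k : bool -> dtree A) : dtree A :=
  match m with
  | Shift c => Ask i (ksub t (klin i c)) k
  | Fold c => Ask i (kmul kphi (ksub (klin i c) t)) (fun b => k (~~ b))
  end.

Fixpoint pull (A : Type) (m : amap) (t : dtree A) : dtree A :=
  match t with
  | Ret r => Ret r
  | Ask i s k => ask_via m i s (fun b => pull m (k b))
  end.

Fixpoint floor_tree (m : amap) (i : dir) (zs : seq Z) : dtree (option Z) :=
  match zs with
  | [::] => Ret None
  | z :: zs' =>
    ask_via m i (kint z) (fun b => if b then
      ask_via m i (kint (Z.add z 1)) (fun b' =>
        if b' then floor_tree m i zs' else Ret (Some z))
      else Ret None)
  end.

(** The integer parts that the maps considered below can produce on the unit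
    square. *)
Definition small_ints : seq Z := [:: (-2)%Z; (-1)%Z; 0%Z; 1%Z; 2%Z].

Definition color_tree (m : amap) (t : dtree color) : dtree (option color) :=
  bind (floor_tree m dX small_ints) (fun o1 =>
  bind (floor_tree m dY small_ints) (fun o2 =>
  match o1, o2 with
  | Some z1, Some z2 =>
    bind (pull (amap_shift m (kint (Z.opp z1), kint (Z.opp z2))) t)
         (fun c => Ret (Some c))
  | _, _ => Ret None
  end)).

Definition back1 (m : amap) := amap_shift m (kopp kalpha, k0).
Definition back2 (m : amap) := amap_shift m (k0, kopp kalpha).

Definition tile_tree (m : amap) : dtree (option tileC) :=
  bind (color_tree m locateY) (fun o1 =>
  bind (color_tree m locateZ) (fun o2 =>
  bind (color_tree (back1 m) locateY) (fun o3 =>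
  bind (color_tree (back2 m) locateZ) (fun o4 =>
  match o1, o2, o3, o4 with
  | Some c1, Some c2, Some c3, Some c4 => Ret (Some (c1, c2, c3, c4))
  | _, _, _, _ => Ret None
  end)))).

Definition unit_bounds : bounds :=
  ((k0, k1), (k0, k1), (k0, kn 2 0), (k0, kn 3 (-1))).

Definition idmap : amap := Shift (k0, k0).

Definition tileU (k : nat) : tileC := nth (cF, cO, cJ, cO) tilesU_seq k.

(** Two by two tiles: bottom left, bottom right, top left, top right. *)
Definition block : Type := (tileC * tileC * tileC * tileC)%type.
Definition get_block (q : block) (s t : bool) : tileC :=
  match s, t with
  | false, false => q.1.1.1 | true, false => q.1.1.2
  | false, true => q.1.2 | true, true => q.2
  end.

(** The inflation, given by the ranks in tilesU_seq of the tiles of each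
    image. The image of u is one tile wide if vbit u holds, and one tile
    high if hbit u holds; the entries beyond are filled with 0. *)
Definition omega_table : seq (nat * nat * nat * nat) := [::
  (17, 0, 0, 0); (16, 0, 0, 0); (15, 11, 0, 0); (13, 9, 0, 0);
  (17, 8, 0, 0); (16, 8, 0, 0); (15, 8, 0, 0); (14, 8, 0, 0);
  (14, 0, 6, 0); (17, 0, 3, 0); (16, 0, 3, 0); (14, 0, 2, 0);
  (15, 11, 7, 1); (14, 11, 6, 1); (13, 9, 7, 1); (12, 9, 6, 1);
  (18, 10, 5, 1); (13, 9, 4, 1); (14, 8, 2, 0)]%N.

Definition omega (u : tileC) : block :=
  let q := nth (0, 0, 0, 0)%N omega_table (index u tilesU_seq) in
  (tileU q.1.1.1, tileU q.1.1.2, tileU q.1.2, tileU q.2).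

(** These right colors are those of the cells inside x1 < alpha, and those
    of hbit are the colors of the cells inside x2 < alpha. *)
Definition vbit (t : tileC) : bool :=
  match right_color t with cA | cB | cF | cG => true | _ => false end.
Definition hbit (t : tileC) : bool :=
  match right_color t with cD | cF | cH | cJ => true | _ => false end.

Fixpoint allt (A : Type) (f : A -> dtree bool) (s : seq A) : dtree bool :=
  match s with
  | [::] => Ret true
  | x :: s' => bind (f x) (fun b => if b then allt f s' else Ret false)
  end.

Definition check_cells (cs : seq color) (t : dtree color) : dtree bool :=
  bind t (fun c => allt (fun c' =>
    bind (inside (cell_sides c')) (fun b => Ret (b == (c' == c)))) cs).

Definition check_tile : dtree bool :=
  bind (tile_tree idmap) (fun o =>
  match o with
  | None => Ret false
  | Some u => Ask dX kalpha (fun b1 => Ask dY kalpha (fun b2 =>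
      Ret [&& u \in tilesU_seq, vbit u == ~~ b1 & hbit u == ~~ b2]))
  end).

(** y |-> (1 - alpha) (1 - y) - alpha s on the first coordinate, and the
    same with t on the second one. *)
Definition inflate (s t : bool) : amap :=
  Fold (ksub kphiV (if s then kalpha else k0), ksub kphiV (if t then kalpha else k0)).

(** The self-similarity of the partition. The image of y under inflate false
    false is the anchor of the supertile of y, its top right tile; the tile
    (p, q) of the supertile is one step to the left of the anchor if the
    supertile is two tiles wide and p is false, and similarly below. *)
Definition check_inflate : dtree bool :=
  bind (tile_tree idmap) (fun o =>
  match o with
  | None => Ret false
  | Some u => allt (fun p : bool * bool =>
      if (p.1 && vbit u) || (p.2 && hbit u) then Ret true else
      bind (tile_tree (inflate (~~ vbit u && ~~ p.1) (~~ hbit u && ~~ p.2)))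
        (fun o' => Ret (o' == Some (get_block (omega u) p.1 p.2))))
      [:: (false, false); (true, false); (false, true); (true, true)]
  end).

(** * The tile of a displaced point *)

Section RealTiles.
Context (R : realType).
Local Notation a := (alpha R).
Implicit Types (x v : (R * R)%type) (i : dir) (t : knum).

Lemma lexposZ (r e c : R) : 0 < c -> lexpos (c * r) e = lexpos r e.
Proof. by move=> c0; rewrite /lexpos pmulr_rgt0 // mulf_eq0 gt_eqF. Qed.

(** The integer part of r + e epsilon, for an infinitesimal epsilon > 0. *)
Definition lexfloor (r e : R) : int :=
  if 0 < e then Num.floor r else - Num.floor (- r) - 1.

Lemma lexfloorP (r e : R) (z : int) : e != 0 ->
  lexpos (r - z%:~R) e && ~~ lexpos (r - (z + 1)%:~R) e = (z == lexfloor r e).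
Proof.
move=> e0; rewrite /lexfloor; have [e_gt0|e_le0] := ltP 0 e.
  have E (s : R) : lexpos s e = (0 <= s).
    by rewrite /lexpos e_gt0 andbT orbC eq_sym -le_eqVlt.
  rewrite !E !subr_ge0 -ltNge; apply/idP/eqP => [/floor_def->//|->].
  exact: floor_itv.
have E (s : R) : lexpos s e = (0 < s).
  by rewrite /lexpos [0 < e]ltNge e_le0 andbF orbF.
rewrite !E !subr_gt0 -leNgt; apply/idP/eqP => [h|->].
  have -> : Num.floor (- r) = - z - 1.
    apply: floor_def; rewrite subrK -opprD !rmorphN /= lerN2 ltrN2.
    by rewrite andbC.
  lia.
have := floor_itv (- r); set f := Num.floor _.
rewrite subrK -opprB opprK !rmorphN /= rmorphD /=; lra.
Qed.

Lemma lexfloorD (r e : R) (z : int) : e != 0 ->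
  lexfloor (r + z%:~R) e = lexfloor r e + z.
Proof.
move=> e0; apply/esym/eqP; rewrite -lexfloorP //.
have := lexfloorP r (lexfloor r e) e0; rewrite eqxx => /andP[h1 h2].
apply/andP; split; [move: h1|move: h2];
  congr (is_true _); rewrite ?[in RHS]rmorphD /= ?[in RHS]rmorphD /=;
  do ?[congr (~~ _)]; congr lexpos; rewrite ?rmorphD /=; ring.
Qed.

Definition lexfrac x v : R * R :=
  (x.1 - (lexfloor x.1 v.1)%:~R, x.2 - (lexfloor x.2 v.2)%:~R).

Lemma transversal1 v : transversal v -> v.1 != 0.
Proof. exact: (fun h => h dX). Qed.
Lemma transversal2 v : transversal v -> v.2 != 0.
Proof. exact: (fun h => h dY). Qed.
Hint Resolve transversal1 transversal2 : core.

Lemma transversalN v : transversal v -> transversal (- v).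
Proof. by move=> tv i; rewrite linN oppr_eq0. Qed.

Lemma lexfrac_unique x v (z1 z2 : int) : transversal v ->
  above x v dX (kint (Z_of_int z1)) -> below x v dX (kint (Z_of_int (z1 + 1))) ->
  above x v dY (kint (Z_of_int z2)) -> below x v dY (kint (Z_of_int (z2 + 1))) ->
  lexfrac x v = (x.1 - z1%:~R, x.2 - z2%:~R).
Proof.
move=> tv; rewrite !belowE // /above !kr_int /zr !Z_of_intK /= => a1 b1 a2 b2.
rewrite /lexfrac; congr (_ - _%:~R, _ - _%:~R); apply/esym/eqP.
  by rewrite -lexfloorP ?a1 // transversal1.
by rewrite -lexfloorP ?a2 // transversal2.
Qed.

Lemma lexfrac_bounded x v : transversal v -> bounded_by unit_bounds (lexfrac x v) v.
Proof.
move=> tv.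
have h1 : lexpos (lexfrac x v).1 v.1 /\ lexpos (1 - (lexfrac x v).1) (- v.1).
  have := lexfloorP x.1 (lexfloor x.1 v.1) (transversal1 tv).
  rewrite eqxx => /andP[-> h]; split => //.
  by rewrite -opprB lexpos_opp ?transversal1 // -addrA -opprD -(rmorphD _ _ 1).
have h2 : lexpos (lexfrac x v).2 v.2 /\ lexpos (1 - (lexfrac x v).2) (- v.2).
  have := lexfloorP x.2 (lexfloor x.2 v.2) (transversal2 tv).
  rewrite eqxx => /andP[-> h]; split => //.
  by rewrite -opprB lexpos_opp ?transversal2 // -addrA -opprD -(rmorphD _ _ 1).
move: h1 h2; set y := lexfrac x v => -[p1 q1] [p2 q2].
have a1 : 0 < 2 - a by have := alpha_le1 R; lra.
have e2 : kr R (kn 2 0) = 2 by exact: (kr_int R 2).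
have e3 : kr R (kn 3 (-1)) = 3 - a.
  have -> : kn 3 (-1) = ksub (kint 3) kalpha by [].
  by rewrite krB kr_int kr_alpha.
by case; rewrite /above /below /= ?e2 ?e3 ?kr_int ?subr0 /zr /=; split => //;
  [exact: lexposD|have := lexposD q1 q2|
   exact: (lexposD (lexposM a1 p1) p2)|have := lexposD (lexposM a1 q1) q2];
  congr (is_true (lexpos _ _)); rewrite ?mulrN ?opprD //; ring.
Qed.

Definition lattice_eq x y := exists z1 z2 : int, x = y + (z1%:~R, z2%:~R).

Lemma lexfrac_eq x y v : transversal v -> lattice_eq x y ->
  lexfrac x v = lexfrac y v.
Proof.
move=> tv [z1 [z2 ->]]; rewrite /lexfrac /= !lexfloorD ?rmorphD /=; first last.
- exact: transversal1. 
- exact: transversal2.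
by congr (_, _); ring.
Qed.

Lemma lexfrac_lattice x v : lattice_eq (lexfrac x v) x.
Proof.
exists (- lexfloor x.1 v.1), (- lexfloor x.2 v.2).
by rewrite /lexfrac !rmorphN.
Qed.

Definition mpt (m : amap) x : R * R :=
  match m with Shift c => x + kpt R c | Fold c => kpt R c - (1 - a) *: x end.
Definition mdir (m : amap) v : R * R :=
  match m with Shift _ => v | Fold _ => - v end.

Lemma mpt_shift m d x : mpt (amap_shift m d) x = mpt m x + kpt R d.
Proof.
have kD c : kpt R (kvadd c d) = kpt R c + kpt R d by rewrite /kpt /= !krD.
by case: m => c /=; rewrite kD; ring.
Qed.
Lemma mdir_shift m d v : mdir (amap_shift m d) v = mdir m v.
Proof. by case: m. Qed.
Lemma transversal_mdir m v : transversal v -> transversal (mdir m v).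
Proof. by case: m => //= c; exact: transversalN. Qed.

Lemma eval_ask_via A m i t (k : bool -> dtree A) x v : transversal v ->
  eval (above x v) (ask_via m i t k) =
  eval (above x v) (k (above (mpt m x) (mdir m v) i t)).
Proof.
move=> tv; case: m => c /=.
  congr (eval (above x v) (k _)); rewrite /above linD lin_kpt krB; congr lexpos; ring.
congr (eval (above x v) (k _)); rewrite -belowE // /below /above krM krB kr_phi.
rewrite linB lin_kpt linZ linN.
have e := alpha_sqr R; have a1 : 0 < 2 - a by have := alpha_le1 R; lra.
rewrite -[RHS](@lexposZ _ _ (2 - a)) //; congr lexpos; ring: e.
Qed.

Lemma eval_pull A m (t : dtree A) x v : transversal v ->
  eval (above x v) (pull m t) = eval (above (mpt m x) (mdir m v)) t.
Proof.
by move=> tv; elim: t => //= i s k IH; rewrite eval_ask_via // IH.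
Qed.

Lemma floor_treeP m i zs x v z : transversal v ->
  eval (above x v) (floor_tree m i zs) = Some z ->
  int_of_Z z = lexfloor (lin i (mpt m x)) (lin i (mdir m v)).
Proof.
move=> tv; elim: zs => //= z' zs IH; rewrite eval_ask_via //.
case: ifP => // h1; rewrite eval_ask_via //; case: ifP => // h2 [<-].
apply/eqP; rewrite -lexfloorP; last exact: transversal_mdir.
move: h1 (negbT h2); rewrite /above !kr_int zrD zr1 /zr => -> /=.
by rewrite rmorphD.
Qed.

Definition color_at (t : dtree color) x v : color :=
  eval (above (lexfrac x v) v) t.

Lemma color_treeP m (t : dtree color) x v c : transversal v ->
  eval (above x v) (color_tree m t) = Some c ->
  color_at t (mpt m x) (mdir m v) = c.
Proof.
move=> tv; rewrite /color_tree !eval_bind.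
case E1: (eval (above x v) (floor_tree m dX _)) => [z1|//].
case E2: (eval (above x v) (floor_tree m dY _)) => [z2|//]; rewrite eval_bind /= eval_pull //.
rewrite mdir_shift mpt_shift => -[<-]; congr (eval (above _ _) _).
rewrite /lexfrac -(floor_treeP tv E1) -(floor_treeP tv E2) /kpt /= !kr_int !zrN.
by case: mpt.
Qed.

(** The left and bottom colors are the right and top colors of the
    neighbours along the rotation, so that reading the tiles along an orbit
    gives a tiling. *)
Definition tile x v : tileC :=
  (color_at locateY x v, color_at locateZ x v,
   color_at locateY (x - (a, 0)) v, color_at locateZ (x - (0, a)) v).

(** The value None stands for an integer part that is not in small_ints. *)
Lemma tile_treeP m x v u : transversal v ->
  eval (above x v) (tile_tree m) = Some u -> tile (mpt m x) (mdir m v) = u.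
Proof.
move=> tv; rewrite /tile_tree 4!eval_bind.
case E1: (eval (above x v) (color_tree m locateY)) => [c1|];
  case E2: (eval (above x v) (color_tree m locateZ)) => [c2|];
  case E3: (eval (above x v) (color_tree (back1 m) locateY)) => [c3|];
  case E4: (eval (above x v) (color_tree (back2 m) locateZ)) => [c4|] //= -[<-].
have := color_treeP tv E1; have := color_treeP tv E2.
have := color_treeP tv E3; have := color_treeP tv E4.
rewrite /back1 /back2 !mdir_shift !mpt_shift /kpt /= !krN kr_alpha !kr_int zr0.
rewrite /tile => <- <- <- <-; congr (_, _, color_at _ _ _, color_at _ _ _).
  by congr (_ + _); rewrite -[LHS]/(- a, - 0) oppr0.
by congr (_ + _); rewrite -[LHS]/(- 0, - a) oppr0.
Qed.

Lemma tile_eq x y v : transversal v -> lattice_eq x y -> tile x v = tile y v.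
Proof.
move=> tv xy; have h (d : R * R) : lattice_eq (x - d) (y - d).
  by case: xy => z1 [z2 ->]; exists z1, z2; ring.
by rewrite /tile /color_at (lexfrac_eq tv xy) !(lexfrac_eq tv (h _)).
Qed.

End RealTiles.

(** * Desubstitution of tilings *)

Definition block_h (q r : block) : bool :=
  (q.1.1.2 == r.1.1.1) && (q.2 == r.1.2).
Definition block_v (q r : block) : bool :=
  (q.1.2 == r.1.1.1) && (q.2 == r.1.1.2).

Definition local_blocks : seq block :=
  let rows := [seq p <- allpairs (fun s t => (s, t)) tilesU_seq tilesU_seq
              | right_color p.1 == left_color p.2] in
  flatten [seq [seq (p.1, p.2, q.1, q.2) | q <- rows
               & (top_color p.1 == bottom_color q.1) &&
                 (top_color p.2 == bottom_color q.2)] | p <- rows].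

Definition windows (S : seq block) : seq (block * block * block * block) :=
  flatten [seq flatten [seq flatten [seq [seq (q, r, u, d)
    | d <- S & block_h u d && block_v r d]
    | u <- [seq u <- S | block_v q u]]
    | r <- [seq r <- S | block_h q r]]
    | q <- S].

(** Each block of a tiling occurs at the four positions of windows of size 3
    by 3 all of whose blocks occur. This necessary condition, applied twice,
    leaves 50 blocks, and blocks_seen shows that all of them do occur. *)
Definition prune (S : seq block) : seq block :=
  let W := windows S in
  let W1 := [seq w.1.1.1 | w <- W] in
  let W2 := [seq w.1.1.2 | w <- W] in
  let W3 := [seq w.1.2 | w <- W] in
  let W4 := [seq w.2 | w <- W] in
  [seq q <- S | [&& q \in W1, q \in W2, q \in W3 & q \in W4]].

Definition blocks : seq block := Eval vm_compute in
  prune (prune local_blocks).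

Lemma blocksE : blocks = prune (prune local_blocks).
Proof. by apply/eqP; vm_cast_no_check (erefl true). Qed.

(** The block q is taken at the corner of the supertile of u, whose width
    and height are given by the bits of the next column and row. *)
Definition fits (u : tileC) (q : block) : bool :=
  [&& vbit u == ~~ vbit q.1.1.2, hbit u == ~~ hbit q.1.2,
      get_block (omega u) false false == get_block q false false,
      vbit u || (get_block (omega u) true false == get_block q true false),
      hbit u || (get_block (omega u) false true == get_block q false true) &
      vbit u || hbit u ||
        (get_block (omega u) true true == get_block q true true)].

(** Supertiles begin at the columns and rows whose bit is false. *)
Definition corner (q : block) : bool := ~~ vbit q.1.1.1 && ~~ hbit q.1.1.1.

Definition desub (q : block) : tileC := head (tileU 0) [seq u <- tilesU_seq | fits u q].

(** The matching of colors along the right side of the supertile at q, which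
    is two tiles wide if the bit of the next column is true. *)
Definition seam_h (q r : block) : bool :=
  if vbit q.1.1.2 then
    (right_color q.1.1.2 == left_color r.1.1.1) &&
    (right_color q.2 == left_color r.1.2)
  else
    (right_color q.1.1.1 == left_color r.1.1.1) &&
    (right_color q.1.2 == left_color r.1.2).
Definition seam_v (q r : block) : bool :=
  if hbit q.1.2 then
    (top_color q.1.2 == bottom_color r.1.1.1) &&
    (top_color q.2 == bottom_color r.1.1.2)
  else
    (top_color q.1.1.1 == bottom_color r.1.1.1) &&
    (top_color q.1.1.2 == bottom_color r.1.1.2).

Definition check_bits (q : block) : bool :=
  [&& vbit q.1.1.1 == vbit q.1.2, hbit q.1.1.1 == hbit q.1.1.2,
      ~~ (vbit q.1.1.1 && vbit q.1.1.2) & ~~ (hbit q.1.1.1 && hbit q.1.2)].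
Definition check_desub (q : block) : bool :=
  corner q ==> (desub q \in tilesU_seq) && fits (desub q) q.
Definition check_seam (x y : block * tileC) : bool :=
  ((hbit x.1.1.2 == hbit y.1.1.2) && seam_h x.1 y.1 ==>
    (right_color x.2 == left_color y.2)) &&
  ((vbit x.1.1.1.2 == vbit y.1.1.1.2) && seam_v x.1 y.1 ==>
    (top_color x.2 == bottom_color y.2)).
Definition corners : seq (block * tileC) :=
  [seq (q, desub q) | q <- blocks & corner q].

Lemma blocks_bits : all check_bits blocks.
Proof. by vm_cast_no_check (erefl true). Qed.
Lemma blocks_desub : all check_desub blocks.
Proof. by vm_cast_no_check (erefl true). Qed.
(** Adjacent supertiles can match only if the tiles that they come from do.
    This finite check makes the desubstituted tiling valid. *)
Lemma corners_seam : all (fun x => all (check_seam x) corners) corners.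
Proof. by vm_cast_no_check (erefl true). Qed.

Lemma corners_right (q r : block) u w : (q, u) \in corners ->
  (r, w) \in corners -> hbit q.1.2 = hbit r.1.2 -> seam_h q r ->
  right_color u = left_color w.
Proof.
move=> cx cy e s; move/allP: corners_seam => /(_ _ cx)/allP/(_ _ cy).
by rewrite /check_seam e s eqxx /= => /andP[/eqP].
Qed.

Lemma corners_top (q r : block) u w : (q, u) \in corners ->
  (r, w) \in corners -> vbit q.1.1.2 = vbit r.1.1.2 -> seam_v q r ->
  top_color u = bottom_color w.
Proof.
move=> cx cy e s; move/allP: corners_seam => /(_ _ cx)/allP/(_ _ cy).
by rewrite /check_seam e s eqxx /= => /andP[_ /eqP].
Qed.

Definition tiling : Type := int -> int -> tileC.

Definition wang_valid (T : tiling) : Prop := forall i j,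
  [/\ T i j \in tilesU_seq, right_color (T i j) = left_color (T (i + 1) j) &
      top_color (T i j) = bottom_color (T i (j + 1))].

Definition block_at (T : tiling) (i j : int) : block :=
  (T i j, T (i + 1) j, T i (j + 1), T (i + 1) (j + 1)).

Lemma local_blocksP T i j : wang_valid T -> block_at T i j \in local_blocks.
Proof.
move=> val; have [u1 h1 v1] := val i j; have [u2 _ v2] := val (i + 1) j.
have [u3 h3 _] := val i (j + 1); have [u4 _ _] := val (i + 1) (j + 1).
have row (s t : tileC) : s \in tilesU_seq -> t \in tilesU_seq ->
    right_color s = left_color t ->
    (s, t) \in [seq p <- allpairs (fun s t => (s, t)) tilesU_seq tilesU_seq
              | right_color p.1 == left_color p.2].
  move=> us ut h; rewrite mem_filter; apply/andP; split; first exact/eqP.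
  exact: (allpairs_f (fun s t => (s, t))).
apply/flatten_mapP; exists (T i j, T (i + 1) j); first exact: row.
apply/mapP; exists (T i (j + 1), T (i + 1) (j + 1)) => //.
rewrite mem_filter row // andbT; apply/andP; split; exact/eqP.
Qed.

Lemma windowsP (S : seq block) T i j :
  (forall i j, block_at T i j \in S) ->
  (block_at T i j, block_at T (i + 1) j, block_at T i (j + 1),
   block_at T (i + 1) (j + 1)) \in windows S.
Proof.
move=> TS; apply/flatten_mapP; exists (block_at T i j) => //.
apply/flatten_mapP; exists (block_at T (i + 1) j).
  by rewrite mem_filter TS /block_h /= !eqxx.
apply/flatten_mapP; exists (block_at T i (j + 1)).
  by rewrite mem_filter TS /block_v /= !eqxx.
apply/mapP; exists (block_at T (i + 1) (j + 1)) => //.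
by rewrite mem_filter TS /block_h /block_v /= !eqxx.
Qed.

Lemma pruneP (S : seq block) T :
  (forall i j, block_at T i j \in S) ->
  forall i j, block_at T i j \in prune S.
Proof.
move=> TS i j; rewrite mem_filter TS andbT; apply/and4P.
have W i' j' := windowsP i' j' TS; split; apply/mapP.
- by eexists; first exact: (W i j).
- by have := W (i - 1) j; rewrite subrK => w; eexists; first exact: w.
- by have := W i (j - 1); rewrite subrK => w; eexists; first exact: w.
- by have := W (i - 1) (j - 1); rewrite !subrK => w; eexists; first exact: w.
Qed.

Lemma blocksP T i j : wang_valid T -> block_at T i j \in blocks.
Proof.
by move=> val; rewrite blocksE; do 2!apply: pruneP => ? ?; exact: local_blocksP.
Qed.

Section Enumeration.
Context (b : int -> bool).
Context (isolated : forall n, ~~ (b n && b (n + 1))).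

Let next (c : int) : int := if b (c + 1) then c + 2 else c + 1.
Let prev (c : int) : int := if b (c - 1) then c - 2 else c - 1.
Let c0 : int := if b 0 then 1 else 0.
Let C (i : int) : int :=
  match i with Posz n => iter n next c0 | Negz n => iter n.+1 prev c0 end.

Let nextN c : ~~ b (next c).
Proof.
rewrite /next; case: ifPn => // h; have := isolated (c + 1).
by rewrite h -addrA.
Qed.
Let prevN c : ~~ b c -> ~~ b (prev c).
Proof.
rewrite /prev => bc; case: ifPn => // h; have := isolated (c - 2).
by rewrite (_ : c - 2 + 1 = c - 1) ?h ?andbT //; ring.
Qed.
Let prevK c : ~~ b c -> next (prev c) = c.
Proof.
rewrite /prev /next => /negbTE bc; case E: (b (c - 1)); last by rewrite subrK bc.
by rewrite (_ : c - 2 + 1 = c - 1) ?E; ring.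
Qed.
Let CN i : ~~ b (C i).
Proof.
have b0 : ~~ b c0.
  by rewrite /c0; case: ifPn => // h; have := isolated 0; rewrite h add0r.
case: i => n; first by case: n => [|n] //; exact: nextN.
by elim: n => [|n IH]; exact: prevN.
Qed.
Let CS i : C (i + 1) = next (C i).
Proof.
case: i => [n|[|n]]; first by rewrite -PoszD addn1.
  by rewrite /= prevK // (CN 0).
rewrite (_ : Negz n.+1 + 1 = Negz n) /=; last by lia.
by rewrite prevK // (CN (Negz n)).
Qed.

(** As b never holds twice in a row, the integers where it fails are 1 or 2
    apart; C enumerates them. They will be the columns, or the rows, where
    the supertiles begin. *)
Lemma enumeration : exists C : int -> int,
  (forall i, ~~ b (C i)) /\
  (forall i, C (i + 1) = if b (C i + 1) then C i + 2 else C i + 1) /\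
  forall n, exists i, C i <= n < C (i + 1).
Proof.
exists C; split=> //; split=> [i|]; first by rewrite CS.
have lt i : C i < C (i + 1) by rewrite CS /next; case: ifP => _; lia.
have le2 i : C (i + 1) <= C i + 2 by rewrite CS /next; case: ifP => _; lia.
have up (k : nat) : exists i, C i <= c0 + k%:Z < C (i + 1).
  elim: k => [|k [i /andP[h1 h2]]]; first by exists 0; have := lt 0; rewrite /=; lia.
  have [h|h] := ltP (c0 + k.+1%:Z) (C (i + 1)); first by exists i; lia.
  by exists (i + 1); have := lt (i + 1); lia.
have down (k : nat) : exists i, C i <= c0 - k%:Z < C (i + 1).
  elim: k => [|k [i /andP[h1 h2]]]; first by exists 0; have := lt 0; rewrite /=; lia.
  have [h|h] := leP (C i) (c0 - k.+1%:Z); first by exists i; lia.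
  by exists (i - 1); rewrite subrK; have := lt (i - 1); rewrite subrK; lia.
move=> n; have [h|h] := leP c0 n.
  by have [i hi] := up (absz (n - c0)); exists i; lia.
by have [i hi] := down (absz (n - c0)); exists i; lia.
Qed.
End Enumeration.

Lemma valid_bits T i j : wang_valid T ->
  [/\ vbit (T i (j + 1)) = vbit (T i j), hbit (T (i + 1) j) = hbit (T i j),
      ~~ (vbit (T i j) && vbit (T (i + 1) j)) &
      ~~ (hbit (T i j) && hbit (T i (j + 1)))].
Proof.
move=> /(blocksP i j)/(allP blocks_bits)/and4P[/= /eqP-> /eqP-> ? ?].
by split.
Qed.

Lemma int_const (A : Type) (f : int -> A) :
  (forall i, f (i + 1) = f i) -> forall i, f i = f 0.
Proof.
move=> fS; have fN i : f (i - 1) = f i by rewrite -(fS (i - 1)) subrK.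
elim/int_rec => // n IH; first by rewrite -addn1 PoszD fS.
by rewrite -addn1 PoszD opprD fN.
Qed.

Lemma vbit_col T i j : wang_valid T -> vbit (T i j) = vbit (T i 0).
Proof.
move=> val; apply: (int_const (f := fun j => vbit (T i j))) => k.
by have [] := valid_bits i k val.
Qed.

Lemma hbit_row T i j : wang_valid T -> hbit (T i j) = hbit (T 0 j).
Proof.
move=> val; apply: (int_const (f := fun i => hbit (T i j))) => k.
by have [] := valid_bits k j val.
Qed.

Arguments omega : simpl never.
Arguments desub : simpl never.
Arguments get_block : simpl never.

(** T is the image of T' by the inflation; the bottom left tile of the
    supertile (i, j) is at (C i, D j). *)
Record desubstitutes (T T' : tiling) (C D : int -> int) : Prop := {
  desub_valid : wang_valid T';
  desub_colS : forall i j, C (i + 1) = C i + (if vbit (T' i j) then 1 else 2);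
  desub_rowS : forall i j, D (j + 1) = D j + (if hbit (T' i j) then 1 else 2);
  desub_cover_col : forall n, exists i, C i <= n < C (i + 1);
  desub_cover_row : forall n, exists j, D j <= n < D (j + 1);
  desub_col0 : forall i j, ~~ vbit (T (C i) j);
  desub_row0 : forall i j, ~~ hbit (T i (D j));
  desub_tile : forall i j p q, (p ==> ~~ vbit (T' i j)) ->
    (q ==> ~~ hbit (T' i j)) ->
    T (C i + p%:Z) (D j + q%:Z) = get_block (omega (T' i j)) p q }.

(** The blocks at the corners of the supertiles determine the tiles of T',
    and the matching of T across the seams becomes the matching of T'. *)
Lemma desubstitution T : wang_valid T ->
  exists T' C D, desubstitutes T T' C D.
Proof.
move=> val.
have iso1 n : ~~ (vbit (T n 0) && vbit (T (n + 1) 0)).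
  by have [] := valid_bits n 0 val.
have iso2 n : ~~ (hbit (T 0 n) && hbit (T 0 (n + 1))).
  by have [] := valid_bits 0 n val.
have [C [CN [CS Ccov]]] := enumeration iso1.
have [D [DN [DS Dcov]]] := enumeration iso2.
pose q i j := block_at T (C i) (D j).
have qb i j : q i j \in blocks by exact: blocksP.
have qc i j : corner (q i j).
  by rewrite /corner /= vbit_col // CN hbit_row // DN.
pose T' i j := desub (q i j).
have T'fits i j : T' i j \in tilesU_seq /\ fits (T' i j) (q i j).
  by have /implyP/(_ (qc i j))/andP[] := allP blocks_desub _ (qb i j).
have T'v i j : vbit (T' i j) = ~~ vbit (T (C i + 1) 0).
  have [_ /and5P[/eqP-> _ _ _ _]] := T'fits i j; by rewrite /= vbit_col.
have T'h i j : hbit (T' i j) = ~~ hbit (T 0 (D j + 1)).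
  have [_ /and5P[_ /eqP-> _ _ _]] := T'fits i j; by rewrite /= hbit_row.
have CE i j : C (i + 1) = C i + (if vbit (T' i j) then 1 else 2).
  by rewrite CS T'v; case: vbit.
have DE i j : D (j + 1) = D j + (if hbit (T' i j) then 1 else 2).
  by rewrite DS T'h; case: hbit.
have cin i j : (q i j, T' i j) \in corners.
  by apply/mapP; exists (q i j) => //; rewrite mem_filter qc qb.
have hT i j : right_color (T i j) = left_color (T (i + 1) j).
  by have [] := val i j.
have vT i j : top_color (T i j) = bottom_color (T i (j + 1)).
  by have [] := val i j.
have e2 (c : int) : c + 2 = c + 1 + 1 by rewrite -addrA.
clearbody T'; exists T', C, D; split => //.
  move=> i j; split; first by have [] := T'fits i j.
    apply: (corners_right (cin i j) (cin (i + 1) j)).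
      by rewrite /= !(hbit_row _ (D j + 1)).
    rewrite /seam_h /= (CE i j) T'v vbit_col //; case: vbit => /=.
      by rewrite !hT !e2 !eqxx.
    by rewrite !hT !eqxx.
  apply: (corners_top (cin i j) (cin i (j + 1))).
    by rewrite /= !(vbit_col (C i + 1)).
  rewrite /seam_v /= (DE i j) T'h hbit_row //; case: hbit => /=.
    by rewrite !vT !e2 !eqxx.
  by rewrite !vT !eqxx.
- by move=> i j; rewrite vbit_col.
- by move=> i j; rewrite hbit_row.
move=> i j p r; have [_ /and5P[_ _ /eqP f00 f10 /andP[f01 f11]]] := T'fits i j.
case: p; case: r => /=; rewrite ?addr0.
- by move=> nv nh; move: f11; rewrite (negbTE nv) (negbTE nh) => /eqP->.
- by move=> nv _; move: f10; rewrite (negbTE nv) => /eqP->.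
- by move=> _ nh; move: f01; rewrite (negbTE nh) => /eqP->.
- by rewrite f00.
Qed.

(** * Every window of a tiling occurs along an orbit *)

Lemma eval_allt A o (f : A -> dtree bool) s :
  eval o (allt f s) = all (fun x => eval o (f x)) s.
Proof. by elim: s => //= x s IH; rewrite eval_bind; case: ifP. Qed.

Definition holds (R : realType) (x v : R * R) (h : halfplane) : bool :=
  above x v h.1.1 h.1.2 == h.2.

Lemma eval_inside (R : realType) (x v : R * R) hs :
  eval (above x v) (inside hs) = all (holds x v) hs.
Proof.
elim: hs => //= -[[i t] s] hs IH /=; rewrite /holds /=.
by case: eqP.
Qed.

Lemma check_cellsY : verify unit_bounds (check_cells colorsY locateY).
Proof. by vm_cast_no_check (erefl true). Qed.
Lemma check_cellsZ : verify unit_bounds (check_cells colorsZ locateZ).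
Proof. by vm_cast_no_check (erefl true). Qed.
Lemma check_tile_true : verify unit_bounds check_tile.
Proof. by vm_cast_no_check (erefl true). Qed.
Lemma check_inflate_true : verify unit_bounds check_inflate.
Proof. by vm_cast_no_check (erefl true). Qed.

Section TileFacts.
Context (R : realType).
Local Notation a := (alpha R).
Implicit Types (x v : (R * R)%type).

Lemma cell_colorY x v c : transversal v -> c \in colorsY ->
  all (holds (lexfrac x v) v) (cell_sides c) = (c == color_at locateY x v).
Proof.
move=> tv cY; have := verifyP tv (lexfrac_bounded x tv) check_cellsY.
rewrite eval_bind eval_allt => /allP/(_ _ cY).
by rewrite eval_bind eval_inside /= => /eqP.
Qed.

Lemma cell_colorZ x v c : transversal v -> c \in colorsZ ->
  all (holds (lexfrac x v) v) (cell_sides c) = (c == color_at locateZ x v).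
Proof.
move=> tv cZ; have := verifyP tv (lexfrac_bounded x tv) check_cellsZ.
rewrite eval_bind eval_allt => /allP/(_ _ cZ).
by rewrite eval_bind eval_inside /= => /eqP.
Qed.

Lemma mpt_idmap x : mpt idmap x = x.
Proof. by rewrite /= /kpt /= kr_int zr0 -[RHS]addr0. Qed.

Lemma tile_lexfrac x v : transversal v -> tile (lexfrac x v) v = tile x v.
Proof. by move=> tv; apply: tile_eq => //; exact: lexfrac_lattice. Qed.

Lemma tile_idmap x v : transversal v ->
  let o := eval (above (lexfrac x v) v) (tile_tree idmap) in
  o = Some (tile x v) \/ o = None.
Proof.
move=> tv; case E: (eval (above (lexfrac x v) v) (tile_tree idmap)) => [u|];
  last by right.
by have := tile_treeP tv E; rewrite mpt_idmap tile_lexfrac // => <-; left.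
Qed.

Lemma tile_unit x v : transversal v ->
  [/\ tile x v \in tilesU_seq,
      vbit (tile x v) = ~~ above (lexfrac x v) v dX kalpha &
      hbit (tile x v) = ~~ above (lexfrac x v) v dY kalpha].
Proof.
move=> tv; have := verifyP tv (lexfrac_bounded x tv) check_tile_true.
rewrite eval_bind; case: (tile_idmap x tv) => ->; last by [].
by move=> /and3P[? /eqP ? /eqP ?].
Qed.

Lemma tile_inflate x v (p q : bool) (y := lexfrac x v) (u := tile x v) :
  transversal v -> (p ==> ~~ vbit u) -> (q ==> ~~ hbit u) ->
  tile (mpt (inflate (~~ vbit u && ~~ p) (~~ hbit u && ~~ q)) y) (- v) =
  get_block (omega u) p q.
Proof.
move=> tv pu qu; have := verifyP tv (lexfrac_bounded x tv) check_inflate_true.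
rewrite eval_bind; case: (tile_idmap x tv) => ->; last by [].
rewrite eval_allt => /allP/(_ (p, q)); rewrite -/u -/y.
have -> : (p, q) \in [:: (false, false); (true, false); (false, true); (true, true)].
  by case: p q {pu qu} => -[].
move=> /(_ isT); rewrite [(p, q).1]/= [(p, q).2]/=.
case: ifPn => [|_].
  by case/orP=> /andP[hp hu]; [move: pu|move: qu]; rewrite hp hu.
rewrite eval_bind; set o := eval _ (tile_tree _).
case E: o => [w|] /= /eqP // [<-].
exact: (tile_treeP (m := inflate _ _) tv E).
Qed.

End TileFacts.

Section Realized.
Context (R : realType).
Local Notation a := (alpha R).
Implicit Types (x v : (R * R)%type).

Definition orbit x (i j : int) : R * R := x + (a * i%:~R, a * j%:~R).

Definition fold1 (r : R) : R := (1 - a) * (1 - r).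
Definition frac1 (r e : R) : R := r - (lexfloor r e)%:~R.

Lemma frac1_addalpha (r e : R) : e != 0 ->
  frac1 (r + a) e = frac1 r e + a - (~~ lexpos (frac1 (r + a) e - a) e)%:R.
Proof.
move=> e0; have [a1 a2] := alpha_bounds R.
have := lexfloorP r (lexfloor r e) e0; rewrite eqxx -/(frac1 r e) => /andP[h1].
rewrite rmorphD /= opprD addrA -/(frac1 r e) => h2.
case E: (lexpos (frac1 r e + a - 1) e).
  have F : lexfloor (r + a) e = lexfloor r e + 1.
    apply/esym/eqP; rewrite -lexfloorP // !rmorphD /=; apply/andP; split.
      by move: E; rewrite /frac1; congr (is_true (lexpos _ _)); ring.
    move: h2; apply: contra => h; have a0 : 0 <= 1 - a by lra.
    have := lexpos_addl a0 h.
    by rewrite /frac1; congr (is_true (lexpos _ _)); ring.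
  have G : frac1 (r + a) e = frac1 r e + a - 1.
    by rewrite /frac1 F rmorphD /=; ring.
  by rewrite G (_ : frac1 r e + a - 1 - a = frac1 r e - 1) ?h2 //; ring.
have F : lexfloor (r + a) e = lexfloor r e.
  apply/esym/eqP; rewrite -lexfloorP // !rmorphD /=; apply/andP; split.
    have a0 : 0 <= a by lra.
    have := lexpos_addl a0 h1.
    by rewrite /frac1; congr (is_true (lexpos _ _)); ring.
  move: (negbT E); apply: contra.
  by rewrite /frac1; congr (is_true (lexpos _ _)); ring.
have G : frac1 (r + a) e = frac1 r e + a by rewrite /frac1 F; ring.
by rewrite G addrK h1 /= subr0.
Qed.

Lemma fold1_step (r e : R) : e != 0 -> exists z : int,
  fold1 (frac1 (r + a) e) = fold1 (frac1 r e) + z%:~R +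
    a * (if lexpos (frac1 (r + a) e - a) e then 2 else 1).
Proof.
move=> e0; have := frac1_addalpha r e0; case: lexpos => /= ->.
  by exists (-1); rewrite /fold1; ring: (alpha_sqr R).
by exists 0; rewrite /fold1; ring: (alpha_sqr R).
Qed.

Definition realized (T : tiling) (i0 i1 j0 j1 : int) : Prop :=
  exists x v, transversal v /\ forall i j, i0 <= i < i1 -> j0 <= j < j1 ->
    tile (orbit x i j) v = T i j.

Lemma realized_sub T i0 i1 j0 j1 i0' i1' j0' j1' :
  i0 <= i0' -> i1' <= i1 -> j0 <= j0' -> j1' <= j1 ->
  realized T i0 i1 j0 j1 -> realized T i0' i1' j0' j1'.
Proof.
move=> ? ? ? ? [x [v [tv h]]]; exists x, v; split=> // i j hi hj.
by apply: h; lia.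
Qed.

(** The map fold1 carries a step by alpha to a step by alpha or 2 alpha
    modulo 1, according to the width of the next supertile. Hence the
    anchors of the supertiles, which are at C (i + 1) - 1, all lie on one
    orbit. *)
Lemma fold1_orbit (r e : R) (C : int -> int) (b : int -> bool) i0 i1 :
  e != 0 -> (forall i, C (i + 1) = C i + (if b i then 1 else 2)) ->
  (forall i, i0 <= i < i1 ->
    b i = ~~ lexpos (frac1 (r + a * i%:~R) e - a) e) ->
  exists s : R, forall i, i0 <= i < i1 -> exists z : int,
    s + a * (C (i + 1) - 1)%:~R = fold1 (frac1 (r + a * i%:~R) e) + z%:~R.
Proof.
move=> e0 CS hb; exists (fold1 (frac1 (r + a * i0%:~R) e) - a * (C (i0 + 1) - 1)%:~R).
move=> i /andP[hi hi1].
have : i = i0 + (absz (i - i0))%:Z by lia.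
move: (absz _) => k; elim: k i hi hi1 => [|k IH] i hi hi1 ik.
  by exists 0; rewrite ik addr0; ring.
have [z hz] := IH (i - 1) ltac:(lia) ltac:(lia) ltac:(lia).
have [z' hz'] := fold1_step (r + a * (i - 1)%:~R) e0.
have E : r + a * (i - 1)%:~R + a = r + a * i%:~R by rewrite rmorphB /=; ring.
exists (z - z'); move: hz; rewrite subrK; rewrite E in hz'.
have {}hb : b i = ~~ lexpos (frac1 (r + a * i%:~R) e - a) e.
  by apply: hb; rewrite hi.
rewrite hz' (CS i) hb; case: (lexpos (frac1 (r + a * i%:~R) e - a) e);
   rewrite /= !rmorphB !rmorphD /= => hz; lra.
Qed.

Lemma supertile_mono (C : int -> int) (b : int -> bool) :
  (forall i, C (i + 1) = C i + (if b i then 1 else 2)) ->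
  {homo C : i k / i <= k}.
Proof.
move=> CS i k ik; have -> : k = i + (absz (k - i))%:Z by lia.
elim: (absz _) => [|n IH]; first by rewrite addr0.
have := CS (i + n%:Z); rewrite -addrA (_ : n%:Z + 1 = n.+1%:Z); last by lia.
by move=> ->; apply: le_trans IH _; case: (b _); rewrite lerDl.
Qed.

Lemma kpt_inflate (p q : bool) (y : R * R) :
  mpt (inflate p q) y = (fold1 y.1 - a * p%:R, fold1 y.2 - a * q%:R).
Proof.
have kb (b : bool) : kr R (ksub kphiV (if b then kalpha else k0)) = 1 - a - a * b%:R.
  by rewrite krB kr_phiV; case: b; rewrite ?kr_alpha ?kr_int ?zr0 ?mulr1 ?mulr0.
by rewrite /= /kpt /= !kb; congr (_, _); rewrite /= /fold1 /GRing.scale /=; ring.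
Qed.

(** The two coordinates are treated separately by fold1_orbit, and
    tile_inflate identifies the tiles. The direction is reversed because
    Fold reverses it. *)
Lemma realized_inflate T T' C D i0 i1 j0 j1 :
  desubstitutes T T' C D -> realized T' i0 i1 j0 j1 ->
  realized T (C i0) (C i1) (D j0) (D j1).
Proof.
move=> sub [x [v [tv h]]].
have Cm : {homo C : i k / i <= k}.
  exact: (supertile_mono (fun i => desub_colS sub i 0)).
have Dm : {homo D : i k / i <= k}.
  exact: (supertile_mono (fun i => desub_rowS sub 0 i)).
have [i10|i01] := leP i1 i0.
  by exists x, v; split=> // i j hi; have := Cm _ _ i10; lia.
have [j10|j01] := leP j1 j0.
  by exists x, v; split=> // i j _ hj; have := Dm _ _ j10; lia.
have [s1 hs1] := @fold1_orbit x.1 v.1 C (fun i => vbit (T' i j0)) i0 i1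
  (transversal1 tv) (fun i => desub_colS sub i j0) (fun i hi => ltac:(
  have [_ e _] := tile_unit (orbit x i j0) tv;
  by rewrite -h ?e ?j01 ?lexx // /above kr_alpha)).
have [s2 hs2] := @fold1_orbit x.2 v.2 D (fun j => hbit (T' i0 j)) j0 j1
  (transversal2 tv) (fun j => desub_rowS sub i0 j) (fun j hj => ltac:(
  have [_ _ e] := tile_unit (orbit x i0 j) tv;
  by rewrite -h ?e ?i01 ?lexx // /above kr_alpha)).
exists (s1, s2), (- v); split; first exact: transversalN.
move=> I J /andP[hI hI'] /andP[hJ hJ'].
have [i /andP[hi hi']] := desub_cover_col sub I.
have [j /andP[hj hj']] := desub_cover_row sub J.
have ii : i0 <= i < i1.
  apply/andP; split; [rewrite leNgt|rewrite ltNge]; apply/negP => ?.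
    by have := Cm (i + 1) i0; lia.
  by have := Cm i1 i; lia.
have jj : j0 <= j < j1.
  apply/andP; split; [rewrite leNgt|rewrite ltNge]; apply/negP => ?.
    by have := Dm (j + 1) j0; lia.
  by have := Dm j1 j; lia.
pose p := I == C i + 1; pose q := J == D j + 1.
have Ip : I = C i + p%:Z.
  by rewrite /p; move: hi'; rewrite (desub_colS sub i j); case: eqP; case: vbit; lia.
have Jq : J = D j + q%:Z.
  by rewrite /q; move: hj'; rewrite (desub_rowS sub i j); case: eqP; case: hbit; lia.
have hp : p ==> ~~ vbit (T' i j).
  by apply/implyP => /eqP e; move: hi'; rewrite (desub_colS sub i j); case: vbit; lia.
have hq : q ==> ~~ hbit (T' i j).
  by apply/implyP => /eqP e; move: hj'; rewrite (desub_rowS sub i j); case: hbit; lia.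
clearbody p q; rewrite Ip Jq (desub_tile sub hp hq).
rewrite -(h i j ii jj) in hp hq *.
rewrite -(tile_inflate tv hp hq); apply: tile_eq; first exact: transversalN.
have [z1 e1] := hs1 i ii; have [z2 e2] := hs2 j jj.
exists z1, z2; rewrite kpt_inflate.
have ep : (C (i + 1) - 1 : int) = C i + p%:Z + (~~ vbit (T' i j) && ~~ p)%:Z.
  by rewrite (desub_colS sub i j) -h // {Ip}; case: vbit hp; case: p => //=; lia.
have eq : (D (j + 1) - 1 : int) = D j + q%:Z + (~~ hbit (T' i j) && ~~ q)%:Z.
  by rewrite (desub_rowS sub i j) -h // {Jq}; case: hbit hq; case: q => //=; lia.
have f1 : frac1 (x.1 + a * i%:~R) v.1 = (lexfrac (orbit x i j) v).1 by [].
have f2 : frac1 (x.2 + a * j%:~R) v.2 = (lexfrac (orbit x i j) v).2 by [].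
have bZ (b : bool) : (b%:Z)%:~R = b%:R :> R by case: b.
rewrite ep rmorphD /= bZ f1 in e1; rewrite eq rmorphD /= bZ f2 in e2.
rewrite -[LHS]/(s1 + a * (C i + p%:Z)%:~R, s2 + a * (D j + q%:Z)%:~R) h //.
have move_term (s c w F z : R) : s + a * (c + w) = F + z ->
    s + a * c = F - a * w + z by move=> e; lra.
by congr (_, _); apply: move_term.
Qed.

End Realized.

(** The side of a line for the origin displaced in the direction (1, 1), as
    far as kgt0 can tell. *)
Definition kdecide (d : knum) : option bool :=
  if kgt0 d then Some true else if kgt0 (kopp d) then Some false
  else if Z.eqb d.1 0 && Z.eqb d.2 0 then Some true else None.

Fixpoint evalk A (t : dtree A) : option A :=
  match t with
  | Ret r => Some r
  | Ask i s k => obind (fun b => evalk (k b)) (kdecide (kopp s))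
  end.

Definition block_tree (c : kvec) : dtree (option block) :=
  let at_ i j := tile_tree (Shift (kvadd c (i, j))) in
  bind (at_ k0 k0) (fun o1 => bind (at_ kalpha k0) (fun o2 =>
  bind (at_ k0 kalpha) (fun o3 => bind (at_ kalpha kalpha) (fun o4 =>
  match o1, o2, o3, o4 with
  | Some u1, Some u2, Some u3, Some u4 => Ret (Some (u1, u2, u3, u4))
  | _, _, _, _ => Ret None
  end)))).

(** For each of the 50 blocks, a point of Z[alpha]^2 along whose orbit it is
    seen in the direction (1, 1). *)
Definition witnesses : seq kvec := [::
  (kn 4 (-9), kn 3 (-7)); (kn 4 (-9), kn (-4) 12); (kn 3 (-6), kn 2 (-4));
  (kn 3 (-6), kn 2 (-3)); (kn 3 (-6), kn (-2) 6); (kn 2 (-4), kn 2 (-4));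
  (kn 2 (-4), kn 2 (-3)); (kn 2 (-4), kn 1 (-2)); (kn 2 (-4), kn 1 (-1));
  (kn 2 (-4), kn (-1) 4); (kn 2 (-3), kn 2 (-3)); (kn 2 (-3), kn 1 (-2));
  (kn 2 (-3), kn (-1) 4); (kn 2 (-3), kn (-1) 5); (kn 1 (-2), kn 1 (-2));
  (kn 1 (-2), kn 1 (-1)); (kn 1 (-2), kn 0 0); (kn 1 (-2), kn 0 1);
  (kn 1 (-2), kn 0 2); (kn 1 (-2), kn (-1) 3); (kn 1 (-2), kn (-1) 4);
  (kn 1 (-2), kn (-1) 5); (kn 1 (-1), kn 1 (-2)); (kn 1 (-1), kn 1 (-1));
  (kn 1 (-1), kn 0 0); (kn 1 (-1), kn 0 1); (kn 1 (-1), kn 0 2);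
  (kn 1 (-1), kn (-1) 3); (kn 1 (-1), kn (-1) 4); (kn 0 0, kn 1 (-2));
  (kn 0 0, kn 1 (-1)); (kn 0 0, kn 0 0); (kn 0 0, kn 0 1); (kn 0 0, kn 0 2);
  (kn 0 1, kn 1 (-1)); (kn 0 1, kn 0 0); (kn 0 1, kn 0 1); (kn 0 1, kn 0 2);
  (kn 0 2, kn 1 (-2)); (kn 0 2, kn 1 (-1)); (kn 0 2, kn 0 0);
  (kn 0 2, kn 0 1); (kn 0 2, kn 0 2); (kn (-1) 4, kn 2 (-3));
  (kn (-1) 4, kn 1 (-2)); (kn (-1) 4, kn (-1) 4); (kn (-1) 5, kn 1 (-2));
  (kn (-1) 5, kn (-1) 4); (kn (-2) 6, kn (-1) 4); (kn (-2) 6, kn (-1) 5)].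

Lemma blocks_seen :
  all (fun q => Some (Some q) \in [seq evalk (block_tree c) | c <- witnesses])
    blocks.
Proof. by vm_cast_no_check (erefl true). Qed.

Section Base.
Context (R : realType).
Local Notation a := (alpha R).

Lemma evalkP A (t : dtree A) r :
  evalk t = Some r -> eval (above (0 : R * R) (1, 1)) t = r.
Proof.
have lin0 i : lin i (0 : R * R) = 0 by case: i => /=; rewrite ?mulr0 ?addr0.
have lin1 i : 0 < lin i ((1, 1) : R * R).
  by have := alpha_le1 R; case: i => /=; lra.
elim: t => /= [b [->]//|i s k IH]; rewrite /above lin0 sub0r -krN /kdecide.
case: ifPn => [/(kgt0P R) h|_]; first by rewrite /= /lexpos h => /IH.
case: ifPn => [/(kgt0P R) h|_].
  by rewrite /= /lexpos -[kr R (kopp s)]opprK -krN oppr_gt0 oppr_eq0 lt_gtF // gt_eqF //= => /IH.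
case: ifPn => // /andP[h1 h2]; rewrite /= /lexpos /kr.
have -> : (kopp s).1 = Z0 by lia.
have -> : (kopp s).2 = Z0 by lia.
by rewrite zr0 mul0r addr0 eqxx lin1 orbT => /IH.
Qed.

Lemma transversal11 : transversal ((1, 1) : R * R).
Proof. have h := alpha_le1 R; move=> i; rewrite gt_eqF //; case: i => /=; lra. Qed.

Lemma block_treeP c q : evalk (block_tree c) = Some (Some q) ->
  exists x : R * R, forall s t : bool,
    tile (orbit x s%:Z t%:Z) (1, 1) = get_block q s t.
Proof.
move=> h; have := evalkP h; rewrite /block_tree 4!eval_bind.
set o1 := eval _ (tile_tree _); set o2 := eval _ (tile_tree _).
set o3 := eval _ (tile_tree _); set o4 := eval _ (tile_tree _).
case E1: o1 => [u1|]; case E2: o2 => [u2|]; case E3: o3 => [u3|];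
  case E4: o4 => [u4|] //= -[<-].
exists (kpt R c) => s t.
have -> : orbit (kpt R c) s%:Z t%:Z =
    mpt (Shift (kvadd c (if s then kalpha else k0, if t then kalpha else k0))) 0.
  have kb (b : bool) : a * (b%:Z)%:~R = kr R (if b then kalpha else k0).
    by case: b; rewrite /= ?kr_alpha ?kr_int ?mulr1 ?mulr0.
  by rewrite /orbit !kb /= add0r /kpt /= !krD.
have tv := transversal11.
by case: s; case: t; [exact: (tile_treeP tv E4)|exact: (tile_treeP tv E2)|
  exact: (tile_treeP tv E3)|exact: (tile_treeP tv E1)].
Qed.

Lemma realized_block T i j : wang_valid T ->
  realized R T i (i + 2) j (j + 2).
Proof.
move=> /(blocksP i j) qb; have /mapP[c _ /esym/block_treeP[x hx]] := allP blocks_seen _ qb.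
exists (x - (a * i%:~R, a * j%:~R)), (1, 1); split; first exact: transversal11.
move=> k l hk hl.
have -> : orbit (x - (a * i%:~R, a * j%:~R)) k l = orbit x (k - i) (l - j).
  rewrite /orbit -addrA; congr (_ + _); congr (_, _);
  by rewrite [RHS]/= rmorphB /=; ring.
have [s es] : exists s : bool, k = i + s%:Z by exists (k == i + 1); lia.
have [t et] : exists t : bool, l = j + t%:Z by exists (l == j + 1); lia.
have -> : k - i = s%:Z by lia.
have -> : l - j = t%:Z by lia.
by rewrite hx es et; case: (s); case: (t); rewrite ?addr0.
Qed.

(** A column of T' where the supertiles of T'' begin has its bit false,
    hence comes from a supertile column of T of width two. *)
Lemma supertile2_gap T T' T'' C D C' D' :
  desubstitutes T T' C D -> desubstitutes T' T'' C' D' ->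
  (forall k, C (C' k) + 2 <= C (C' (k + 1))) /\
  (forall k, D (D' k) + 2 <= D (D' (k + 1))).
Proof.
move=> sub sub'.
have Cm : {homo C : i k / i <= k}.
  exact: (supertile_mono (fun i => desub_colS sub i 0)).
have Dm : {homo D : i k / i <= k}.
  exact: (supertile_mono (fun i => desub_rowS sub 0 i)).
split=> k.
  have := desub_colS sub (C' k) 0; rewrite (negbTE (desub_col0 sub' k 0)) => <-.
  by apply: Cm; rewrite (desub_colS sub' k 0); case: vbit; rewrite lerD2l.
have := desub_rowS sub 0 (D' k); rewrite (negbTE (desub_row0 sub' 0 k)) => <-.
by apply: Dm; rewrite (desub_rowS sub' 0 k); case: hbit; rewrite lerD2l.
Qed.

(** An interval of length m meets at most m / 2 + 1 intervals of length at
    least 2; this is less than m as soon as m > 2. *)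
Lemma supertile2_cover (E : int -> int) i0 i1 :
  (forall k, E k + 2 <= E (k + 1)) ->
  (forall n, exists k, E k <= n < E (k + 1)) -> i0 < i1 ->
  exists k0 k1, [/\ E k0 <= i0, i1 <= E k1, k0 < k1 &
    2 * (k1 - k0) <= i1 - i0 + 2].
Proof.
move=> gap cov i01.
have [k0 /andP[h0 h0']] := cov i0; have [k1 /andP[h1 h1']] := cov (i1 - 1).
have grow (n : nat) k : E k + 2 * n%:Z <= E (k + n%:Z).
  elim: n => [|n IH]; first by rewrite mulr0 !addr0.
  have := gap (k + n%:Z); rewrite -addrA (_ : n%:Z + 1 = n.+1%:Z); last by lia.
  by move: (E (k + n%:Z)) (E (k + n.+1%:Z)) IH => u w; lia.
have far k k' : k <= k' -> E k + 2 * (k' - k) <= E k'.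
  move=> kk'; have := grow (absz (k' - k)%R) k.
  by rewrite (_ : (absz (k' - k)%R)%:Z = k' - k) ?[k + _]addrC ?subrK //; lia.
have k01 : k0 <= k1.
  rewrite leNgt; apply/negP => k10; have := far (k1 + 1) k0.
  by move: (E k0) (E (k1 + 1)) h0 h1' => u w; lia.
exists k0, (k1 + 1); split; [exact: h0|lia|lia|].
have [->|k10] := eqVneq k0 k1; first by lia.
have := far (k0 + 1) k1.
by move: (E (k0 + 1)) (E k1) h0' h1 => u w; lia.
Qed.

Lemma realized_empty T i0 i1 j0 j1 : i1 <= i0 \/ j1 <= j0 ->
  realized R T i0 i1 j0 j1.
Proof.
by move=> h; exists 0, (1, 1); split; [exact: transversal11|move=> i j; lia].
Qed.

(** Two desubstitutions shrink any window that is not contained in a 2 by 2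
    block, and these blocks are realized by blocks_seen. *)
Lemma realized_all T i0 i1 j0 j1 : wang_valid T -> realized R T i0 i1 j0 j1.
Proof.
have [n] := ubnP (absz (i1 - i0)%R + absz (j1 - j0)%R).
elim: n T i0 i1 j0 j1 => // n IH T i0 i1 j0 j1 len val.
have [i10|i01] := leP i1 i0; first by apply: realized_empty; left.
have [j10|j01] := leP j1 j0; first by apply: realized_empty; right.
have [small|large] := boolP ((i1 - i0 <= 2) && (j1 - j0 <= 2)).
  by apply: realized_sub (realized_block i0 j0 val); lia.
have [T' [C [D sub]]] := desubstitution val.
have [T'' [C' [D' sub']]] := desubstitution (desub_valid sub).
have [gapC gapD] := supertile2_gap sub sub'.
have cov (A A' : int -> int) : {homo A : i k / i <= k} ->
    (forall n, exists i, A i <= n < A (i + 1)) ->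
    (forall n, exists i, A' i <= n < A' (i + 1)) ->
    forall n, exists i, A (A' i) <= n < A (A' (i + 1)).
  move=> Am covA covA' m; have [i /andP[h1 h2]] := covA m.
  have [k /andP[h3 h4]] := covA' i; exists k; apply/andP; split.
    exact: le_trans (Am _ _ h3) h1.
  by apply: lt_le_trans h2 (Am _ _ _); lia.
have Cm : {homo C : i k / i <= k}.
  exact: (supertile_mono (fun i => desub_colS sub i 0)).
have Dm : {homo D : i k / i <= k}.
  exact: (supertile_mono (fun i => desub_rowS sub 0 i)).
have [k0 [k1 [c0 c1 k01 kl]]] := supertile2_cover gapC
  (cov _ _ Cm (desub_cover_col sub) (desub_cover_col sub')) i01.
have [l0 [l1 [d0 d1 l01 ll]]] := supertile2_cover gapD
  (cov _ _ Dm (desub_cover_row sub) (desub_cover_row sub')) j01.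
apply: (realized_sub c0 c1 d0 d1); apply: (realized_inflate sub).
apply: (realized_inflate sub'); apply: IH; last exact: desub_valid sub'.
lia.
Qed.

End Base.

(** * The torus *)

Section TorusTopology.
Context (R : realType).
Implicit Types (x y v : (R * R)%type).

Definition tpi : R * R -> torus R := \pi_(torus R)%qT.
Local Notation pi := tpi.

Lemma tpiD x y : pi (x + y) = pi x + pi y.
Proof. exact: raddfD (\pi_(torus R)%qT : {additive R * R -> torus R}) x y. Qed.

Lemma tpiB x y : pi (x - y) = pi x - pi y.
Proof. exact: raddfB (\pi_(torus R)%qT : {additive R * R -> torus R}) x y. Qed.

Lemma tpiK (p : torus R) : pi (repr p) = p.
Proof. exact: reprK. Qed.

Lemma tpi_eq x y : pi x = pi y <-> lattice_eq x y.
Proof.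
split=> [/torus_piE|[z1 [z2 ->]]].
  rewrite !inE /= => /andP[/intrP[z1 e1] /intrP[z2 e2]]; exists z1, z2.
  by rewrite -e1 -e2 addrC; case: (x) (y) => [? ?] [? ?]; rewrite -[RHS]/(_, _) /= !subrK.
apply/torus_piE; rewrite addrC addKr !inE /=; apply/andP; split; exact: intr_int.
Qed.

Lemma continuous_tpi : continuous pi.
Proof. by apply/continuousP => V. Qed.

Lemma nbhs_tpi x (U : set (torus R)) :
  nbhs (pi x) U <-> nbhs x (pi @^-1` U).
Proof.
split; first exact: (continuous_tpi (x := x)).
move=> /nbhs_ballP[e /= e0 h].
rewrite nbhsE; exists (pi @` ball x e); last by move=> _ [y hy <-]; exact: h.
split; last by exists x => //; exact: ballxx.
rewrite -[open _]/(torus_open _) /torus_open openE => y [y' hy' yy'].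
have [z1 [z2 e']] : lattice_eq y y' by apply/tpi_eq.
rewrite /interior /=; near=> w.
exists (w - (z1%:~R, z2%:~R)); last by apply/tpi_eq; exists (- z1), (- z2); rewrite !rmorphN.
near: w; have : nbhs y' (ball x e).
  by apply: open_nbhs_nbhs; split => //; exact: ball_open.
rewrite (_ : y' = y - (z1%:~R, z2%:~R)); last by rewrite e' addrK.
move=> h'; apply: (cvgB (cvg_id : _ --> y) (cvg_cst _)) h'.
Unshelve. all: by end_near. Qed.

Lemma open_tpi (V : set (R * R)) : open V -> open (pi @` V).
Proof.
move=> oV; rewrite openE => _ [x Vx <-]; apply/nbhs_tpi.
rewrite openE in oV; have := oV _ Vx; apply: filterS => y Vy /=.
by exists y.
Qed.

Lemma torus_square :
  [set: torus R] = pi @` (`[0, 1]%classic `*` `[0, 1]%classic).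
Proof.
apply/seteqP; split => // p _; rewrite -(tpiK p).
exists (lexfrac (repr p) (1, 1)); last first.
  by apply/tpi_eq; exact: lexfrac_lattice.
rewrite /= !in_itv /= /lexfrac /lexfloor /= ltr01.
have := floor_itv (repr p).1; have := floor_itv (repr p).2.
rewrite !rmorphD /=; lra.
Qed.

Lemma compact_torus : compact [set: torus R].
Proof.
rewrite torus_square; apply: continuous_compact; first exact/continuous_subspaceT/continuous_tpi.
by apply: compact_setX; exact: segment_compact.
Qed.

Lemma hausdorff_torus : hausdorff_space (torus R).
Proof.
move=> p q; rewrite -(tpiK p) -(tpiK q); set x := repr p; set y := repr q.
move=> clu; apply/tpi_eq.
(* d is the distance of r to the nearest integer *)
have away (r : R) : r \isn't a Num.int -> exists2 d, 0 < d &
    forall s, `|r - s| < d -> s \isn't a Num.int.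
  move=> rn; have := floor_itv r; set f := Num.floor r.
  rewrite rmorphD /= => /andP[f1 f2].
  have f1' : f%:~R < r.
    by rewrite lt_neqAle f1 andbT; apply: contraNneq rn => <-; exact: intr_int.
  exists (Num.min (r - f%:~R) (f%:~R + 1 - r)).
    by rewrite lt_min !subr_gt0 f1' f2.
  move=> s; rewrite lt_min !ltr_norml => /andP[/andP[_ h1] /andP[h2 _]].
  apply/negP => /intrP[k sk]; move: h1 h2; rewrite sk => h1 h2.
  have : (f%:~R : R) < k%:~R by lra.
  have : (k%:~R : R) < (f + 1)%:~R by rewrite rmorphD /=; lra.
  rewrite !ltr_int; lia.
have nb (d : R) z : 0 < d -> nbhs (pi z) (pi @` ball z d).
  by move=> d0; apply/nbhs_tpi/nbhs_ballP; exists d => // w hw; exists w.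
suff [h1 h2] : x.1 - y.1 \is a Num.int /\ x.2 - y.2 \is a Num.int.
  move/intrP: h1 => [z1 e1]; move/intrP: h2 => [z2 e2]; exists z1, z2.
  by rewrite -e1 -e2 addrC; case: (x) (y) => [? ?] [? ?]; rewrite -[RHS]/(_, _) /= !subrK.
have close (d : R) : 0 < d -> exists x' y', [/\ `|x - x'| < d, `|y - y'| < d,
    x'.1 - y'.1 \is a Num.int & x'.2 - y'.2 \is a Num.int].
  move=> d0; have [_ [[x' hx' <-] [y' hy' e]]] := clu _ _ (nb d x d0) (nb d y d0).
  have [z1 [z2 ex]] : lattice_eq x' y' by apply/tpi_eq.
  exists x', y'; rewrite -ball_normE in hx'; rewrite -ball_normE in hy'.
  by split=> //; rewrite ex /= addrAC subrr add0r; exact: intr_int.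
have tri (r s r' s' d : R) : `|r - r'| < d / 2 -> `|s - s'| < d / 2 ->
    `|r - s - (r' - s')| < d.
  by rewrite !ltr_norml => /andP[? ?] /andP[? ?]; lra.
have cmp (z : R * R) (d : R) : `|z| < d -> `|z.1| < d /\ `|z.2| < d.
  by rewrite prod_normE gt_max => /andP[].
split; apply/negPn/negP => /away[d d0 hd];
  have [|x' [y' [/cmp[? ?] /cmp[? ?] i1 i2]]] := close (d / 2); rewrite ?divr_gt0 //.
- by move: i1; apply/negP/hd/tri.
- by move: i2; apply/negP/hd/tri.
Qed.

End TorusTopology.

(** * Polygons as intersections of half-planes *)

Definition kweak (u : kvec) (h : halfplane) : bool :=
  let d := ksub (klin h.1.1 u) h.1.2 in kge0 (if h.2 then d else kopp d).

Definition korient (u w z : kvec) : knum :=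
  ksub (kmul (ksub w.1 u.1) (ksub z.2 u.2))
       (kmul (ksub w.2 u.2) (ksub z.1 u.1)).

Definition keq (s t : knum) : bool := Z.eqb s.1 t.1 && Z.eqb s.2 t.2.

(** h lies to the left of the edge from u to w, which is on its boundary
    line. *)
Definition edge_ok (u w : kvec) (h : halfplane) : bool :=
  let: (i, t, s) := h in
  let sgn (c : knum) := if s then c else kopp c in
  let dx := ksub w.1 u.1 in let dy := ksub w.2 u.2 in
  keq (klin i u) t &&
  match i with
  | dX => keq dx k0 && kgt0 (sgn (kopp dy))
  | dY => keq dy k0 && kgt0 (sgn dx)
  | dS => keq dy (kopp dx) && kgt0 (sgn dx)
  | dG => keq dy (kopp (kmul kphi dx)) && kgt0 (sgn dx)
  end.

Definition polygon_ok (vs : seq kvec) (hs : seq halfplane) : bool :=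
  match vs, hs with
  | [:: v0; v1; v2], [:: h0; h1; h2] =>
    [&& edge_ok v0 v1 h0, edge_ok v1 v2 h1, edge_ok v2 v0 h2 &
        kgt0 (korient v0 v1 v2)]
  | [:: v0; v1; v2; v3], [:: h0; h1; h2; h3] =>
    [&& edge_ok v0 v1 h0, edge_ok v1 v2 h1, edge_ok v2 v3 h2, edge_ok v3 v0 h3,
        kgt0 (korient v0 v1 v2) & kgt0 (korient v0 v2 v3)]
  | _, _ => false
  end.

Definition unit_sides : seq halfplane :=
  [:: (dX, k0, true); (dX, k1, false); (dY, k0, true); (dY, k1, false)].

Definition cell_ok (c : color) : bool :=
  polygon_ok (cell_vertices c) (cell_sides c) &&
  all (fun u => all (kweak u) (cell_sides c ++ unit_sides)) (cell_vertices c).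

Lemma cells_ok : all cell_ok (colorsY ++ colorsZ).
Proof. by vm_cast_no_check (erefl true). Qed.

Section Polygons.
Context (R : realType).
Local Notation a := (alpha R).
Implicit Types (x v : (R * R)%type) (u w : kvec) (h : halfplane).

Definition strict x h : bool :=
  if h.2 then kr R h.1.2 < lin h.1.1 x else lin h.1.1 x < kr R h.1.2.
Definition weak x h : bool :=
  if h.2 then kr R h.1.2 <= lin h.1.1 x else lin h.1.1 x <= kr R h.1.2.

Lemma kweakP (u : kvec) h : kweak u h -> weak (kpt R u) h.
Proof.
rewrite /kweak /weak lin_kpt => /(kge0P R); case: h.2; rewrite ?krN krB.
  by rewrite subr_ge0.
by rewrite opprB subr_ge0.
Qed.

Lemma keqP s t : keq s t -> s = t.
Proof.
by case: s t => [? ?] [? ?] /andP[/Z.eqb_spec/= -> /Z.eqb_spec/= ->].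
Qed.

Definition orient (u w x : R * R) : R :=
  (w.1 - u.1) * (x.2 - u.2) - (w.2 - u.2) * (x.1 - u.1).

Lemma korientE (u w x : kvec) : orient (kpt R u) (kpt R w) (kpt R x) = kr R (korient u w x).
Proof. by rewrite /korient krB !krM !krB. Qed.

Lemma edge_okP (u w : kvec) h x : edge_ok u w h -> strict x h ->
  0 < orient (kpt R u) (kpt R w) x.
Proof.
case: h => [[i t] s] /andP[/keqP <-]; rewrite /strict /= -lin_kpt /orient.
case: i => /andP[/keqP/(congr1 (kr R)) e /(kgt0P R)]; rewrite krB in e;
  case: s; rewrite ?krN ?krM ?krB ?kr_phi ?kr_int ?zr0 in e *;
  rewrite /lin /kpt /=;
  move: (kr R u.1) (kr R u.2) (kr R w.1) (kr R w.2) e => u1 u2 w1 w2 e d0;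
  rewrite -subr_gt0 => l0; have := mulr_gt0 d0 l0;
  rewrite ?[w1 - u1]e ?[w2 - u2]e; lra.
Qed.

Lemma polygon_intro (vs : seq (R * R)) (ts : seq R) x :
  size ts = size vs -> all (fun t => 0 <= t) ts -> \sum_(t <- ts) t = 1 ->
  x.1 = \sum_(p <- zip ts vs) p.1 * p.2.1 ->
  x.2 = \sum_(p <- zip ts vs) p.1 * p.2.2 -> polygon vs x.
Proof.
move=> st t0 t1 e1 e2; exists (fun i => ts`_i); split.
- by move=> i; apply: (all_nthP 0 t0); rewrite st.
- by rewrite -t1 (big_nth 0) st big_mkord.
- rewrite e1 (big_nth (0, 0)) size_zip st minnn big_mkord.
  by apply: eq_bigr => i _; rewrite nth_zip.
- rewrite e2 (big_nth (0, 0)) size_zip st minnn big_mkord.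
  by apply: eq_bigr => i _; rewrite nth_zip.
Qed.

Lemma triangle_bary (v0 v1 v2 x : R * R) (D := orient v0 v1 v2) : D != 0 ->
  let t0 := orient v1 v2 x / D in let t1 := orient v2 v0 x / D in
  let t2 := orient v0 v1 x / D in
  [/\ t0 + t1 + t2 = 1, t0 * v0.1 + t1 * v1.1 + t2 * v2.1 = x.1 &
      t0 * v0.2 + t1 * v1.2 + t2 * v2.2 = x.2].
Proof. by rewrite /D /orient => D0; split; field. Qed.

Lemma triangle_in (v0 v1 v2 x : R * R) : 0 < orient v0 v1 v2 ->
  0 <= orient v0 v1 x -> 0 <= orient v1 v2 x -> 0 <= orient v2 v0 x ->
  polygon [:: v0; v1; v2] x.
Proof.
move=> D0 h0 h1 h2; have [e0 e1 e2] := triangle_bary x (lt0r_neq0 D0).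
have Di := ltW D0; rewrite -invr_ge0 in Di.
set t0 := _ / _ in e0 e1 e2; set t1 := _ v2 v0 x / _ in e0 e1 e2.
set t2 := _ v0 v1 x / _ in e0 e1 e2.
apply: (@polygon_intro _ [:: t0; t1; t2]) => //.
- by rewrite /= !mulr_ge0.
- by rewrite -[RHS]e0 !big_cons big_nil addr0 !addrA.
- by rewrite !big_cons big_nil /= addr0 !addrA.
- by rewrite !big_cons big_nil /= addr0 !addrA.
Qed.

Lemma quadrilateral_in (v0 v1 v2 v3 x : R * R) : 0 < orient v0 v1 v2 ->
  0 < orient v0 v2 v3 -> 0 <= orient v0 v1 x -> 0 <= orient v1 v2 x ->
  0 <= orient v2 v3 x -> 0 <= orient v3 v0 x ->
  polygon [:: v0; v1; v2; v3] x.
Proof.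
move=> D0 D1 h0 h1 h2 h3; have [ge|lt] := leP 0 (orient v0 v2 x).
  have [t [t0 t1 e1 e2]] := triangle_in D1 ge h2 h3.
  rewrite !big_ord_recl !big_ord0 /= in t1 e1 e2.
  apply: (@polygon_intro _ [:: t ord0; 0; t (lift ord0 ord0); t (lift ord0 (lift ord0 ord0))]) => //.
  - by rewrite /= lexx !t0.
  - by rewrite !big_cons big_nil add0r.
  - by rewrite !big_cons big_nil /= mul0r add0r.
  - by rewrite !big_cons big_nil /= mul0r add0r.
have o' : 0 <= orient v2 v0 x by move: lt; rewrite /orient; lra.
have [t [t0 t1 e1 e2]] := triangle_in D0 h0 h1 o'.
rewrite !big_ord_recl !big_ord0 /= in t1 e1 e2.
apply: (@polygon_intro _ [:: t ord0; t (lift ord0 ord0); t (lift ord0 (lift ord0 ord0)); 0]) => //.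
- by rewrite /= lexx !t0.
- by rewrite !big_cons big_nil addr0.
- by rewrite !big_cons big_nil /= mul0r addr0.
- by rewrite !big_cons big_nil /= mul0r addr0.
Qed.

Lemma polygon_okP (vs : seq kvec) hs x : polygon_ok vs hs ->
  all (strict x) hs -> polygon [seq kpt R w | w : kvec <- vs] x.
Proof.
case: vs => [|v0 [|v1 [|v2 [|v3 [|? ?]]]]] //;
  case: hs => [|h0 [|h1 [|h2 [|h3 [|? ?]]]]] //.
  move=> /and4P[e0 e1 e2 /(kgt0P R)]; rewrite -korientE => D0.
  move=> /and4P[s0 s1 s2 _].
  by apply: triangle_in => //; apply/ltW/edge_okP; eassumption.
move=> /and5P[e0 e1 e2 e3 /andP[/(kgt0P R) D0 /(kgt0P R) D1]].
rewrite -!korientE in D0 D1; move=> /and5P[s0 s1 s2 s3 _].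
by apply: quadrilateral_in => //; apply/ltW/edge_okP; eassumption.
Qed.

Lemma polygon_weak (vs : seq (R * R)) h x :
  all (weak^~ h) vs -> polygon vs x -> weak x h.
Proof.
move=> /allP vh [t [t0 t1 e1 e2]].
have e : lin h.1.1 x = \sum_i t i * lin h.1.1 (vs`_i).
  case: h.1.1; rewrite /= ?e1 ?e2 //.
    by rewrite -big_split; apply: eq_bigr => i _; rewrite mulrDr.
  rewrite mulr_sumr -big_split; apply: eq_bigr => i _ /=; ring.
rewrite /weak e -[kr R _]mul1r -t1 mulr_suml.
have vh' (i : 'I_(size vs)) : weak vs`_i h by apply: vh; exact: mem_nth.
move: vh'; rewrite /weak; case: h.2 => vh'; apply: ler_sum => i _;
  by rewrite ler_wpM2l ?t0 ?vh'.
Qed.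

(** All the forms are positive at (1, 1), so a point of the boundary line of
    h leaves h when it is moved along (1, 1) or (-1, -1). *)
Lemma interior_weak (A : set (R * R)) h : (forall x, A x -> weak x h) ->
  forall x, A° x -> strict x h.
Proof.
move=> Ah x Ax; have := Ah x (interior_subset Ax).
rewrite /weak /strict; have /nbhs_ballP[e /= e0 xe] : nbhs x A := Ax.
have l1 : 0 < lin h.1.1 ((1, 1) : R * R).
  by have := alpha_le1 R; case: h.1.1 => /=; lra.
pose d (s : R) : R * R := s *: (1, 1).
have inA (s : R) : `|s| = e / 2 -> A (x + d s).
  move=> se; apply: xe; rewrite -ball_normE /= opprD addrA subrr add0r normrN.
  rewrite /d prod_normE /= /GRing.scale /= !mulr1 se maxxx; lra.
have hp : 0 < e / 2 by rewrite divr_gt0.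
have n1 : `|e / 2| = e / 2 by rewrite gtr0_norm.
have n2 : `|- (e / 2)| = e / 2 by rewrite normrN.
have := Ah _ (inA _ n1); have := Ah _ (inA _ n2).
rewrite /weak !linD /d !linZ; case: h.2; nra.
Qed.

Definition cell (c : color) : set (R * R) :=
  [set x | all (strict x) (cell_sides c)].

Lemma continuous_lin i : continuous (lin i : R * R -> R).
Proof.
move=> x; case: i.
- exact: cvg_fst.
- exact: cvg_snd.
- by apply: cvgD; [exact: cvg_fst|exact: cvg_snd].
- by apply: cvgD; [apply: cvgMl_tmp; exact: cvg_fst|exact: cvg_snd].
Qed.

Lemma open_cell c : open (cell c).
Proof.
rewrite /cell; elim: (cell_sides c) => [|h hs IH].
  by rewrite (_ : [set x | _] = setT); [exact: openT|apply/seteqP; split].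
rewrite (_ : [set x | _] = [set x | strict x h] `&` [set x | all (strict x) hs]);
  last by apply/seteqP; split => x /= => [/andP[]|[-> ->]].
apply: openI => //.
have cl := @continuous_lin h.1.1.
move/continuousP: cl => cl; rewrite /strict; case: h.2.
  by apply: (cl [set r | kr R h.1.2 < r]); exact: open_gt.
by apply: (cl [set r | r < kr R h.1.2]); exact: open_lt.
Qed.

Lemma all_exchange (A B : Type) (p : A -> B -> bool) (q : pred B) us hs :
  (forall y : B, all (p^~ y) us -> q y) -> all (fun b => all (p b) hs) us -> all q hs.
Proof.
move=> pq; elim: hs => //= y hs IH.
by rewrite all_predI => /andP[/pq-> /IH->].
Qed.

Lemma interior_sides c hs x : c \in colorsY ++ colorsZ ->
  all (fun u => all (kweak u) hs) (cell_vertices c) ->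
  (polygon [seq kpt R w | w : kvec <- cell_vertices c])° x -> all (strict x) hs.
Proof.
move=> cc wk Px; apply: all_exchange wk => h wk.
apply: interior_weak Px => y; apply: polygon_weak; rewrite all_map.
by apply: sub_all wk => w; exact: kweakP.
Qed.

(** A point to the left of all the edges has nonnegative barycentric
    coordinates in one of the triangles into which a diagonal cuts the
    polygon. Conversely the half-planes are convex and contain the vertices. *)
Lemma interior_polygon c : c \in colorsY ++ colorsZ ->
  (polygon [seq kpt R w | w : kvec <- cell_vertices c])° = cell c.
Proof.
move=> cc; have /andP[ok wk] := allP cells_ok _ cc.
have wkc : all (fun u => all (kweak u) (cell_sides c)) (cell_vertices c).
  by apply: sub_all wk => w; rewrite all_cat => /andP[].
apply/seteqP; split => x; first exact: interior_sides.
move=> cx; apply: (@filterS _ (nbhs x) _ (cell c)).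
  by move=> y cy; apply: (polygon_okP ok).
by apply: open_nbhs_nbhs; split => //; exact: open_cell.
Qed.

Lemma cell_unit c x : c \in colorsY ++ colorsZ -> cell c x ->
  all (strict x) unit_sides.
Proof.
move=> cc; rewrite -interior_polygon // => Px.
have /andP[ok wk] := allP cells_ok _ cc; apply: (interior_sides cc) Px.
by apply: sub_all wk => w; rewrite all_cat => /andP[].
Qed.

End Polygons.

(** * The partition and the displaced points *)

Section Atoms.
Context (R : realType).
Local Notation a := (alpha R).
Local Notation pi := (@tpi R).
Implicit Types (x y v : (R * R)%type).

Lemma atomYE c : c \in colorsY -> atomY R c = pi @` @cell R c.
Proof.
move=> cY; rewrite -interior_polygon ?mem_cat ?cY //.
have k00 : kr R (0, 0)%Z = 0 by exact: (kr_int R 0).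
have k10 : kr R (1, 0)%Z = 1 by exact: (kr_int R 1).
have k01 : kr R (0, 1)%Z = a by exact: kr_alpha.
have k02 : kr R (0, 2)%Z = 2 * a by rewrite /kr /= zr0 add0r.
have kN : kr R (1, -1)%Z = 1 - a by exact: kr_phiV.
by case: c cY => // _; rewrite /cell_vertices /= /kpt /= ?k00 ?k10 ?k01 ?k02 ?kN.
Qed.

Lemma atomZE c : c \in colorsZ -> atomZ R c = pi @` @cell R c.
Proof.
move=> cZ; rewrite -interior_polygon ?mem_cat ?cZ ?orbT //.
have k00 : kr R (0, 0)%Z = 0 by exact: (kr_int R 0).
have k10 : kr R (1, 0)%Z = 1 by exact: (kr_int R 1).
have k01 : kr R (0, 1)%Z = a by exact: kr_alpha.
have k02 : kr R (0, 2)%Z = 2 * a by rewrite /kr /= zr0 add0r.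
have kN : kr R (1, -1)%Z = 1 - a by exact: kr_phiV.
by case: c cZ => // _; rewrite /cell_vertices /= /kpt /= ?k00 ?k10 ?k01 ?k02 ?kN.
Qed.

Lemma polygon_nil : torus_polygon [::] = set0 :> set (torus R).
Proof.
apply/seteqP; split => // p [x /interior_subset [t [_ + _ _]] _].
by rewrite big_ord0 => /eqP; rewrite eq_sym oner_eq0.
Qed.

Lemma atomY0 c : c \notin colorsY -> atomY R c = set0.
Proof. by case: c => // _; exact: polygon_nil. Qed.
Lemma atomZ0 c : c \notin colorsZ -> atomZ R c = set0.
Proof. by case: c => // _; exact: polygon_nil. Qed.

Lemma open_atomY c : open (atomY R c).
Proof.
have [cY|/atomY0->] := boolP (c \in colorsY); last exact: open0.
by rewrite atomYE //; apply: open_tpi; exact: open_cell.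
Qed.
Lemma open_atomZ c : open (atomZ R c).
Proof.
have [cZ|/atomZ0->] := boolP (c \in colorsZ); last exact: open0.
by rewrite atomZE //; apply: open_tpi; exact: open_cell.
Qed.

Lemma strict_holds x v h : transversal v -> strict x h -> holds x v h.
Proof.
move=> tv; rewrite /strict /holds; case: h.2 => h0.
  by rewrite /above /lexpos subr_gt0 h0.
by rewrite /above /lexpos subr_gt0 (lt_gtF h0) subr_eq0 (lt_eqF h0).
Qed.

Lemma cell_lexfrac c x v : transversal v -> c \in colorsY ++ colorsZ ->
  (@cell R c) x -> lexfrac x v = x.
Proof.
move=> tv cc cx; have /and5P[h1 h2 h3 h4 _] := cell_unit cc cx.
have hv h := @strict_holds x v h tv.
move: (hv _ h1) (hv _ h2) (hv _ h3) (hv _ h4); rewrite /holds /=.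
rewrite !eqbF_neg -!belowE // => /eqP ? ? /eqP ? ?.
by rewrite (@lexfrac_unique _ _ _ 0 0) // !subr0; case: (x).
Qed.

Lemma atomY_color c x v : transversal v -> atomY R c (pi x) ->
  color_at locateY x v = c.
Proof.
move=> tv; have [cY|/atomY0->//] := boolP (c \in colorsY).
rewrite atomYE // => -[y cy /tpi_eq yx]; apply/esym/eqP.
have e : lexfrac x v = y.
  by rewrite -(lexfrac_eq tv yx) (cell_lexfrac tv _ cy) // mem_cat cY.
rewrite -cell_colorY // e; apply: sub_all cy => h; exact: strict_holds.
Qed.

Lemma atomZ_color c x v : transversal v -> atomZ R c (pi x) ->
  color_at locateZ x v = c.
Proof.
move=> tv; have [cZ|/atomZ0->//] := boolP (c \in colorsZ).
rewrite atomZE // => -[y cy /tpi_eq yx]; apply/esym/eqP.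
have e : lexfrac x v = y.
  by rewrite -(lexfrac_eq tv yx) (cell_lexfrac tv _ cy) // mem_cat cZ orbT.
rewrite -cell_colorZ // e; apply: sub_all cy => h; exact: strict_holds.
Qed.

Definition sector v : set (R * R) := [set d | forall i, 0 < lin i d * lin i v].
(** The displacements that tend to 0 within the sector of v, one of the
    connected components of the complement of the four lines through 0. *)
Definition toward v : set_system (R * R) := within (sector v) (nbhs (0 : R * R)).

Lemma lin0 i : lin i (0 : R * R) = 0.
Proof. by rewrite -[X in lin i X](subrr 0) linB subrr. Qed.

Lemma near_lin i (c : R) : 0 < c -> \forall d \near (0 : R * R), `|lin i d| < c.
Proof.
move=> c0.
have : lin i @ (0 : R * R) --> lin i (0 : R * R) by exact: continuous_lin.
rewrite lin0 => /cvgrPdist_lt/(_ _ c0).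
by apply: filterS => d; rewrite sub0r normrN.
Qed.

Lemma sector_scale v (e : R) : transversal v -> 0 < e -> sector v (e *: v).
Proof.
move=> tv e0 i; rewrite linZ -mulrA mulr_gt0 // lt0r mulf_neq0 ?tv //=.
exact: sqr_ge0 (lin i v).
Qed.

Lemma toward_scale v (U : set (R * R)) : transversal v -> toward v U ->
  \forall e \near 0^'+, U (e *: v).
Proof.
move=> tv U0; near=> e.
have e0 : 0 < e by near: e; exact: nbhs_right_gt.
suff : sector v (e *: v) -> U (e *: v) by apply; exact: sector_scale.
near: e; apply: (@cvg_at_right_filter _ _ (fun e : R => e *: v) (0 : R)) U0.
by rewrite -[X in _ --> X](scale0r v); apply: cvgZr_tmp; exact: cvg_id.
Unshelve. all: by end_near. Qed.

Lemma toward_proper v : transversal v -> ProperFilter (toward v).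
Proof.
move=> tv; split; last exact: within_filter.
by move=> /(toward_scale tv) h; have [e] := filter_ex h.
Qed.

Lemma near_strict x v h : transversal v -> holds x v h ->
  \forall d \near toward v, strict (x + d) h.
Proof.
move=> tv; rewrite /holds /strict /toward near_withinE; case: h => [[i t] s] /=.
have above_case : above x v i t ->
    \forall d \near (0 : R * R), sector v d -> kr R t < lin i (x + d).
  rewrite /above => /orP[l0|/andP[/eqP l0 v0]].
    have := near_lin i l0; apply: filterS => d + _.
    by rewrite linD ltr_norml => /andP[? _]; lra.
  near=> d => /(_ i); rewrite pmulr_lgt0 // linD => ?; lra.
have below_case : below x v i t ->
    \forall d \near (0 : R * R), sector v d -> lin i (x + d) < kr R t.
  rewrite /below => /orP[l0|/andP[/eqP l0 v0]].
    have := near_lin i l0; apply: filterS => d + _.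
    by rewrite linD ltr_norml => /andP[_ ?]; lra.
  rewrite oppr_gt0 in v0.
  near=> d => /(_ i); rewrite nmulr_lgt0 // linD => ?; lra.
case: s => /eqP ab; first by apply: above_case; rewrite ab.
by apply: below_case; rewrite belowE // ab.
Unshelve. all: by end_near. Qed.

Lemma near_cell c x v : transversal v -> all (holds x v) (cell_sides c) ->
  \forall d \near toward v, @cell R c (x + d).
Proof.
move=> tv; have := toward_proper tv; rewrite /cell /= => PF.
elim: (cell_sides c) => [_|h hs IH] /=; first by near=> d.
move=> /andP[h1 h2]; near=> d; apply/andP; split; near: d.
  exact: near_strict.
exact: IH.
Unshelve. all: by end_near. Qed.

Lemma locate_mem o c0 cs : c0 \in cs -> eval o (locate c0 cs) \in cs.
Proof.
move=> c0s; suff : (eval o (locate c0 cs) == c0) || (eval o (locate c0 cs) \in cs).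
  by case/orP => // /eqP->.
elim: cs {c0s} => [|c cs IH] /=; first by rewrite eqxx.
rewrite eval_bind; case: ifP => _ /=; rewrite in_cons ?eqxx ?orbT //.
by case/orP: IH => ->; rewrite ?orbT.
Qed.

Lemma color_atomY x v : transversal v ->
  \forall d \near toward v, atomY R (color_at locateY x v) (pi (x + d)).
Proof.
move=> tv; have cY : color_at locateY x v \in colorsY by exact: locate_mem.
have := cell_colorY x tv cY; rewrite eqxx => /(near_cell tv).
have PF := toward_proper tv.
apply: filterS => d cd; rewrite atomYE //; exists (lexfrac x v + d) => //.
apply/tpi_eq; have [z1 [z2 ->]] := lexfrac_lattice x v.
by exists z1, z2; rewrite addrAC.
Qed.

Lemma color_atomZ x v : transversal v ->
  \forall d \near toward v, atomZ R (color_at locateZ x v) (pi (x + d)).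
Proof.
move=> tv; have cZ : color_at locateZ x v \in colorsZ by exact: locate_mem.
have := cell_colorZ x tv cZ; rewrite eqxx => /(near_cell tv).
have PF := toward_proper tv.
apply: filterS => d cd; rewrite atomZE //; exists (lexfrac x v + d) => //.
apply/tpi_eq; have [z1 [z2 ->]] := lexfrac_lattice x v.
by exists z1, z2; rewrite addrAC.
Qed.

Lemma rotU_tpi n x : rotU n (pi x) = pi (orbit x n.1 n.2).
Proof. by rewrite /rotU /orbit tpiD. Qed.

Lemma rotU_image n (A : set (torus R)) x :
  (rotU n @` A) (pi x) <-> A (pi (x - (a * n.1%:~R, a * n.2%:~R))).
Proof.
split=> [[p Ap]|Ax].
  rewrite -(tpiK p) rotU_tpi => /tpi_eq e; rewrite -(tpiK p) in Ap.
  suff -> : pi (x - (a * n.1%:~R, a * n.2%:~R)) = pi (repr p) by [].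
  apply/esym/tpi_eq; case: e => z1 [z2 e]; exists z1, z2.
  by rewrite addrAC -e /orbit addrK.
by exists (pi (x - (a * n.1%:~R, a * n.2%:~R))) => //; rewrite rotU_tpi /orbit subrK.
Qed.

Lemma partitionUE u x : partitionU u (pi x) <->
  [/\ atomY R (right_color (val u)) (pi x), atomZ R (top_color (val u)) (pi x),
      atomY R (left_color (val u)) (pi (x - (a, 0))) &
      atomZ R (bottom_color (val u)) (pi (x - (0, a)))].
Proof.
rewrite /partitionU /=; split.
  by move=> [[[h1 h2] /rotU_image/= h3] /rotU_image/= h4]; rewrite !mulr1 !mulr0 in h3 h4.
move=> [h1 h2 h3 h4]; split; first split => //; apply/rotU_image => /=;
  by rewrite mulr1 mulr0.
Qed.

(** Inside an atom no line is met, so that the direction does not matter. *)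
Lemma partitionU_tile u x v : transversal v -> partitionU u (pi x) ->
  tile x v = val u.
Proof.
move=> tv /partitionUE[h1 h2 h3 h4]; rewrite /tile (atomY_color tv h1).
rewrite (atomZ_color tv h2) (atomY_color tv h3) (atomZ_color tv h4).
by case: (val u) => [[[]]].
Qed.

(** A small displacement within the sector of v leaves all the lines on the
    side predicted by above. *)
Lemma tile_partitionU u x v : transversal v -> tile x v = val u ->
  \forall d \near toward v, partitionU u (pi (x + d)).
Proof.
move=> tv e; have PF := toward_proper tv; near=> s; apply/partitionUE; rewrite -e.
rewrite ![x + _ - _]addrAC; split; near: s;
  [exact: color_atomY|exact: color_atomZ|exact: color_atomY|exact: color_atomZ].
Unshelve. all: by end_near. Qed.

Lemma is_action_rotU : is_action (@rotU R).
Proof.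
split.
- move=> n p; rewrite -(tpiK p) => U; rewrite rotU_tpi.
  move=> /nbhs_tpi nU; apply/nbhs_tpi; rewrite /preimage /=.
  have cx : (fun y => orbit y n.1 n.2) @ (repr p) --> orbit (repr p) n.1 n.2.
    by apply: cvgD; [exact: cvg_id|exact: cvg_cst].
  have := cx _ nU; apply: (@filterS _ (nbhs (repr p))) => y.
  by rewrite /= rotU_tpi.
- move=> p; rewrite -(tpiK p) rotU_tpi /orbit /= mulr0 -[X in _ + X]/(0 : R * R).
  by rewrite addr0.
- move=> m n p; rewrite -(tpiK p) !rotU_tpi /orbit -!addrA; congr (pi (_ + _)).
  rewrite -[RHS]/(_, _) /= !rmorphD /= !mulrDr.
  by congr (_, _); exact: addrC.
Qed.

Lemma open_rotU n (A : set (torus R)) : open A -> open (rotU n @` A).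
Proof.
move=> oA; have [ct t0 tD] := is_action_rotU.
have -> : rotU n @` A = rotU (- n) @^-1` A.
  apply/seteqP; split=> [_ [p Ap <-]|p Ap]; first by rewrite /= -tD addNr t0.
  by exists (rotU (- n) p) => //; rewrite -tD addrN t0.
by move/continuousP: (ct (- n)) => /(_ _ oA).
Qed.

Lemma open_partitionU (u : tilesU) : open (@partitionU R u).
Proof.
by do !apply: openI; [exact: open_atomY|exact: open_atomZ|
  apply: open_rotU; exact: open_atomY|apply: open_rotU; exact: open_atomZ].
Qed.

Lemma equicontinuous_rotU : equicontinuous_system (@rotU R).
Proof.
split; [exact: compact_torus|exact: hausdorff_torus|exact: is_action_rotU|].
move=> p E entE.
have : entourage [set xy : (R * R) * (R * R) | E (pi xy.1, pi xy.2)] by exact: entE.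
rewrite -entourage_ballE => -[e /= e0 h]; rewrite -(tpiK p); apply/nbhs_tpi.
apply/nbhs_ballP; exists e => // y xy n _; rewrite !rotU_tpi.
apply: (h (orbit _ _ _, orbit _ _ _)); move: xy => /=.
by rewrite -!ball_normE /= /orbit opprD addrACA subrr addr0.
Qed.

End Atoms.

(** * Configurations and codes *)

Lemma near_seq (I : eqType) (T : Type) (F : set_system T) (s : seq I)
    (Q : I -> T -> Prop) : Filter F ->
  (forall k, k \in s -> \forall y \near F, Q k y) ->
  \forall y \near F, forall k, k \in s -> Q k y.
Proof.
move=> FF; elim: s => [|k s IH] h; first exact: filterE.
have hk : \forall y \near F, Q k y by apply: h; rewrite mem_head.
have hs : \forall y \near F, forall k, k \in s -> Q k y.
  by apply: IH => l ls; apply: h; rewrite in_cons ls orbT.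
apply: filterS2 hk hs => y yk ys l.
by rewrite in_cons => /orP[/eqP->//|]; exact: ys.
Qed.

Section ConfigTopology.
Context (A : choiceType).
Implicit Types (w : config A) (k : Z2).

Definition ball1 (N : nat) : set Z2 := [set k : Z2 | (`|k.1| + `|k.2| <= N)%N].

Definition agree (N : nat) w w' : Prop := forall k, ball1 N k -> w' k = w k.

Definition box (N : nat) : seq Z2 :=
  let r := [seq (n%:Z - N%:Z : int) | n <- iota 0 (N + N).+1] in
  [seq (i, j) | i <- r, j <- r].

Lemma ball1_box N k : ball1 N k -> k \in box N.
Proof.
rewrite /ball1 => kN; rewrite /box [k]surjective_pairing.
have mem (z : int) : (absz z <= N)%N ->
    z \in [seq (n%:Z - N%:Z : int) | n <- iota 0 (N + N).+1].
  move=> zN; apply/mapP; exists (absz (z + N%:Z)%R); first by rewrite mem_iota; lia.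
  by lia.
by apply/allpairs_f; apply: mem; move: kN => /=; lia.
Qed.

Lemma near_coords (s : seq Z2) w :
  \forall w' \near w, forall k, k \in s -> w' k = w k.
Proof.
apply: (@near_seq _ _ (nbhs w) s (fun k w' => w' k = w k)) => k _.
have := @proj_continuous Z2 (fun=> discrete_topology A) k w.
by move=> /(_ _ (discrete_set1 (proj k w))).
Qed.

Lemma nbhs_agree N w : nbhs w [set w' | agree N w w'].
Proof.
by apply: filterS (near_coords (box N) w) => w' h k /ball1_box; exact: h.
Qed.

Lemma nbhs_configP w (U : set (config A)) :
  nbhs w U <-> exists N, forall w', agree N w w' -> U w'.
Proof.
split=> [wU|[N NU]]; last by apply: filterS (nbhs_agree N w) => w'; exact: NU.
pose F : set_system (config A) := filter_from setT (fun N => [set w' | agree N w w']).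
have FF : Filter F.
  apply: filter_fromT_filter; first by exists 0%N.
  move=> i j; exists (maxn i j) => w' h; split=> k; rewrite /ball1 /= => hk;
    apply: h; rewrite /ball1 /=; lia.
have : F --> w.
  apply/cvg_sup => k V; rewrite nbhsE => -[B [[C oC CB] Bw] BV].
  exists (absz k.1 + absz k.2)%N => // w' h; apply: BV; rewrite -CB /=.
  by rewrite (h k (leqnn _)); move: Bw; rewrite -CB.
by move=> /(_ _ wU) [N _ h]; exists N.
Qed.

Lemma closed_configP (X : set (config A)) : closed X <->
  forall w, (forall N, exists2 w', X w' & agree N w w') -> X w.
Proof.
split=> [cX w h|h w clw].
  apply: cX => U /nbhs_configP[N NU]; have [w' Xw' ww'] := h N.
  by exists w'; split => //; exact: NU.
apply: h => N; have [w' [Xw' ww']] := clw _ (nbhs_agree N w).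
by exists w'.
Qed.

Lemma shift_action0 w : shift_action 0 w = w.
Proof. by apply/funext => k; rewrite /shift_action addr0. Qed.

Lemma shift_actionD m n w :
  shift_action (m + n) w = shift_action m (shift_action n w).
Proof. by apply/funext => k; rewrite /shift_action addrA. Qed.

Lemma subshift_language_inj (X1 X2 : set (config A)) :
  subshift X1 -> subshift X2 -> language X1 `<=` language X2 -> X1 `<=` X2.
Proof.
move=> [_ _] [/closed_configP cX2 _] XX w Xw; apply: cX2 => N.
pose p : {fmap Z2 -> A} :=
  [fmap k : [fset k | k in box N]%fset => w (val k)].
have [w' X2w' pw'] : language X2 p.
  by apply: XX; exists w => // k; rewrite ffunE.
exists w' => // k /ball1_box kN.
have kp : k \in domf p by rewrite /p /= in_fset.
by have := pw' [` kp]%fset; rewrite ffunE.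
Qed.

End ConfigTopology.

Section Code.
Context (R : realType).
Local Notation a := (alpha R).
Local Notation pi := (@tpi R).
Local Notation P := (@partitionU R).
Local Notation RU := (@rotU R).
Local Notation sigma := (@shift_action tilesU).
Local Notation Omega := (wang_shift tilesU).
Implicit Types (x y v : (R * R)%type) (w : config tilesU).

(** The tiles along the orbit of x displaced by v; insubd always succeeds,
    by val_code. *)
Definition code x v : config tilesU :=
  fun n => insubd (point : tilesU) (tile (orbit x n.1 n.2) v).

Lemma mem_tilesU t : (t \in tilesU) = (t \in tilesU_seq).
Proof. by rewrite /tilesU in_fset. Qed.

Lemma val_code x v n : transversal v ->
  val (code x v n) = tile (orbit x n.1 n.2) v.
Proof.
move=> tv; rewrite /code insubdK // -topredE /= mem_tilesU.
by have [] := tile_unit (orbit x n.1 n.2) tv.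
Qed.

Lemma codeE x v n u : transversal v ->
  code x v n = u <-> tile (orbit x n.1 n.2) v = val u.
Proof.
by move=> tv; rewrite -val_code //; split=> [->//|/val_inj].
Qed.

Lemma orbitD x i j k l : orbit (orbit x i j) k l = orbit x (k + i) (l + j).
Proof.
rewrite /orbit -addrA; congr (_ + _); rewrite -[LHS]/(_, _) /= !rmorphD /= !mulrDr.
by congr (_, _); exact: addrC.
Qed.

Lemma shift_code n x v : sigma n (code x v) = code (orbit x n.1 n.2) v.
Proof. by apply/funext => k; rewrite /shift_action /code orbitD. Qed.

Lemma code_eq x y v : transversal v -> pi x = pi y -> code x v = code y v.
Proof.
move=> tv /tpi_eq [z1 [z2 e]]; apply/funext => n; rewrite /code; congr insubd.
by apply: tile_eq => //; exists z1, z2; rewrite e /orbit addrAC.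
Qed.

Lemma orbit_back1 x i j : orbit x (i + 1) j - (a, 0) = orbit x i j.
Proof.
rewrite /orbit -addrA; congr (_ + _).
rewrite -[LHS]/(a * (i + 1)%:~R - a, a * j%:~R - 0) rmorphD /= subr0.
by congr (_, _); ring.
Qed.
Lemma orbit_back2 x i j : orbit x i (j + 1) - (0, a) = orbit x i j.
Proof.
rewrite /orbit -addrA; congr (_ + _).
rewrite -[LHS]/(a * i%:~R - 0, a * (j + 1)%:~R - a) rmorphD /= subr0.
by congr (_, _); ring.
Qed.

Lemma code_wang x v : transversal v -> Omega (code x v).
Proof.
move=> tv [i j]; rewrite !val_code // -![(i, j) + _]/(_, _) /= !addr0.
by split; rewrite /left_color /bottom_color /= ?orbit_back1 ?orbit_back2.
Qed.

Definition tiling_of w : tiling := fun i j => val (w (i, j)).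

Lemma wang_valid_of w : Omega w -> wang_valid (tiling_of w).
Proof.
move=> Ow i j; have [h v] := Ow (i, j); split.
- by rewrite -mem_tilesU /tiling_of; exact: valP.
- by move: h; rewrite /tiling_of -[(i, j) + _]/(_, _) /= addr0.
- by move: v; rewrite /tiling_of -[(i, j) + _]/(_, _) /= addr0.
Qed.

Lemma rotU_imageN k u x :
  (RU (- k) @` P u) (pi x) <-> P u (pi (orbit x k.1 k.2)).
Proof.
split=> [/rotU_image|h]; last apply/rotU_image.
  by rewrite /orbit /= !rmorphN /= !mulrN -[- (_, _)]/(_, _) /= !opprK.
by move: h; rewrite /orbit /= !rmorphN /= !mulrN -[- (_, _)]/(_, _) /= !opprK.
Qed.

(** A displaced point can be replaced by x + d for d small in the sector of
    v, and conversely the direction is irrelevant at a point of the open set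
    defined by a pattern. *)
Lemma allowedP (p : {fmap Z2 -> tilesU}) : allowed P RU p <->
  exists x v, transversal v /\
    forall k : domf p, tile (orbit x (val k).1 (val k).2) v = val (p k).
Proof.
split=> [[q hq]|[x [v [tv h]]]].
  exists (repr q), (1, 1); have tv := transversal11 R; split=> // k.
  apply: partitionU_tile => //; apply/rotU_imageN; rewrite tpiK; exact: hq.
have PF := toward_proper tv.
have near_all : \forall d \near toward v, forall k : domf p,
    k \in enum {: domf p} -> P (p k) (pi (orbit (x + d) (val k).1 (val k).2)).
  apply: (near_seq (Q := fun k d => P (p k) (pi (orbit (x + d) _ _)))) => k _.
  have := tile_partitionU tv (h k).
  by apply: filterS => d; rewrite /orbit addrAC.
have [d hd] := filter_ex near_all.
exists (pi (x + d)) => k _; apply/rotU_imageN; apply: hd.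
by rewrite mem_enum.
Qed.

Lemma language_Omega : language Omega = allowed P RU.
Proof.
apply/seteqP; split=> p.
  move=> [w /wang_valid_of Ow pw]; apply/allowedP.
  pose N : nat := (\sum_(k : domf p) (absz (val k).1 + absz (val k).2))%N.
  have kN (k : domf p) : (absz (val k).1 + absz (val k).2 <= N)%N.
    by rewrite /N (bigD1 k) //= leq_addr.
  have [x [v [tv h]]] := realized_all R (- N%:Z) (N%:Z + 1) (- N%:Z) (N%:Z + 1) Ow.
  exists x, v; split=> // k; clearbody N; have := kN k; rewrite -pw.
  by case: (val k) => i j /= ij; rewrite h //; lia.
move=> /allowedP[x [v [tv h]]]; exists (code x v); first exact: code_wang.
by move=> k; apply/codeE.
Qed.

Lemma subshift_Omega : subshift Omega.
Proof.
split.
  apply/closed_configP => w h n.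
  have [w' Ow' ww'] := h (absz n.1 + absz n.2 + 1)%N.
  have [e1 e2] := Ow' n.
  by rewrite !ww' // in e1 e2; rewrite /ball1 /=; lia.
move=> n _ [w Ow <-] k; rewrite /shift_action.
by rewrite ![k + _ + n]addrAC; exact: Ow.
Qed.

Lemma symbolic_systemE : symbolic_system P RU = Omega.
Proof.
have [sX lX] : [set X | subshift X /\ language X = allowed P RU]
    (symbolic_system P RU).
  rewrite /symbolic_system; apply: xgetPex; exists Omega.
  by split; [exact: subshift_Omega|exact: language_Omega].
apply/seteqP; split; apply: subshift_language_inj => //;
  by [exact: subshift_Omega|rewrite lX language_Omega].
Qed.

End Code.

(** * Density of the orbits *)

Section Density.
Context (R : realType).
Local Notation a := (alpha R).
Local Notation pi := (@tpi R).
Implicit Types (x y v : (R * R)%type).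

Lemma pow_Zalpha (k : nat) : exists n m : int, (1 - a) ^+ k = a * n%:~R + m%:~R.
Proof.
elim: k => [|k [n [m IH]]]; first by exists 0, 1; rewrite expr0 mulr0 add0r.
exists (- n - n - m), (m + n); rewrite exprS IH !rmorphD /= !rmorphN /=.
by ring: (alpha_sqr R).
Qed.

Lemma pow_le (k : nat) : (1 - a) ^+ k * (1 + k%:R * a) <= 1.
Proof.
have [a1 a2] := alpha_bounds R.
elim: k => [|k IH]; first by rewrite expr0 mul0r addr0 mulr1.
apply: le_trans IH; rewrite exprSr -mulrA ler_wpM2l ?exprn_ge0 //; first lra.
have k0 : 0 <= (k%:R : R) by exact: ler0n.
rewrite -natr1; nra.
Qed.

(** The powers of the unit 1 - alpha are in Z[alpha] and tend to 0, by
    Bernoulli's inequality pow_le. *)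
Lemma small_Zalpha (e : R) : 0 < e -> exists n m : int, 0 < a * n%:~R + m%:~R < e.
Proof.
move=> e0; have [a1 a2] := alpha_bounds R.
have ea : 0 < e * a by rewrite mulr_gt0 //; lra.
pose k := Num.bound (e * a)^-1.
have hk : (e * a)^-1 < k%:R 
  by apply: archi_boundP; rewrite invr_ge0 ltW.
have [n [m nm]] := pow_Zalpha k; exists n, m; rewrite -nm.
have p0 : 0 < (1 - a) ^+ k by apply: exprn_gt0; lra.
rewrite p0 /=; have := pow_le k.
have : 1 < e * (1 + k%:R * a).
  by move: hk; rewrite -[X in X < _]mul1r ltr_pdivrMr // => ?; nra.
set p := (1 - a) ^+ k in p0 *; move=> h1 h2.
have q0 : 0 < 1 + k%:R * a by rewrite ltr_pwDl // mulr_ge0 ?ler0n //; lra.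
by rewrite -(ltr_pM2r q0); lra.
Qed.

Lemma dense_Zalpha (l r : R) : l < r -> exists n m : int, l < a * n%:~R + m%:~R < r.
Proof.
move=> lr; have [n [m /andP[s0 s1]]] : exists n m : int, 0 < a * n%:~R + m%:~R < r - l.
  by apply: small_Zalpha; lra.
set s := a * _ + _ in s0 s1; pose t := Num.floor (l / s) + 1.
exists (n * t), (m * t).
have -> : a * (n * t)%:~R + (m * t)%:~R = s * t%:~R by rewrite !rmorphM /= /s; ring.
have := floor_itv (l / s); rewrite -/t => /andP[t1 t2].
have {}t1 : t%:~R - 1 <= l / s by rewrite /t rmorphD /= addrK.
rewrite ler_pdivlMr // in t1; rewrite ltr_pdivrMr // in t2.
by move: t1 t2; rewrite mulrDl mulN1r ![_ * s]mulrC; lra.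
Qed.

(** Otherwise all the elements of Z[alpha] would be multiples of 1 / n, and
    none would be small and positive. *)
Lemma alpha_irrational (n m : int) : a * n%:~R = m%:~R -> n = 0.
Proof.
move=> e; apply/eqP; apply: contraT => n0.
have nR : 0 < `|n%:~R : R| by rewrite normr_gt0 intr_eq0.
have [p [q /andP[h0 h1]]] : exists p q : int,
    0 < a * p%:~R + q%:~R < `|n%:~R : R|^-1 by apply: small_Zalpha; rewrite invr_gt0.
have : `|(a * p%:~R + q%:~R) * n%:~R| < 1.
  by rewrite normrM gtr0_norm // -ltr_pdivlMr // div1r.
have -> : (a * p%:~R + q%:~R) * n%:~R = (p * m + q * n)%:~R :> R.
  by rewrite rmorphD !rmorphM /= -e; ring.
rewrite -intr_norm -[1]/(1%:~R) ltr_int => lt1.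
have : (a * p%:~R + q%:~R) * n%:~R != 0 :> R.
  by apply: mulf_neq0; [rewrite gt_eqF|rewrite intr_eq0].
have -> : (a * p%:~R + q%:~R) * n%:~R = (p * m + q * n)%:~R :> R.
  by rewrite rmorphD !rmorphM /= -e; ring.
rewrite intr_eq0; lia.
Qed.

Lemma dense_orbit x (O : set (torus R)) : open O -> O !=set0 ->
  exists n : Z2, O (pi (orbit x n.1 n.2)).
Proof.
move=> oO [p Op]; have : nbhs (pi (repr p)) O.
  by apply: open_nbhs_nbhs; split; rewrite ?tpiK.
move=> /nbhs_tpi/nbhs_ballP[e /= e0 he]; set y := repr p in he.
have [n1 [m1 h1]] : exists n m : int,
    y.1 - x.1 - e < a * n%:~R + m%:~R < y.1 - x.1 + e by apply: dense_Zalpha; lra.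
have [n2 [m2 h2]] : exists n m : int,
    y.2 - x.2 - e < a * n%:~R + m%:~R < y.2 - x.2 + e by apply: dense_Zalpha; lra.
exists (n1, n2) => /=.
have -> : pi (orbit x n1 n2) = pi (orbit x n1 n2 + (m1%:~R, m2%:~R)).
  by apply/esym/tpi_eq; exists m1, m2.
apply: he; rewrite -ball_normE /= prod_normE gt_max /orbit /= !ltr_norml; lra.
Qed.
End Density.

(** * Directions *)

Section Directions.
Context (R : realType).
Local Notation a := (alpha R).
Implicit Types (x y v d : (R * R)%type).

Definition in_Zalpha (r : R) : Prop := exists n m : int, r = a * n%:~R + m%:~R.

Lemma lexpos_sign (r e e' : R) : (r = 0 -> 0 < e * e') ->
  lexpos r e = lexpos r e'.
Proof.
rewrite /lexpos; case: eqVneq => [->|//] /(_ erefl) ee; rewrite ltxx /=.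
by apply/idP/idP => e0; rewrite ?(pmulr_rgt0 _ e0) ?(pmulr_lgt0 _ e0) in ee.
Qed.

Lemma in_Zalpha_int (z : int) : in_Zalpha z%:~R.
Proof. by exists 0, z; rewrite mulr0 add0r. Qed.

Lemma in_Zalpha_kr (s : knum) : in_Zalpha (kr R s).
Proof. by exists (int_of_Z s.2), (int_of_Z s.1); rewrite /kr /zr mulrC addrC. Qed.

Lemma lin_in_Zalpha i x : in_Zalpha x.1 -> in_Zalpha x.2 -> in_Zalpha (lin i x).
Proof.
move=> [n [m e1]] [n' [m' e2]]; case: i => /=; rewrite ?e1 ?e2.
- by exists n, m.
- by exists n', m'.
- by exists (n + n'), (m + m'); rewrite !rmorphD /=; ring.
- exists (n' - n - m), (m + m + n + m'); rewrite !(rmorphD, rmorphN) /=.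
  by ring: (alpha_sqr R).
Qed.

Definition signs_agree x v d : Prop :=
  forall i, in_Zalpha (lin i x) -> 0 < lin i d * lin i v.

Lemma signs_agreeB x s v d : in_Zalpha s.1 -> in_Zalpha s.2 ->
  signs_agree x v d -> signs_agree (x - s) v d.
Proof.
move=> s1 s2 h i xs; apply: h; have := lin_in_Zalpha i s1 s2.
case: xs => n [m e] [n' [m' e']]; exists (n + n'), (m + m').
by rewrite !rmorphD /= -[LHS](subrK (lin i s)) -linB e e'; ring.
Qed.

(** The thresholds are in Z[alpha], so the direction matters only for the
    forms whose value at x is in Z[alpha]. *)
Lemma tile_direction x v d : transversal v -> transversal d ->
  signs_agree x v d -> tile x d = tile x v.
Proof.
move=> tv td.
have fl (r e e' : R) : e != 0 -> e' != 0 -> (in_Zalpha r -> 0 < e * e') ->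
    lexfloor r e = lexfloor r e'.
  move=> e0 e0' ee; apply/eqP; rewrite -lexfloorP //.
  have E z : lexpos (r - z%:~R) e' = lexpos (r - z%:~R) e.
    apply/esym/lexpos_sign => /eqP; rewrite subr_eq0 => /eqP E.
    by apply: ee; rewrite E; exact: in_Zalpha_int.
  by rewrite !E lexfloorP.
have col t y : signs_agree y v d -> color_at t y d = color_at t y v.
  move=> yvd.
  have fr : lexfrac y d = lexfrac y v.
    rewrite /lexfrac (fl _ _ _ (td dX) (tv dX)); last exact: yvd dX.
    by rewrite (fl _ _ _ (td dY) (tv dY)) //; exact: yvd dY.
  rewrite /color_at fr; congr eval; apply/funext => i; apply/funext => s.
  apply: lexpos_sign => /eqP; rewrite subr_eq0 => /eqP E.
  have fvd : signs_agree (lexfrac y v) v d.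
    rewrite [lexfrac y v](_ : _ = y - ((lexfloor y.1 v.1)%:~R, (lexfloor y.2 v.2)%:~R)) //.
    by apply: signs_agreeB => //; exact: in_Zalpha_int.
  by apply: fvd; rewrite E; exact: in_Zalpha_kr.
move=> xvd; have za : in_Zalpha a by exists 1, 0; rewrite mulr1 addr0.
have z0 : in_Zalpha 0 by exact: (in_Zalpha_int 0).
by rewrite /tile !col //; apply: signs_agreeB.
Qed.

Lemma code_direction x v d : transversal v -> transversal d ->
  signs_agree x v d -> code x d = code x v.
Proof.
move=> tv td xvd; apply/funext => n; rewrite /code (tile_direction tv td) //.
rewrite [orbit _ _ _](_ : _ = x - (a * (- n.1)%:~R, a * (- n.2)%:~R)).
  by apply: signs_agreeB => //=; [exists (- n.1), 0 | exists (- n.2), 0];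
    rewrite addr0.
by rewrite /orbit !rmorphN /= !mulrN; congr (_ + (_, _)); rewrite opprK.
Qed.

(** One direction in each of the eight sectors between the four lines. *)
Definition dir8 (j : 'I_8) : R * R :=
  nth (1, 1) [:: (1, 1); (2, -1); (2, -3); (1, -2);
                 (-1, -1); (-2, 1); (-2, 3); (-1, 2)] j.

Lemma transversal_dir8 j : transversal (dir8 j).
Proof.
have [a1 a2] := alpha_bounds R.
case: j => -[|[|[|[|[|[|[|[|//]]]]]]]] h i; rewrite /dir8 /=;
  case: i => /=; by [rewrite gt_eqF //; lra | rewrite lt_eqF //; lra].
Qed.

Lemma dir8_cover d : transversal d -> exists j : 'I_8, sector (dir8 j) d.
Proof.
move=> td; have [a1 a2] := alpha_bounds R.
have mk (j : 'I_8) : 0 < d.1 * (dir8 j).1 -> 0 < d.2 * (dir8 j).2 ->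
    0 < (d.1 + d.2) * ((dir8 j).1 + (dir8 j).2) ->
    0 < ((2 - a) * d.1 + d.2) * ((2 - a) * (dir8 j).1 + (dir8 j).2) ->
    exists j : 'I_8, sector (dir8 j) d.
  by move=> ? ? ? ?; exists j; case.
have := td dX; have := td dY; have := td dS; have := td dG => /= hG hS.
have pos (r t : R) : 0 < (2 - a) * d.1 + d.2 -> 0 < (2 - a) * r + t ->
    0 < ((2 - a) * d.1 + d.2) * ((2 - a) * r + t) by exact: mulr_gt0.
have neg (r t : R) : (2 - a) * d.1 + d.2 < 0 -> (2 - a) * r + t < 0 ->
    0 < ((2 - a) * d.1 + d.2) * ((2 - a) * r + t) by move=> ? ?; rewrite nmulr_rgt0.
have c0 : 0 < 1 - a by lra.
case: (ltrgt0P d.2) => // hY _; case: (ltrgt0P d.1) => // hX _.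
- have hX' := mulr_gt0 c0 hX.
  apply: (mk (Ordinal (isT : 0 < 8)%N)); rewrite /dir8 /=; [lra|lra|lra|].
  by apply: pos; lra.
- have hX' : (1 - a) * d.1 < 0 by rewrite pmulr_rlt0.
  case: (ltrgt0P (d.1 + d.2)) hS => // hS _.
    case: (ltrgt0P ((2 - a) * d.1 + d.2)) hG => // hG _.
      apply: (mk (Ordinal (isT : 7 < 8)%N)); rewrite /dir8 /=; [lra|lra|lra|].
      by apply: pos; lra.
    apply: (mk (Ordinal (isT : 6 < 8)%N)); rewrite /dir8 /=; [lra|lra|lra|].
    by apply: neg; lra.
  apply: (mk (Ordinal (isT : 5 < 8)%N)); rewrite /dir8 /=; [lra|lra|lra|].
  by apply: neg; lra.
- have hX' := mulr_gt0 c0 hX.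
  case: (ltrgt0P (d.1 + d.2)) hS => // hS _.
    apply: (mk (Ordinal (isT : 1 < 8)%N)); rewrite /dir8 /=; [lra|lra|lra|].
    by apply: pos; lra.
  case: (ltrgt0P ((2 - a) * d.1 + d.2)) hG => // hG _.
    apply: (mk (Ordinal (isT : 2 < 8)%N)); rewrite /dir8 /=; [lra|lra|lra|].
    by apply: pos; lra.
  apply: (mk (Ordinal (isT : 3 < 8)%N)); rewrite /dir8 /=; [lra|lra|lra|].
  by apply: neg; lra.
- have hX' : (1 - a) * d.1 < 0 by rewrite pmulr_rlt0.
  apply: (mk (Ordinal (isT : 4 < 8)%N)); rewrite /dir8 /=; [lra|lra|lra|].
  by apply: neg; lra.
Qed.

End Directions.

(** * Codes near a point *)

Section Factor.
Context (R : realType).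
Local Notation a := (alpha R).
Local Notation pi := (@tpi R).
Local Notation P := (@partitionU R).
Local Notation RU := (@rotU R).
Local Notation sigma := (@shift_action tilesU).
Local Notation Omega := (wang_shift tilesU).
Local Notation D := (cylinder_atom P RU).
Implicit Types (x y v d : (R * R)%type) (w : config tilesU) (N : nat).

Lemma near_toward v (U : set (R * R)) : nbhs (0 : R * R) U -> toward v U.
Proof. by move=> U0; rewrite /toward /within /=; apply: filterS U0 => d Ud _. Qed.

Lemma cylinderE w N x : D w N (pi x) <->
  forall k, ball1 N k -> P (w k) (pi (orbit x k.1 k.2)).
Proof.
by split=> h k kN; [apply/rotU_imageN; exact: h|apply/rotU_imageN; exact: h].
Qed.

Lemma code_near x v N : transversal v ->
  \forall d \near toward v, D (code x v) N (pi (x + d)).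
Proof.
move=> tv; have PF := toward_proper tv.
have : \forall d \near toward v, forall k, k \in box N ->
    P (code x v k) (pi (orbit (x + d) k.1 k.2)).
  apply: (near_seq (Q := fun k d => P (code x v k) (pi (orbit (x + d) _ _)))) => k _.
  have : tile (orbit x k.1 k.2) v = val (code x v k) by rewrite val_code.
  by move=> /(tile_partitionU tv); apply: filterS => d; rewrite /orbit addrAC.
by apply: filterS => d h; apply/cylinderE => k /ball1_box; exact: h.
Qed.

Lemma code_closure x v N : transversal v -> closure (D (code x v) N) (pi x).
Proof.
move=> tv U /nbhs_tpi xU; have PF := toward_proper tv.
have Ux : \forall d \near (0 : R * R), U (pi (x + d)).
  have : (fun d => x + d) @ (0 : R * R) --> x + 0.
    by apply: cvgD; [exact: cvg_cst|exact: cvg_id].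
  by rewrite addr0 => /(_ _ xU).
have [d [h1 h2]] : exists d, D (code x v) N (pi (x + d)) /\ U (pi (x + d)).
  apply: (@filter_ex _ (toward v)); apply: filterI; first exact: code_near.
  by apply: near_toward; exact: Ux.
by exists (pi (x + d)).
Qed.

Lemma cylinder_code w N x v : transversal v -> D w N (pi x) -> agree N w (code x v).
Proof.
move=> tv /cylinderE h k kN; apply/codeE => //; exact: partitionU_tile (h k kN).
Qed.

Lemma open_cylinder w N x : D w N (pi x) -> nbhs x [set y | D w N (pi y)].
Proof.
move=> /cylinderE h; have nb k : k \in [seq k <- box N | (absz k.1 + absz k.2 <= N)%N] ->
    \forall y \near x, P (w k) (pi (orbit y k.1 k.2)).
  rewrite mem_filter => /andP[kN _].
  have : nbhs (pi (orbit x k.1 k.2)) (P (w k)).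
    by apply: open_nbhs_nbhs; split; [exact: open_partitionU|exact: h].
  move=> /nbhs_tpi nP.
  have : (fun y => orbit y k.1 k.2) @ x --> orbit x k.1 k.2.
    by apply: cvgD; [exact: cvg_id|exact: cvg_cst].
  by move=> c; exact: (c _ nP).
have := near_seq (Q := fun k y => P (w k) (pi (orbit y k.1 k.2)))
  (nbhs_filter x) nb.
apply: filterS => y hy; apply/cylinderE => k kN; apply: hy.
by rewrite mem_filter ball1_box // andbT.
Qed.

(** A point of D w N close to x can be moved off the lines through x into
    one of the eight sectors, where the first tiles are those of the code of
    x in that direction. *)
Lemma near_agree N x : \forall z \near x, forall w,
  closure (D w N) (pi z) -> exists j : 'I_8, agree N w (code x (dir8 R j)).
Proof.
have near8 : \forall d \near (0 : R * R), forall j : 'I_8,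
    j \in enum 'I_8 -> sector (dir8 R j) d -> D (code x (dir8 R j)) N (pi (x + d)).
  apply: (@near_seq _ _ (nbhs (0 : R * R)) _ (fun j d =>
    sector (dir8 R j) d -> D (code x (dir8 R j)) N (pi (x + d)))) => j _.
  exact: (code_near x N (transversal_dir8 R j)).
move/nbhs_ballP: near8 => [e /= e0 near8].
apply/nbhs_ballP; exists e => // z0 z0x w clz.
have : nbhs (pi z0) (pi @` ball x e).
  apply/nbhs_tpi; have : nbhs z0 (ball x e).
    by apply: open_nbhs_nbhs; split => //; exact: ball_open.
  by apply: filterS => z hz; exists z.
move=> /clz [q [Dz [z xz zq]]]; rewrite -{q}zq in Dz.
(* z is moved off the four lines through x, staying in D w N *)
have tv := transversal11 R; have PF := toward_proper tv.
have near_D : \forall d \near toward (1, 1), D w N (pi (z + d)).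
  apply: near_toward; have := open_cylinder Dz.
  have : (fun d => z + d) @ (0 : R * R) --> z + 0.
    by apply: cvgD; [exact: cvg_cst|exact: cvg_id].
  by rewrite addr0 => cz /cz.
have near_ball : \forall d \near toward (1, 1), ball x e (z + d).
  apply: near_toward; have : nbhs z (ball x e).
    by apply: open_nbhs_nbhs; split => //; exact: ball_open.
  have : (fun d => z + d) @ (0 : R * R) --> z + 0.
    by apply: cvgD; [exact: cvg_cst|exact: cvg_id].
  by rewrite addr0 => cz /cz.
have near_lin i : \forall d \near toward (1, 1), lin i (z - x + d) != 0.
  have [l0|l0] := eqVneq (lin i (z - x)) 0.
    rewrite /toward near_withinE; near=> d => /(_ i) d0; rewrite linD l0 add0r.
    by apply: contraTneq d0 => ->; rewrite mul0r ltxx.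
  apply: near_toward; have := @near_lin R i `|lin i (z - x)|; rewrite normr_gt0 l0.
  move=> /(_ isT); apply: filterS => d hd; rewrite linD.
  by apply: contraTneq hd => /eqP; rewrite addr_eq0 => /eqP->; rewrite normrN ltxx.
have near_tr : \forall d \near toward (1, 1), transversal (z - x + d).
  near=> d; case; near: d; exact: near_lin.
have [d [[hD hB] ht]] := filter_ex (filterI (filterI near_D near_ball) near_tr).
have [j hj] := dir8_cover ht; exists j.
have zxd : z + d = x + (z - x + d) by rewrite [z - x + d]addrAC [RHS]addrC subrK.
have hC : D (code x (dir8 R j)) N (pi (z + d)).
  rewrite zxd; apply: near8 => //; last by rewrite mem_enum.
  by move: hB; rewrite -!ball_normE /= sub0r normrN zxd opprD addrA subrr add0r normrN.
move=> k kN; have := cylinder_code tv hC kN; have := cylinder_code tv hD kN.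
by move=> <- <-.
Unshelve. all: by end_near. Qed.

Lemma agree_code w N x : closure (D w N) (pi x) ->
  exists j : 'I_8, agree N w (code x (dir8 R j)).
Proof. exact: (nbhs_singleton (near_agree N x)). Qed.

End Factor.

(** * The factor map *)

Section FactorMap.
Context (R : realType).
Local Notation a := (alpha R).
Local Notation pi := (@tpi R).
Local Notation P := (@partitionU R).
Local Notation RU := (@rotU R).
Local Notation sigma := (@shift_action tilesU).
Local Notation Omega := (wang_shift tilesU).
Local Notation D := (cylinder_atom P RU).
Local Notation f := (symbolic_factor P RU).
Implicit Types (x y v d : (R * R)%type) (w : config tilesU) (N : nat).

Lemma agree_le M N w w' : (M <= N)%N -> agree N w w' -> agree M w w'.
Proof. by move=> MN h k kM; apply: h; exact: leq_trans kM MN. Qed.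

Lemma agree_all w w' : (forall N, agree N w w') -> w' = w.
Proof.
move=> h; apply/funext => k; apply: (h (absz k.1 + absz k.2)%N).
by rewrite /ball1 /=.
Qed.

(** Otherwise each of the eight codes differs from w somewhere, and a window
    that shows the eight differences contradicts agree_code. *)
Lemma fiber_code w x : (forall N, closure (D w N) (pi x)) ->
  exists j : 'I_8, w = code x (dir8 R j).
Proof.
move=> clx; apply: contrapT => none.
have bad (j : 'I_8) : exists N, ~ agree N w (code x (dir8 R j)).
  apply/existsNP => h; apply: none; exists j.
  by apply/esym/agree_all.
pose N j := projT1 (cid (bad j)); pose M := \max_j N j.
have [j hj] := agree_code (clx M).
apply: (projT2 (cid (bad j))); apply: agree_le hj; exact: leq_bigmax.
Qed.

Lemma cylinder_nonempty w N : Omega w -> D w N !=set0.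
Proof.
move=> /wang_valid_of Ow.
have [x [v [tv h]]] := realized_all R (- N%:Z) (N%:Z + 1) (- N%:Z) (N%:Z + 1) Ow.
have PF := toward_proper tv; have [d /cylinderE hd] := filter_ex (code_near x N tv).
exists (pi (x + d)); apply/cylinderE => k kN; have := hd k kN.
suff -> : code x v k = w k by [].
apply/codeE => //; rewrite h; first by rewrite /tiling_of -surjective_pairing.
- by move: kN; rewrite /ball1 /=; lia.
- by move: kN; rewrite /ball1 /=; lia.
Qed.

Lemma cylinder_le M N w : (M <= N)%N -> D w N `<=` D w M.
Proof. by move=> MN p h k kM; apply: h; exact: leq_trans kM MN. Qed.

(** By compactness: the sets D w N decrease, and are nonempty by
    realized_all. *)
Lemma closure_point w : Omega w -> exists x, forall N, closure (D w N) (pi x).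
Proof.
move=> Ow; pose F : set_system (torus R) := filter_from setT (D w).
have FF : ProperFilter F.
  apply: filter_from_proper; last by move=> N _; exact: cylinder_nonempty.
  apply: filter_fromT_filter; first by exists 0%N.
  move=> i j; exists (maxn i j) => p h.
  by split; apply: cylinder_le h; rewrite ?leq_maxl ?leq_maxr.
have [p [_ clp]] := @compact_torus R F FF (filterT (F := F)).
exists (repr p) => N; rewrite tpiK => U pU.
by apply: (clp (D w N) U) => //; exists N.
Qed.

Lemma Omega_code w : Omega w -> exists x (j : 'I_8), w = code x (dir8 R j).
Proof.
by move=> /closure_point[x /fiber_code[j wj]]; exists x, j.
Qed.

(** If r and r' differ modulo 1, some element of Z[alpha] translates r into
    (0, alpha) and r' into (alpha, 1), modulo 1. *)
Lemma coordinate_eq (r r' e e' : R) : e != 0 -> e' != 0 ->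
  (forall n : int, lexpos (frac1 (r + a * n%:~R) e - a) e =
     lexpos (frac1 (r' + a * n%:~R) e' - a) e') -> exists z : int, r = r' + z%:~R.
Proof.
move=> e0 e0' h; apply: contrapT => none.
have [a1 a2] := alpha_bounds R.
pose k := Num.floor (r' - r); pose s := r' - r - k%:~R.
have s0 : 0 < s < 1.
  have := floor_itv (r' - r); rewrite -/k rmorphD /= /s => /andP[k1 k2].
  suff : s != 0 by rewrite /s lt_def subr_ge0 k1 => ->; lra.
  by apply/eqP => s0; apply: none; exists (- k); rewrite rmorphN /=; move: s0; rewrite /s; lra.
have [n [m nm]] : exists n m : int,
    Num.max (- r) (a - s - r) < a * n%:~R + m%:~R < Num.min (a - r) (1 - s - r).
  by apply: dense_Zalpha; rewrite gt_max !lt_min; lra.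
rewrite gt_max lt_min in nm.
have fr (t u : R) (z : int) : u != 0 -> 0 < t + z%:~R < 1 -> frac1 t u = t + z%:~R.
  move=> u0 tz; rewrite /frac1 -[lexfloor t u]opprK rmorphN opprK; congr (_ + _%:~R).
  apply/eqP; rewrite eqr_oppLR; apply/eqP/esym/eqP; rewrite -lexfloorP //.
  rewrite rmorphD rmorphN /= /lexpos !subr_gt0 !subr_eq0; lra.
have := h n; rewrite (fr _ _ m) //; last by lra.
rewrite (fr _ _ (m - k)) //; last by rewrite rmorphB /= /s in nm s0 *; lra.
rewrite /lexpos rmorphB /=.
have -> : 0 < r + a * n%:~R + m%:~R - a = false by lra.
have -> : (r + a * n%:~R + m%:~R - a == 0) = false by lra.
have -> // : 0 < r' + a * n%:~R + (m%:~R - k%:~R) - a by rewrite /s in nm s0; lra.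
Qed.

Lemma code_inj x y v u : transversal v -> transversal u ->
  code x v = code y u -> pi x = pi y.
Proof.
move=> tv tu e.
have et (i j : int) : tile (orbit x i j) v = tile (orbit y i j) u.
  by rewrite -(val_code x (i, j) tv) e val_code.
have [z1 e1] : exists z : int, x.1 = y.1 + z%:~R.
  apply: (coordinate_eq (transversal1 tv) (transversal1 tu)) => n.
  have [_ b1 _] := tile_unit (orbit x n 0) tv.
  have [_ b2 _] := tile_unit (orbit y n 0) tu.
  by move: b1 b2; rewrite et => -> /negb_inj; rewrite /above kr_alpha.
have [z2 e2] : exists z : int, x.2 = y.2 + z%:~R.
  apply: (coordinate_eq (transversal2 tv) (transversal2 tu)) => n.
  have [_ _ b1] := tile_unit (orbit x 0 n) tv.
  have [_ _ b2] := tile_unit (orbit y 0 n) tu.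
  by move: b1 b2; rewrite et => -> /negb_inj; rewrite /above kr_alpha.
by apply/tpi_eq; exists z1, z2; rewrite [x]surjective_pairing e1 e2.
Qed.

Lemma closures_code x v : transversal v ->
  \bigcap_N closure (D (code x v) N) = [set pi x].
Proof.
move=> tv; apply/seteqP; split=> [p hp|_ -> N _]; last exact: code_closure.
have [j] : exists j : 'I_8, code x v = code (repr p) (dir8 R j).
  by apply: fiber_code => N; rewrite tpiK; exact: hp.
by move=> /(code_inj tv (transversal_dir8 R j)) /=; rewrite tpiK => ->.
Qed.

Lemma factor_code x v : transversal v -> f (code x v) = pi x.
Proof.
move=> tv; rewrite /symbolic_factor closures_code //.
by have := @getPex _ [set pi x] (ex_intro _ _ erefl).
Qed.

Lemma factor_fiber w x : Omega w -> f w = pi x ->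
  exists j : 'I_8, w = code x (dir8 R j).
Proof.
move=> /Omega_code[y [j ->]]; rewrite factor_code; last exact: transversal_dir8.
by move=> e; exists j; apply: code_eq => //; exact: transversal_dir8.
Qed.

Lemma factor_closure w N : Omega w -> closure (D w N) (f w).
Proof.
move=> /Omega_code[x [j ->]]; have tv := transversal_dir8 R j.
by rewrite factor_code //; exact: code_closure.
Qed.

Lemma closures_factor w : Omega w -> \bigcap_N closure (D w N) = [set f w].
Proof.
move=> /Omega_code[x [j ->]]; have tv := transversal_dir8 R j.
by rewrite factor_code //; exact: closures_code.
Qed.

Lemma cylinder_agree w w' N : agree N w w' -> D w' N = D w N.
Proof.
move=> h; rewrite /cylinder_atom; apply: eq_bigcapr => k kN.
by rewrite h.
Qed.

(** By compactness: the closed sets closure (D w N) decrease to the point f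
    w. *)
Lemma factor_open w U : Omega w -> nbhs (f w) U ->
  exists N, forall w', Omega w' -> agree N w w' -> U (f w').
Proof.
move=> Ow wU; suff [N NU] : exists N, closure (D w N) `<=` U.
  exists N => w' Ow' ww'; apply: NU.
  by have := factor_closure N Ow'; rewrite (cylinder_agree ww').
apply: contrapT => none.
pose F : set_system (torus R) :=
  filter_from setT (fun N => closure (D w N) `\` U).
have FF : ProperFilter F.
  apply: filter_from_proper.
    apply: filter_fromT_filter; first by exists 0%N.
    move=> i j; exists (maxn i j) => p [h nU].
    by split; split=> //; apply: closureS h;
      apply: cylinder_le; rewrite ?leq_maxl ?leq_maxr.
  move=> N _; apply: contrapT => /set0P/negP/negPn/eqP e.
  by apply: none; exists N; rewrite -setD_eq0.
have [p [_ clp]] := @compact_torus R F FF (filterT (F := F)).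
have pf : p = f w.
  have : (\bigcap_N closure (D w N)) p.
    move=> N _; apply: closed_closure => V pV.
    have [q [[q1 _] q2]] : (closure (D w N) `\` U) `&` V !=set0.
      by apply: clp => //; exists N.
    by exists q.
  by rewrite closures_factor.
have [q [[_ q1] q2]] : (closure (D w 0) `\` U) `&` U !=set0.
  by apply: clp; [exists 0%N|rewrite pf].
exact: q1.
Qed.

Lemma factor_mapU : factor_map Omega sigma RU f.
Proof.
split.
- apply/subspace_continuousP => w Ow U /(factor_open Ow)[N NU].
  rewrite /within /=; apply/nbhs_configP; exists N => w' ww' Ow'.
  exact: NU.
- apply/seteqP; split=> // p _; exists (code (repr p) (1, 1)).
    exact: code_wang (transversal11 R).
  by rewrite factor_code ?tpiK //; exact: transversal11.
- move=> n w /Omega_code[x [j ->]]; have tv := transversal_dir8 R j.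
  by rewrite shift_code !factor_code // rotU_tpi.
Qed.

(** The orbit of f w enters the open set D w0 N. *)
Lemma dense_shift w w0 N : Omega w -> Omega w0 ->
  exists n, agree N w0 (sigma n w).
Proof.
move=> /Omega_code[x [j ->]] /(cylinder_nonempty N)[p Dp].
have oD : open (D w0 N)°  by exact: open_interior.
have tv := transversal_dir8 R j.
have [|n hn] := dense_orbit x oD.
  exists p; rewrite -[p]tpiK in Dp *; apply/nbhs_tpi; exact: open_cylinder.
by exists n; rewrite shift_code; apply: cylinder_code => //; exact: interior_subset hn.
Qed.

Lemma minimal_Omega : minimal sigma Omega.
Proof.
have [cO iO] := subshift_Omega; split=> // X cX iX XO [w Xw].
apply/seteqP; split=> // w0 Ow0; move/closed_configP: cX; apply=> N.
have [n nw] := dense_shift N (XO _ Xw) Ow0.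
by exists (sigma n w) => //; apply: iX; exists w.
Qed.

Lemma aperiodic_Omega : aperiodic sigma Omega.
Proof.
split; first by exists (code (0 : R * R) (1, 1)); exact: code_wang (transversal11 R).
move=> n w /Omega_code[x [j ->]]; have tv := transversal_dir8 R j.
rewrite shift_code => /(code_inj tv tv)/tpi_eq[z1 [z2]].
rewrite /orbit => /addrI[/alpha_irrational e1 /alpha_irrational e2].
by rewrite [n]surjective_pairing e1 e2.
Qed.
End FactorMap.

(** * Markov partition *)

Section Markov.
Context (R : realType).
Local Notation a := (alpha R).
Local Notation pi := (@tpi R).
Local Notation P := (@partitionU R).
Local Notation RU := (@rotU R).
Local Notation sigma := (@shift_action tilesU).
Local Notation Omega := (wang_shift tilesU).
Local Notation D := (cylinder_atom P RU).
Local Notation f := (symbolic_factor P RU).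
Implicit Types (x y v d : (R * R)%type) (w : config tilesU) (N : nat).

Lemma topological_partitionU : topological_partition P.
Proof.
have tv := transversal11 R; split; first exact: open_partitionU.
  move=> u u' _ _ [p [Pu Pu']]; apply: val_inj.
  by rewrite -(tpiK p) in Pu Pu'; rewrite -(partitionU_tile tv Pu) (partitionU_tile tv Pu').
apply/seteqP; split=> // p _; exists (code (repr p) (1, 1) 0) => //.
have := @code_closure R (repr p) (1, 1) 0%N tv; rewrite tpiK; apply: closureS => q /(_ 0).
by rewrite -(tpiK q) => /(_ isT)/rotU_imageN; rewrite /orbit !mulr0 addr0.
Qed.

Definition domino (e : Z2) (s t : tilesU) : pattern tilesU :=
  [fmap k : [fset 0; e]%fset => if val k == 0 then s else t]%fmap.

Lemma occurs_domino e s t w : e != 0 ->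
  occurs (domino e s t) w <-> w 0 = s /\ w e = t.
Proof.
move=> e0; split=> [h|[h0 he] k].
  have k0 : 0 \in domf (domino e s t) by rewrite !inE eqxx.
  have ke : e \in domf (domino e s t) by rewrite !inE eqxx orbT.
  have := h [` k0]%fset; have := h [` ke]%fset; rewrite !ffunE /= (negPf e0).
  by move=> -> ->.
rewrite ffunE; have := valP k; rewrite !inE => /orP[]/eqP ->; rewrite ?eqxx //.
by rewrite (negPf e0).
Qed.

Lemma SFT_Omega : shift_of_finite_type Omega.
Proof.
pose F := [seq domino (1, 0) st.1 st.2 | st : tilesU * tilesU <- enum {: tilesU * tilesU} &
             right_color (val st.1) != left_color (val st.2)] ++
  [seq domino (0, 1) st.1 st.2 | st : tilesU * tilesU <- enum {: tilesU * tilesU} &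
             top_color (val st.1) != bottom_color (val st.2)].
exists F; apply/seteqP; split=> w Ow.
  move=> p + n; rewrite mem_cat => /orP[] /mapP[[s t]]; rewrite mem_filter => /andP[+ _] -> /occurs_domino.
    move=> /= ne /(_ isT); rewrite /shift_action add0r addrC => -[e1 e2].
    by have [h _] := Ow n; rewrite -e1 -e2 h eqxx in ne.
  move=> /= ne /(_ isT); rewrite /shift_action add0r addrC => -[e1 e2].
  by have [_ h] := Ow n; rewrite -e1 -e2 h eqxx in ne.
move=> n; split; apply: contrapT => /eqP ne.
  apply: (Ow (domino (1, 0) (w n) (w (n + (1, 0)))) _ n).
    rewrite mem_cat; apply/orP; left; apply/mapP; exists (w n, w (n + (1, 0))) => //.
    by rewrite mem_filter ne mem_enum.
  by apply/occurs_domino => //; rewrite /shift_action add0r addrC.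
apply: (Ow (domino (0, 1) (w n) (w (n + (0, 1)))) _ n).
  rewrite mem_cat; apply/orP; right; apply/mapP; exists (w n, w (n + (0, 1))) => //.
  by rewrite mem_filter ne mem_enum.
by apply/occurs_domino => //; rewrite /shift_action add0r addrC.
Qed.

Lemma markov_partitionU : markov_partition P RU.
Proof.
split; first exact: topological_partitionU.
  by move=> w; rewrite symbolic_systemE => Ow; exists (f w); exact: closures_factor.
rewrite symbolic_systemE; exact: SFT_Omega.
Qed.
End Markov.

(** * The maximal equicontinuous factor *)

Section EquicontinuousFactor.
Context (R : realType).
Local Notation a := (alpha R).
Local Notation pi := (@tpi R).
Local Notation P := (@partitionU R).
Local Notation RU := (@rotU R).
Local Notation sigma := (@shift_action tilesU).
Local Notation Omega := (wang_shift tilesU).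
Local Notation D := (cylinder_atom P RU).
Local Notation f := (symbolic_factor P RU).
Implicit Types (x y v d : (R * R)%type) (w : config tilesU) (N : nat).

Lemma agree_sym N w w' : agree N w w' -> agree N w' w.
Proof. by move=> h k kN; rewrite h. Qed.

(** The points of a fiber are codes of the same x. When the orbit of x
    enters the open set D w0 N, the direction does not matter any more. *)
Lemma proximal_fiber w w' w0 N : Omega w -> Omega w' -> f w = f w' -> Omega w0 ->
  exists n, agree N w0 (sigma n w) /\ agree N w0 (sigma n w').
Proof.
move=> Ow Ow' ff /(cylinder_nonempty R N)[p Dp].
have [j wj] := factor_fiber Ow (esym (tpiK (f w))).
have [j' wj'] := factor_fiber Ow' (esym (etrans (tpiK (f w)) ff)).
have [tv tv'] := (transversal_dir8 R j, transversal_dir8 R j').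
have [|n hn] := dense_orbit (repr (f w)) (@open_interior _ (D w0 N)).
  exists p; rewrite -[p]tpiK in Dp *; apply/nbhs_tpi; exact: open_cylinder.
exists n; rewrite wj wj' !shift_code.
by split; apply: cylinder_code => //; exact: interior_subset hn.
Qed.

Section Factor.
Context (Y : puniformType) (V : Z2 -> Y -> Y) (theta : config tilesU -> Y).
Context (eqV : equicontinuous_system V) (ftheta : factor_map Omega sigma V theta).

Lemma theta_near w U : Omega w -> nbhs (theta w) U ->
  exists N, forall w', Omega w' -> agree N w w' -> U (theta w').
Proof.
have [ct _ _] := ftheta; move=> Ow wU.
have /subspace_continuousP/(_ w Ow _ wU) := ct.
by move=> /nbhs_configP[N NU]; exists N => w' Ow' /NU; exact.
Qed.

(** Shifts bring w and w' arbitrarily close to each other; by equicontinuity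
    the images stay close when they are moved back, so they are equal. *)
Lemma equicontinuous_fiber w w' : Omega w -> Omega w' -> f w = f w' ->
  theta w = theta w'.
Proof.
move=> Ow Ow' ff; have [_ hY [_ V0 VD] ecV] := eqV; have [_ _ tV] := ftheta.
apply: (close_eq hY); rewrite entourage_close => E entE.
pose E1 := split_ent E `&` ((split_ent E)^-1)%relation.
have entE1 : entourage E1 by apply: filterI; [|apply: entourage_inv]; exact: entourage_split_ent.
have [N hN] := theta_near Ow (ecV (theta w) E1 entE1).
have [n [n1 n2]] := proximal_fiber N Ow Ow' ff Ow.
have [_ iO] := subshift_Omega.
have On u : Omega u -> Omega (sigma n u) by move=> Ou; apply: iO; exists u.
have back u : Omega u -> V (- n) (theta (sigma n u)) = theta u.
  by move=> Ou; rewrite tV // -VD addNr V0.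
have [_ h1] := hN _ (On _ Ow) n1 (- n) I; have [h2 _] := hN _ (On _ Ow') n2 (- n) I.
rewrite !back // in h1 h2.
exact: entourage_split entE h1 h2.
Qed.

(** psi p is the common value of theta over p. It is continuous because the
    fibers are finite and, by near_agree, upper semicontinuous. *)
Lemma factor_unique : exists! psi : torus R -> Y, factor_map setT RU V psi /\
  forall w, Omega w -> theta w = psi (f w).
Proof.
have [_ ontot tV] := ftheta; have [_ ontof fU] := factor_mapU R.
have tv := transversal11 R; have [_ iO] := subshift_Omega.
pose psi (p : torus R) : Y := theta (code (repr p) (1, 1)).
have thetaE w : Omega w -> theta w = psi (f w).
  move=> Ow; apply: equicontinuous_fiber => //; first exact: code_wang.
  by rewrite factor_code // tpiK.
have psiE x v : transversal v -> psi (pi x) = theta (code x v).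
  by move=> tx; rewrite thetaE ?factor_code //; exact: code_wang.
exists psi; split; last first.
  move=> psi' [_ h]; apply/funext => p; rewrite -(tpiK p) (psiE _ (1, 1)) // h; last exact: code_wang.
  by rewrite factor_code.
split=> //; split.
- apply: continuous_subspaceT => p U; rewrite -(tpiK p); set x := repr p.
  move=> xU; apply/nbhs_tpi.
  have hj (j : 'I_8) : exists N, forall w', Omega w' ->
      agree N (code x (dir8 R j)) w' -> U (theta w').
    have tj := transversal_dir8 R j; apply: theta_near; first exact: code_wang.
    by rewrite -psiE.
  pose N := \max_j projT1 (cid (hj j)).
  apply: filterS (near_agree N x) => z hz; rewrite /= (psiE _ (1, 1)) //.
  have [j nj] := hz (code z (1, 1)) (@code_closure R z (1, 1) N tv).
  apply: (projT2 (cid (hj j))); first exact: code_wang.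
  by apply/agree_sym; apply: agree_le nj; exact: (leq_bigmax j).
- apply/seteqP; split=> // y _.
  have : [set: Y] y by []. rewrite -ontot => -[w Ow <-]. 
  by exists (f w) => //; rewrite thetaE.
- move=> n p _; have : [set: torus R] p by []. rewrite -ontof => -[w Ow <-].
  by rewrite -fU // -!thetaE // ?tV //; apply: iO; exists w.
Qed.
End Factor.

Lemma maximal_equicontinuous_factorU : maximal_equicontinuous_factor Omega sigma RU.
Proof.
split; first exact: equicontinuous_rotU.
exists f; split; first exact: factor_mapU.
by move=> Y V theta eqV ft; exact: factor_unique.
Qed.
End EquicontinuousFactor.

(** * Fiber cardinalities *)

Section Fibers.
Context (R : realType).
Local Notation a := (alpha R).
Local Notation pi := (@tpi R).
Local Notation P := (@partitionU R).
Local Notation RU := (@rotU R).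
Local Notation sigma := (@shift_action tilesU).
Local Notation Omega := (wang_shift tilesU).
Local Notation f := (symbolic_factor P RU).
Implicit Types (x y z v d : (R * R)%type) (w : config tilesU) (i : dir).

Lemma lexfrac_unit z v : transversal v -> 0 < z.1 < 1 -> 0 < z.2 < 1 ->
  lexfrac z v = z.
Proof.
move=> tv /andP[h1 h2] /andP[h3 h4].
rewrite (@lexfrac_unique _ _ _ 0 0) //; first by rewrite !subr0; case: (z).
all: by rewrite ?belowE // /above /lexpos /= ?kr_int; lra.
Qed.

(** For each of the four forms, this lemma and the next ones provide a
    segment of a level line along which the tile tells the side to which v
    points. *)
Lemma vbit_line z v : transversal v -> z.1 = a -> 0 < z.2 < 1 ->
  vbit (tile z v) = ~~ (0 < v.1).
Proof.
move=> tv z1 z2; have [_ -> _] := tile_unit z tv; have [a1 a2] := alpha_bounds R.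
rewrite lexfrac_unit //; last by rewrite z1; lra.
by rewrite /above kr_alpha /= z1 subrr /lexpos ltxx eqxx.
Qed.

Lemma hbit_line z v : transversal v -> z.2 = a -> 0 < z.1 < 1 ->
  hbit (tile z v) = ~~ (0 < v.2).
Proof.
move=> tv z2 z1; have [_ _ ->] := tile_unit z tv; have [a1 a2] := alpha_bounds R.
rewrite lexfrac_unit //; last by rewrite z2; lra.
by rewrite /above kr_alpha /= z2 subrr /lexpos ltxx eqxx.
Qed.

Lemma lexpos_pos (r e : R) : 0 < r -> lexpos r e = true.
Proof. by rewrite /lexpos => ->. Qed.

Lemma lexpos_neg (r e : R) : r < 0 -> lexpos r e = false.
Proof. by move=> r0; rewrite /lexpos (lt_gtF r0) (lt_eqF r0). Qed.

Lemma lexpos_tie (r e : R) : r = 0 -> lexpos r e = (0 < e).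
Proof. by rewrite /lexpos => ->; rewrite ltxx eqxx. Qed.

Lemma kr_1 : kr R (1%Z, 0%Z) = 1.
Proof. by rewrite /kr /zr /= mul0r addr0. Qed.
Lemma kr_0 : kr R (0%Z, 0%Z) = 0.
Proof. by rewrite /kr /zr /= mul0r addr0. Qed.
Lemma kr_2a : kr R (0%Z, 2%Z) = 2 * a.
Proof. by rewrite /kr /zr /= add0r. Qed.

Lemma color_lineS z v : transversal v -> 0 < z.1 < a -> z.1 + z.2 = 2 * a ->
  (cA == right_color (tile z v)) = (0 < lin dS v).
Proof.
move=> tv /andP[h1 h2] h3; have [a1 a2] := alpha_bounds R; have a3 := alpha_sqr R.
rewrite /right_color [_.1]/= -cell_colorY // lexfrac_unit //; try lra.
rewrite /= /holds /above ![_.1]/= ![_.2]/= kr_1 kr_0 kr_2a.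
rewrite lexpos_tie; last by rewrite /= h3 subrr.
rewrite lexpos_neg; last by rewrite /=; nra.
by rewrite lexpos_pos /= ?subr0 // andbT eqb_id.
Qed.

Lemma color_lineG z v : transversal v -> 0 < z.1 < a -> (2 - a) * z.1 + z.2 = 1 ->
  (cA == right_color (tile z v)) = ~~ (0 < lin dG v).
Proof.
move=> tv /andP[h1 h2] h3; have [a1 a2] := alpha_bounds R; have a3 := alpha_sqr R.
rewrite /right_color [_.1]/= -cell_colorY // lexfrac_unit //; try nra.
rewrite /= /holds /above ![_.1]/= ![_.2]/= kr_1 kr_0 kr_2a.
rewrite lexpos_pos; last by rewrite /=; nra.
rewrite lexpos_tie; last by rewrite /= h3 subrr.
by rewrite lexpos_pos /= ?subr0 // andbT eqbF_neg.
Qed.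

Lemma tile_of_code x v d (n : Z2) (m1 m2 : int) : transversal v -> transversal d ->
  code x v = code x d ->
  tile (orbit x n.1 n.2 + (m1%:~R, m2%:~R)) v =
  tile (orbit x n.1 n.2 + (m1%:~R, m2%:~R)) d.
Proof.
move=> tv td e.
have h u : transversal u ->
    tile (orbit x n.1 n.2 + (m1%:~R, m2%:~R)) u = val (code x u n).
  by move=> tu; rewrite val_code //; apply: tile_eq => //; exists m1, m2.
by rewrite !h // e.
Qed.

(** The orbit of x, modulo 1, meets the segment that tells the side:
    membership in Z[alpha] gives a translate on its line, and density puts
    it between the ends. *)
Lemma code_sign x v d i : transversal v -> transversal d -> code x v = code x d ->
  in_Zalpha (lin i x) -> (0 < lin i v) = (0 < lin i d).
Proof.
move=> tv td e; have [a1 a2] := alpha_bounds R; have a3 := alpha_sqr R.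
have te n1 n2 m1 m2 := tile_of_code (n1, n2) m1 m2 tv td e.
case: i => -[n [m xi]]; rewrite /= in xi.
- have [n2 [m2 h2]] : exists n2 m2 : int, - x.2 < a * n2%:~R + m2%:~R < 1 - x.2.
    by apply: dense_Zalpha; lra.
  apply/negb_inj; have := te (1 - n) n2 (- m) m2; set z := _ + _ => tz.
  have z1 : z.1 = a by rewrite /z /= xi !(rmorphD, rmorphN) /=; ring.
  have z2 : 0 < z.2 < 1 by rewrite /z /=; lra.
  by rewrite -(vbit_line tv z1 z2) tz (vbit_line td z1 z2).
- have [n1 [m1 h1]] : exists n1 m1 : int, - x.1 < a * n1%:~R + m1%:~R < 1 - x.1.
    by apply: dense_Zalpha; lra.
  apply/negb_inj; have := te n1 (1 - n) m1 (- m); set z := _ + _ => tz.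
  have z2 : z.2 = a by rewrite /z /= xi !(rmorphD, rmorphN) /=; ring.
  have z1 : 0 < z.1 < 1 by rewrite /z /=; lra.
  by rewrite -(hbit_line tv z2 z1) tz (hbit_line td z2 z1).
- have [n1 [m1 h1]] : exists n1 m1 : int, - x.1 < a * n1%:~R + m1%:~R < a - x.1.
    by apply: dense_Zalpha; lra.
  have := te n1 (2 - n - n1) m1 (- m - m1); set z := _ + _ => tz.
  have z1 : 0 < z.1 < a by rewrite /z /=; lra.
  have zS : z.1 + z.2 = 2 * a.
    rewrite /z /= !(rmorphD, rmorphN) /=.
    by rewrite [x.2](_ : _ = a * n%:~R + m%:~R - x.1); [ring|lra].
  by rewrite -(color_lineS tv z1 zS) tz (color_lineS td z1 zS).
- have [n1 [m1 h1]] : exists n1 m1 : int, - x.1 < a * n1%:~R + m1%:~R < a - x.1.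
    by apply: dense_Zalpha; lra.
  apply/negb_inj.
  have := te n1 (n1 + m1 - n) m1 (1 - m - m1 - m1 - n1); set z := _ + _ => tz.
  have z1 : 0 < z.1 < a by rewrite /z /=; lra.
  have zG : (2 - a) * z.1 + z.2 = 1.
    rewrite /z /= !(rmorphD, rmorphN) /=.
    rewrite [x.2](_ : _ = a * n%:~R + m%:~R - (2 - a) * x.1); last by lra.
    by ring: (alpha_sqr R).
  by rewrite -(color_lineG tv z1 zG) tz (color_lineG td z1 zG).
Qed.

Lemma code_dir8 x (j k : 'I_8) :
  code x (dir8 R j) = code x (dir8 R k) <->
  forall i, in_Zalpha (lin i x) -> (0 < lin i (dir8 R j)) = (0 < lin i (dir8 R k)).
Proof.
have [tj tk] := (transversal_dir8 R j, transversal_dir8 R k).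
split=> [e i|h]; first exact: code_sign.
apply: code_direction => // i /h; have := tj i; have := tk i => k0 j0.
case: (ltrgt0P (lin i (dir8 R j))) j0 => // hj _;
  case: (ltrgt0P (lin i (dir8 R k))) k0 => // hk _ _; first exact: mulr_gt0.
by rewrite nmulr_rgt0.
Qed.

Definition sgn8 i (j : 'I_8) : bool :=
  match i with
  | dX => (j < 4)%N
  | dY => (j == 0 :> nat) || (4 < j)%N
  | dS => (j < 2)%N || (5 < j)%N
  | dG => (j < 3)%N || (6 < j)%N
  end.

Lemma sgn8E i j : (0 < lin i (dir8 R j)) = sgn8 i j.
Proof.
have [a1 a2] := alpha_bounds R.
by case: j => -[|[|[|[|[|[|[|[|//]]]]]]]] h; case: i; rewrite /dir8 /sgn8 /=;
  apply/idP/idP => //; lra.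
Qed.

Lemma sgn8_inj (j k : 'I_8) : (forall i, sgn8 i j = sgn8 i k) -> j = k.
Proof.
move=> h; apply: val_inj; move: (h dX) (h dY) (h dS) (h dG).
by case: j k {h} => -[|[|[|[|[|[|[|[|//]]]]]]]] ? [[|[|[|[|[|[|[|[|//]]]]]]]] ?].
Qed.

Lemma fiber_card x k (r : nat -> 'I_8) :
  (forall j, exists2 n, (n < k)%N & code x (dir8 R j) = code x (dir8 R (r n))) ->
  (forall m n, (m < k)%N -> (n < k)%N ->
    code x (dir8 R (r m)) = code x (dir8 R (r n)) -> m = n) ->
  (Omega `&` f @^-1` [set pi x] #= `I_k)%card.
Proof.
move=> cover inj; pose g n := code x (dir8 R (r n)).
have -> : Omega `&` f @^-1` [set pi x] = g @` `I_k.
  apply/seteqP; split=> [w [Ow /(factor_fiber Ow)[j ->]]|_ [n _ <-]].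
    by have [n nk ->] := cover j; exists n.
  by split; [apply: code_wang|rewrite /= factor_code //]; exact: transversal_dir8.
apply: inj_card_eq => m n; rewrite !in_setE => mk nk; exact: inj.
Qed.

Lemma in_ZalphaB (r s : R) : in_Zalpha r -> in_Zalpha s -> in_Zalpha (r - s).
Proof.
move=> [n [m ->]] [n' [m' ->]]; exists (n - n'), (m - m').
by rewrite !rmorphB /=; ring.
Qed.

Lemma in_Zalpha_mula (r : R) : in_Zalpha r -> in_Zalpha (a * r).
Proof.
move=> [n [m ->]]; exists (n + n + n + m), (- n).
by rewrite !(rmorphD, rmorphN) /=; ring: (alpha_sqr R).
Qed.

(** As 1 - alpha and 2 - alpha are inverse units of Z[alpha], any two of the
    forms generate the others over Z[alpha]. *)
Lemma in_Zalpha_two x i i' : i <> i' -> in_Zalpha (lin i x) ->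
  in_Zalpha (lin i' x) -> forall k, in_Zalpha (lin k x).
Proof.
have B := in_ZalphaB; have M := in_Zalpha_mula.
have XS : in_Zalpha x.1 -> in_Zalpha (x.1 + x.2) -> in_Zalpha x.2.
  by move=> h1 h2; rewrite [x.2](_ : _ = x.1 + x.2 - x.1); [exact: B|ring].
have YS : in_Zalpha x.2 -> in_Zalpha (x.1 + x.2) -> in_Zalpha x.1.
  by move=> h1 h2; rewrite [x.1](_ : _ = x.1 + x.2 - x.2); [exact: B|ring].
have XG : in_Zalpha x.1 -> in_Zalpha ((2 - a) * x.1 + x.2) -> in_Zalpha x.2.
  move=> h1 h2; rewrite [x.2](_ : _ = (2 - a) * x.1 + x.2 - x.1 - (x.1 - a * x.1)); last by ring.
  by apply: (B); apply: (B) => //; exact: M.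
have YG : in_Zalpha x.2 -> in_Zalpha ((2 - a) * x.1 + x.2) -> in_Zalpha x.1.
  set g := _ + _ => h1 h2; rewrite [x.1](_ : _ = (g - x.2) - a * (g - x.2)).
    by apply: (B); [exact: B|apply: M; exact: B].
  by rewrite /g; ring: (alpha_sqr R).
have SG : in_Zalpha (x.1 + x.2) -> in_Zalpha ((2 - a) * x.1 + x.2) -> in_Zalpha x.1.
  set g := _ * _ + _; set s := x.1 + x.2 => h1 h2.
  rewrite [x.1](_ : _ = (g - s) - a * (g - s) - (s - g)).
    by apply: (B); [apply: (B)|]; [|apply: (M)|]; exact: B.
  by rewrite /g /s; ring: (alpha_sqr R).
by case: i => //; case: i' => // _ /= h1 h2 k; apply: lin_in_Zalpha; tauto.
Qed.

Lemma fiber_card_all x : (forall i, in_Zalpha (lin i x)) ->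
  (Omega `&` f @^-1` [set pi x] #= `I_8)%card.
Proof.
move=> h; apply: (@fiber_card x 8 (fun n => inord n)).
  by move=> j; exists j => //; rewrite inord_val.
move=> m n m8 n8 /code_dir8 e; have : inord m = inord n :> 'I_8.
  by apply: sgn8_inj => i; rewrite -!sgn8E; exact: e.
by move=> /(congr1 val); rewrite /= !inordK.
Qed.

Lemma fiber_card_one x i : in_Zalpha (lin i x) ->
  (forall k, k <> i -> ~ in_Zalpha (lin k x)) ->
  (Omega `&` f @^-1` [set pi x] #= `I_2)%card.
Proof.
move=> hi none; apply: (@fiber_card x 2 (fun n => inord (4 * n))).
  move=> j; exists (~~ sgn8 i j : nat); first by case: sgn8.
  apply/code_dir8 => k kx; have -> : k = i by apply: contrapT => /none/(_ kx).
  by rewrite !sgn8E; case: (sgn8 i j); rewrite /= /sgn8 inordK //; case: i {hi none}.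
have s0 : sgn8 i (inord 0) by rewrite /sgn8 inordK //; case: i {hi none}.
have s4 : sgn8 i (inord 4) = false by rewrite /sgn8 inordK //; case: i {hi none s0}.
move=> [|[|//]] [|[|//]] _ _ // /code_dir8 /(_ i hi); rewrite !sgn8E ?muln0 ?muln1.
  by rewrite s0 s4.
by rewrite s0 s4.
Qed.

Lemma fiber_card_none x : (forall i, ~ in_Zalpha (lin i x)) ->
  (Omega `&` f @^-1` [set pi x] #= `I_1)%card.
Proof.
move=> none; apply: (@fiber_card x 1 (fun=> ord0)) => [j|[|//] [|//] //].
by exists 0%N => //; apply/code_dir8 => i /none.
Qed.

(** This provides points none, or only one, of whose forms is in Z[alpha]. *)
Lemma third_in_Zalpha (p q : int) : in_Zalpha ((a * p%:~R + q%:~R) / 3) ->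
  exists n m, p = 3 * n /\ q = 3 * m.
Proof.
move=> [n [m e]]; exists n, m.
have e1 : a * (p - 3 * n)%:~R = (3 * m - q)%:~R.
  move/(congr1 (fun r => r * 3)): e; rewrite divfK ?pnatr_eq0 // => e.
  by rewrite !rmorphB !rmorphM /=; lra.
have p0 := alpha_irrational e1.
move: e1; rewrite p0 mulr0 => /esym/eqP; rewrite intr_eq0 => /eqP q0; lia.
Qed.

(** A fiber has as many points as the eight directions have sign patterns on
    the forms whose value at x is in Z[alpha]; by in_Zalpha_two none, one or
    all of the four forms are such. *)
Lemma fiber_cardinalitiesU : fiber_cardinalities Omega f [set 1; 2; 8]%N.
Proof.
split=> [p|k].
  rewrite -(tpiK p); set x := repr p.
  have [[i hi]|none] := pselect (exists i, in_Zalpha (lin i x)); last first.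
    exists 1%N; first by left; left.
    by apply: fiber_card_none => i hi; apply: none; exists i.
  have [[k [ki hk]]|none] := pselect (exists k, k <> i /\ in_Zalpha (lin k x)).
    exists 8%N; first by right.
    by apply: fiber_card_all; exact: in_Zalpha_two ki hk hi.
  exists 2%N; first by left; right.
  by apply: (fiber_card_one hi) => k ki hk; apply: none; exists k.
have no3 (r : R) (p q : int) : r = (a * p%:~R + q%:~R) / 3 ->
    (forall n m : int, p = 3 * n -> q = 3 * m -> False) -> ~ in_Zalpha r.
  by move=> -> + /third_in_Zalpha[n [m []]]; exact.
case=> [[|]|] ->.
- exists (pi (3^-1, 3^-1)); apply: fiber_card_none => -[].
  + by apply: (no3 _ 0 1) => /= [|? ?]; [rewrite mulr0 add0r mul1r|lia].
  + by apply: (no3 _ 0 1) => /= [|? ?]; [rewrite mulr0 add0r mul1r|lia].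
  + by apply: (no3 _ 0 2) => /= [|? ?]; [lra|lia].
  + by apply: (no3 _ (-1) 3) => /= [|? ?]; [rewrite rmorphN /=; lra|lia].
- exists (pi (0, 3^-1)); apply: (@fiber_card_one _ dX).
    exact: (in_Zalpha_int _ 0).
  by case=> // _; apply: (no3 _ 0 1) => /= [|? ?]; [lra|lia|lra|lia|lra|lia].
- exists (pi (0, 0)); apply: fiber_card_all => i.
  by rewrite lin0; exact: (in_Zalpha_int _ 0).
Qed.

End Fibers.

(** * Borel probabilities on the torus *)

Section Borel.
Context (R : realType).

Lemma open_borel (M : ptopologicalType) (U : set M) :
  open U -> measurable (U : set (borel M)).
Proof. exact: sub_sigma_algebra. Qed.

Lemma closed_borel (M : ptopologicalType) (U : set M) :
  closed U -> measurable (U : set (borel M)).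
Proof. move=> cU; rewrite -[U]setCK; apply: (@measurableC _ (borel M)).
by apply: open_borel; exact: closed_openC. Qed.

Lemma measurable_borel d (T : measurableType d) (M : ptopologicalType) (D : set T)
    (g : T -> borel M) :
  (forall U : set M, open U -> measurable (D `&` g @^-1` U)) -> measurable_fun D g.
Proof.
move=> h; apply: (@measurability _ _ _ _ D g open) => //.
by move=> _ [U oU <-]; exact: h.
Qed.

Lemma continuous_borel (S M : ptopologicalType) (g : S -> M) :
  continuous g -> measurable_fun setT (g : borel S -> borel M).
Proof.
move=> cg; apply: measurable_borel => U oU; rewrite setTI.
by apply: open_borel; move/continuousP: cg; exact.
Qed.

Lemma borel_measure_eq (M : ptopologicalType)
    (m1 m2 : {measure set (borel M) -> \bar R}) : (m1 setT < +oo)%E ->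
  (forall U : set M, open U -> m1 U = m2 U) ->
  forall A, measurable A -> m1 A = m2 A.
Proof.
move=> fin h A mA; apply: (@measure_unique _ R (borel M) open (fun=> setT)) => //.
- exact: openI.
- by move=> _; exact: openT.
- by rewrite bigcup_const //; exists 0%N.
Qed.

Lemma measurable_rectangles d1 d2 (T1 : measurableType d1) (T2 : measurableType d2)
    (I : countType) (B1 : I -> set T1) (B2 : I -> set T2) (W : set (T1 * T2)) :
  (forall i, measurable (B1 i)) -> (forall i, measurable (B2 i)) ->
  (forall p, W p -> exists i, (B1 i `*` B2 i) p /\ B1 i `*` B2 i `<=` W) ->
  measurable W.
Proof.
move=> m1 m2 h.
have -> : W = \bigcup_i (if `[< B1 i `*` B2 i `<=` W >] then B1 i `*` B2 i else set0).
  apply/seteqP; split=> [p /h[i [pi iW]]|p [i _]].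
    by exists i => //; case: asboolP.
  by case: asboolP => // iW /iW.
apply: countable_bigcupT_measurable; first exact: countableP.
by move=> i; case: asboolP => // _; exact: measurableX.
Qed.

End Borel.
Section TorusMeasure.
Context (R : realType).
Local Notation a := (alpha R).
Local Notation pi := (@tpi R).
Local Notation RU := (@rotU R).
Implicit Types (x y z : (R * R)%type) (p q : torus R).
Implicit Types mu nu : probability (borel (torus R)) R.

Lemma nbhs_tpi_ball x (U : set (torus R)) : nbhs (pi x) U ->
  exists2 k : nat, True & forall y, ball x k.+1%:R^-1 y -> U (pi y).
Proof.
move=> /nbhs_tpi/nbhs_ballP[e /= e0 he].
exists (Num.bound e^-1) => // y xy; apply: he; apply: le_ball xy.
rewrite -[leRHS]invrK lef_pV2 ?posrE ?invr_gt0 ?ltr0Sn //.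
apply/ltW/(lt_le_trans (archi_boundP _)); first by rewrite invr_ge0 ltW.
by rewrite ler_nat.
Qed.

Lemma ball_translate x y z (e : R) : ball x e y -> ball (z + x) e (z + y).
Proof. by rewrite -!ball_normE /= opprD addrACA subrr add0r. Qed.

Lemma continuous_translate p : continuous (+%R p : torus R -> torus R).
Proof.
move=> q U; rewrite -[p]tpiK -[q]tpiK -tpiD => /nbhs_tpi h; apply/nbhs_tpi.
have : (fun y => repr p + y) @ repr q --> repr p + repr q.
  by apply: cvgD; [exact: cvg_cst|exact: cvg_id].
move=> /(_ _ h) {}h; rewrite -comp_preimage.
rewrite [X in nbhs _ X](_ : _ = (fun y => repr p + y) @^-1` (pi @^-1` U)) //.
by apply/funext => y; rewrite /preimage /= tpiD.
Qed.

Lemma open_translate p (O : set (torus R)) : open O -> open (+%R p @^-1` O).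
Proof. by move=> oO; have /continuousP := @continuous_translate p; exact. Qed.

Lemma borel_translate p (O : set (torus R)) : open O ->
  measurable (+%R p @^-1` O : set (borel (torus R))).
Proof. by move=> oO; apply: open_borel; exact: open_translate. Qed.

Lemma measurable_translate p :
  measurable_fun setT (+%R p : borel (torus R) -> borel (torus R)).
Proof. exact: continuous_borel (@continuous_translate p). Qed.

Lemma rotU_translate n p : RU n p = pi (orbit 0 n.1 n.2) + p.
Proof. by rewrite /orbit add0r addrC. Qed.

(** Let the rotations t k tend to the translation by p. As O is open, a
    point that the translation sends into O is sent into O by all the
    rotations t k with k large enough; for each m, the points that t k sends
    into O for all k >= m form a set of measure at most mu O. *)
Lemma rotation_semicontinuous mu : 
  (forall n (A : set (borel (torus R))), measurable A -> mu (RU n @^-1` A) = mu A) ->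
  forall p (O : set (torus R)), open O -> (mu (+%R p @^-1` O) <= mu O)%E.
Proof.
move=> inv p O oO.
have rot n : measurable (RU n @^-1` O : set (borel (torus R))).
  rewrite (_ : RU n @^-1` O = +%R (pi (orbit 0 n.1 n.2)) @^-1` O).
    exact: borel_translate.
  by apply/funext => q; rewrite /preimage /= rotU_translate.
have ex k : exists n : Z2,
    (pi @` ball (repr p) k.+1%:R^-1) (pi (orbit 0 n.1 n.2)).
  apply: dense_orbit; first by apply/open_tpi/ball_open; rewrite invr_gt0 ltr0Sn.
  by exists p; exists (repr p); [apply: ballxx; rewrite invr_gt0 ltr0Sn|exact: tpiK].
pose t k := projT1 (cid (ex k)); have ht k := projT2 (cid (ex k)); rewrite -/(t _) in ht.
pose F m := \bigcap_(k in [set k | (m <= k)%N]) (RU (t k) @^-1` O).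
have mF m : measurable (F m : set (borel (torus R))).
  by apply: bigcap_measurable => [|k _]; [exists m => /=|exact: rot].
have ndF : nondecreasing_seq F.
  by move=> m n mn; apply/subsetPset => q h k nk; apply: h; exact: leq_trans nk.
have cov : +%R p @^-1` O `<=` \bigcup_m F m.
  move=> q; rewrite /preimage /= -{1}[p]tpiK -{1}[q]tpiK -tpiD => pq.
  have [|m _ hm] := @nbhs_tpi_ball (repr p + repr q) O; first exact: open_nbhs_nbhs.
  exists m => // k /= mk; rewrite rotU_translate.
  have [y xy <-] := ht k; rewrite -[q]tpiK -tpiD; apply: hm.
  rewrite addrC [y + _]addrC; apply/ball_translate/(le_ball _ xy).
  by rewrite lef_pV2 ?posrE ?ltr0Sn // ler_nat.
have mU : measurable (\bigcup_m F m : set (borel (torus R))) by exact: bigcupT_measurable.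
apply: (@le_trans _ _ (mu (\bigcup_m F m))).
  by apply: le_measure => //; rewrite inE //; exact: borel_translate.
have cF := @nondecreasing_cvg_mu _ _ R mu F mF mU ndF.
rewrite -(cvg_lim _ cF) //; apply: lime_le; first by apply/cvg_ex; eexists; exact: cF.
apply: nearW => m; rewrite /= -(inv (t m) _ (open_borel oO)).
by apply: le_measure; rewrite ?inE // => q; apply => /=.
Qed.

(** Semicontinuity for p and for - p gives the invariance of the measure of
    open sets. *)
Lemma rotation_haar mu :
  (forall n (A : set (borel (torus R))), measurable A -> mu (RU n @^-1` A) = mu A) ->
  haar_probability mu.
Proof.
move=> inv p A mA; pose nu := pushforward mu (+%R p : borel (torus R) -> borel (torus R)).
have mp := measurable_translate p.
have -> : mu (+%R p @^-1` A) = nu A by [].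
apply: (@borel_measure_eq R (torus R)) => //.
  by rewrite /= /nu /pushforward preimage_setT probability_setT ltry.
move=> O oO; apply/eqP; rewrite eq_le; apply/andP; split.
  exact: rotation_semicontinuous.
have /= := rotation_semicontinuous inv (- p) (open_translate oO (p := p)).
congr (mu _ <= _)%E; apply/funext => q.
by rewrite /preimage /= addNKr.
Qed.

Lemma subr_perturb (V : zmodType) (r y u z : V) :
  r - (z - (u - y)) = (r - y) + (u - z).
Proof. by rewrite opprB [u - y]addrC -!addrA. Qed.

Lemma near_orbit k p (B := fun n : Z2 => pi @` ball (orbit 0 n.1 n.2) k.+1%:R^-1) :
  exists n, B n p /\
    forall p', B n p' -> exists2 z, ball (repr p) (2 * k.+1%:R^-1) z & pi z = p'.
Proof.
have e0 : 0 < k.+1%:R^-1 :> R by rewrite invr_gt0 ltr0Sn.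
have [||n [y hy yn]] := @dense_orbit R 0 (pi @` ball (repr p) k.+1%:R^-1).
- by apply/open_tpi/ball_open.
- by exists p; exists (repr p); [exact: ballxx|exact: tpiK].
have yo : pi (orbit 0 n.1 n.2 - y) = 0 by rewrite tpiB yn subrr.
exists n; split=> [|p' [z hz <-]].
  exists (repr p + (orbit 0 n.1 n.2 - y)); last by rewrite tpiD yo tpiK addr0.
  move: hy; rewrite -!ball_normE /= distrC => hy.
  by rewrite opprD opprB addrCA [orbit _ _ _ + _]addrC subrK addrC.
exists (z - (orbit 0 n.1 n.2 - y)); last by rewrite tpiB yo subr0.
move: hy hz; rewrite -!ball_normE /= => hy hz.
rewrite (@subr_perturb _ (repr p) y).
by rewrite mulr_natl mulr2n (le_lt_trans (ler_normD _ _)) // ltrD.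
Qed.

(** The balls around the points of the orbit of 0 are a countable base, so
    that open subsets of the product are countable unions of rectangles. *)
Lemma borel_add : measurable_fun setT
  ((fun pq => pq.1 + pq.2) : borel (torus R) * borel (torus R) -> borel (torus R)).
Proof.
apply: measurable_borel => O oO; rewrite setTI.
pose B (n : Z2) (k : nat) := pi @` ball (orbit 0 n.1 n.2 : R * R) k.+1%:R^-1.
have oB n k : open (B n k) by apply/open_tpi/ball_open; rewrite invr_gt0 ltr0Sn.
apply: (@measurable_rectangles _ _ (borel (torus R)) (borel (torus R)) (Z2 * Z2 * nat)%type
  (fun i => B i.1.1 i.2) (fun i => B i.1.2 i.2)) => [i|i|[p q]]; try exact: open_borel (oB _ _).
rewrite /preimage /= -{1}[p]tpiK -{1}[q]tpiK -tpiD => pq.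
have [|m _ hm] := @nbhs_tpi_ball (repr p + repr q) O; first exact: open_nbhs_nbhs.
pose k := (4 * m + 4)%N; pose e : R := k.+1%:R^-1.
have e0 : 0 < e by rewrite invr_gt0 ltr0Sn.
have e4 : 4 * e <= m.+1%:R^-1.
  rewrite /e -ler_pdivlMl // -invfM lef_pV2 ?posrE ?mulr_gt0 ?ltr0Sn //.
  by rewrite -natrM ler_nat /k; lia.
have [n [np hn]] := near_orbit k p; have [n' [np' hn']] := near_orbit k q.
exists (n, n', k); split=> // -[p' q'] /= [/hn[x xp <-] /hn'[y yq <-]].
rewrite -tpiD; apply: hm; apply: le_ball e4 _ _.
have -> : 4 * e = 2 * e + 2 * e by ring.
apply: (@ball_triangle _ _ (x + repr q)); last exact: ball_translate.
by rewrite addrC [x + _]addrC; exact: ball_translate.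
Qed.

Definition convolution mu nu (A : set (torus R)) : \bar R :=
  (mu \x nu)%E ((fun pq => pq.1 + pq.2) @^-1` A).

Lemma measurable_add (A : set (borel (torus R))) : measurable A ->
  measurable ((fun pq : borel (torus R) * borel (torus R) => pq.1 + pq.2) @^-1` A).
Proof. by move=> mA; rewrite -[X in measurable X]setTI; exact: borel_add. Qed.

Lemma convolution1 mu nu A :
  convolution mu nu A = (\int[mu]_p nu (+%R p @^-1` A))%E.
Proof.
rewrite /convolution /product_measure1; apply: eq_integral => p _ /=.
by rewrite xsectionE.
Qed.

Lemma convolution2 mu nu (A : set (borel (torus R))) : measurable A ->
  convolution mu nu A = (\int[nu]_q mu (+%R q @^-1` A))%E.
Proof.
move=> mA; rewrite /convolution.
rewrite (@product_measure_unique _ _ _ _ _ mu nu (mu \x^ nu)%E) /=; last first.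
- exact: measurable_add.
- by move=> B C mB mC; exact: product_measure2E.
rewrite /product_measure2; apply: eq_integral => q _ /=.
by rewrite ysectionE; congr (mu _); apply/funext => p; rewrite /preimage /= addrC.
Qed.

(** The convolution of mu and nu is equal to nu when the integral over mu
    comes last, and to mu when the integral over nu does. *)
Lemma haar_unique mu nu : haar_probability mu -> haar_probability nu ->
  forall A : set (borel (torus R)), measurable A -> mu A = nu A.
Proof.
move=> hmu hnu A mA; have cst (m m' : probability (borel (torus R)) R) :
    haar_probability m -> (\int[m']_p m (+%R p @^-1` A))%E = m A.
  move=> hm; under eq_integral do rewrite hm //.
  rewrite integral_cst // [X in (_ * X)%E](_ : _ = 1%E) ?mule1 //.
  exact: (probability_setT m').
by rewrite -(cst mu nu hmu) -convolution2 // convolution1 cst.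
Qed.

Lemma convolution_translate mu nu p (A : set (borel (torus R))) : measurable A ->
  (forall B : set (borel (torus R)), measurable B -> nu (+%R p @^-1` B) = nu B) ->
  convolution mu nu (+%R p @^-1` A) = convolution mu nu A.
Proof.
move=> mA inv; rewrite !convolution1; apply: eq_integral => q _.
rewrite -[RHS]inv; last by rewrite -[X in measurable X]setTI; exact: measurable_translate.
by congr (nu _); apply/funext => z; rewrite /preimage /= addrCA.
Qed.

Lemma convolutionC mu nu (A : set (borel (torus R))) : measurable A ->
  convolution mu nu A = convolution nu mu A.
Proof. by move=> mA; rewrite convolution2 // convolution1. Qed.

End TorusMeasure.

(** * Existence of the Haar probability *)

Section Circle.
Context (R : realType).
Local Notation mu := (@lebesgue_measure R).

Lemma lebesgue_translate (t : R) (C : set (measurableTypeR R)) : measurable C ->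
  mu (+%R t @^-1` C) = mu C.
Proof.
move=> mC; have mt : measurable_fun setT (+%R t : measurableTypeR R -> measurableTypeR R).
  by apply: measurable_funD; [exact: measurable_cst|exact: measurable_id].
rewrite -[LHS]/(pushforward mu (+%R t : measurableTypeR R -> measurableTypeR R) C).
apply/esym/lebesgue_measure_unique => //= _ [[b c]] _ <-.
rewrite /pushforward (_ : _ @^-1` _ = `]b - t, c - t]%classic); last first.
  by apply/funext => r; rewrite /preimage /= !in_itv /=; apply/propext; split; lra.
by rewrite !lebesgue_measure_itv /= !lte_fin -!EFinD ltrD2r; case: ifP => // _; congr (_%:E); ring.
Qed.

(** The translation cuts [0, 1) into two intervals and, modulo 1, exchanges
    them. *)
Lemma lebesgue_periodic (t : R) (C : set (measurableTypeR R)) : measurable C ->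
  (forall r, C (1 + r) <-> C r) -> 0 <= t < 1 ->
  mu (+%R t @^-1` C `&` `[0, 1[) = mu (C `&` `[0, 1[).
Proof.
move=> mC per /andP[t0 t1].
have mI (b c : R) : measurable (C `&` `[b, c[ : set (measurableTypeR R)).
  by apply: measurableI => //; exact: measurable_itv.
have cut (b c d : R) : b <= c -> c <= d ->
    mu (C `&` `[b, d[) = (mu (C `&` `[b, c[) + mu (C `&` `[c, d[))%E.
  move=> bc cd; rewrite -measureU //.
    congr (mu _); apply/funext => r /=; rewrite !in_itv /=; apply/propext; split.
      by move=> [Cr /andP[br rd]]; case: (ltP r c) => rc; [left|right]; split=> //; rewrite ?br ?rc.
    by move=> [[Cr /andP[br rc]]|[Cr /andP[cr rd]]]; split=> //; lra.
  apply/seteqP; split=> // r /= [[_]]; rewrite in_itv /= => /andP[_ rc] [_].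
  by rewrite in_itv /= => /andP[cr _]; lra.
have -> : +%R t @^-1` C `&` `[0, 1[ = +%R t @^-1` (C `&` `[t, 1 + t[).
  by apply/funext => r; rewrite /preimage /= !in_itv /=; apply/propext; split=> -[? ?]; split=> //; lra.
have t1t : 1 <= 1 + t by lra.
rewrite lebesgue_translate // (cut _ _ _ (ltW t1) t1t) (cut _ _ _ t0 (ltW t1)).
rewrite addeC; congr (_ + _)%E; rewrite -(lebesgue_translate 1) //.
congr (mu _); apply/funext => r; rewrite /preimage /= !in_itv /=; apply/propext.
by split=> -[/per ? ?]; split=> //; lra.
Qed.

End Circle.

Section HaarExistence.
Context (R : realType).
Local Notation pi := (@tpi R).
Local Notation mu := (@lebesgue_measure R).
Implicit Types e x : (R * R)%type.

Lemma uniform01E (A : set (measurableTypeR R)) : measurable A ->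
  uniform_prob (@ltr01 R) A = mu (A `&` `[0, 1[).
Proof.
move=> mA; rewrite /uniform_prob integral_uniform_pdf.
have mI : measurable (A `&` `[0, 1] : set (measurableTypeR R)).
  by apply: measurableI => //; exact: measurable_itv.
rewrite (eq_integral (cst 1%E)); last first.
  move=> r; rewrite inE /= => -[_]; rewrite in_itv /uniform_pdf /= => ->.
  by rewrite subr0 invr1.
rewrite integral_cst // mul1e (_ : A `&` `[0, 1] = A `&` `[0, 1[ `|` A `&` [set 1]).
  rewrite measureU; last first.
  - apply/seteqP; split=> // r [[_]] /=; rewrite in_itv /= => /andP[_ r1] [_ r1'].
    by rewrite r1' ltxx in r1.
  - exact: measurableI.
  - by apply: measurableI => //; exact: measurable_itv.
  rewrite [X in (_ + X)%E](_ : _ = 0%E) ?adde0 //.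
  apply/eqP; rewrite eq_le measure_ge0 andbT -(lebesgue_measure_set1 1).
  by apply: le_measure; rewrite ?inE //; exact: measurableI.
apply/seteqP; split=> r /=; rewrite !in_itv /=.
  move=> [Ar /andP[r0]]; rewrite le_eqVlt => /orP[/eqP r1|r1]; first by right.
  by left; rewrite r0 r1.
by move=> [[Ar /andP[r0 r1]]|[Ar r1]]; split=> //; [rewrite r0 ltW|rewrite r1 ler01 lexx].
Qed.

Definition ray e (t : measurableTypeR R) : borel (torus R) := pi (t *: e).

Lemma measurable_ray e : measurable_fun setT (ray e).
Proof.
apply: measurable_borel => U oU; rewrite setTI; apply: open_measurable.
have : continuous (fun t : R => pi (t *: e)).
  move=> t; apply: continuous_comp; last exact: continuous_tpi.
  by apply: cvgZr_tmp; exact: cvg_id.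
by move/continuousP; exact.
Qed.

HB.instance Definition _ e := isMeasurableFun.Build _ _ _ _ (ray e) (measurable_ray e).

(** For e in the lattice, the uniform probability on a closed one-parameter
    subgroup. *)
Definition circle e : probability (borel (torus R)) R :=
  distribution (uniform_prob (@ltr01 R)) (ray e).

Lemma circle_translate e (t : R) (A : set (borel (torus R))) :
  (forall n : int, pi (n%:~R *: e) = 0) -> measurable A ->
  circle e (+%R (pi (t *: e)) @^-1` A) = circle e A.
Proof.
move=> e0 mA.
have mray (B : set (borel (torus R))) : measurable B ->
    measurable (ray e @^-1` B : set (measurableTypeR R)).
  by move=> mB; rewrite -[X in measurable X]setTI; exact: measurable_ray.
have mtA : measurable (+%R (pi (t *: e)) @^-1` A : set (borel (torus R))).
  by rewrite -[X in measurable X]setTI; exact: measurable_translate.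
pose s := t - (Num.floor t)%:~R.
have ts : pi (t *: e) = pi (s *: e).
  by rewrite /s scalerBl tpiB e0 subr0.
have s01 : 0 <= s < 1.
  have := floor_itv t; rewrite rmorphD /= /s; lra.
have circleE (B : set (borel (torus R))) : measurable B ->
    circle e B = mu (ray e @^-1` B `&` `[0, 1[).
  by move=> mB; rewrite -uniform01E //; exact: mray.
rewrite !circleE //.
rewrite -[in RHS](lebesgue_periodic _ _ s01); last 2 first.
- exact: mray.
- by move=> r; rewrite /preimage /= /ray scalerDl tpiD (e0 1) add0r.
congr (mu (_ `&` _)); apply/funext => r; rewrite /preimage /= /ray scalerDl tpiD.
by rewrite ts.
Qed.

Definition torus_add (pq : borel (torus R) * borel (torus R)) : borel (torus R) :=
  pq.1 + pq.2.

HB.instance Definition _ := isMeasurableFun.Build _ _ _ _ torus_add (@borel_add R).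

Lemma convolution_probability (m1 m2 : probability (borel (torus R)) R) :
  exists m : probability (borel (torus R)) R, forall A, m A = convolution m1 m2 A.
Proof. by exists (distribution (m1 \x m2)%E torus_add). Qed.

(** The convolution of the uniform probabilities on the two coordinate
    circles is invariant under both circles. *)
Lemma haar_exists : exists mu : probability (borel (torus R)) R, haar_probability mu.
Proof.
pose c1 := circle (1, 0); pose c2 := circle (0, 1).
have [lambda lambdaE] := convolution_probability c1 c2.
exists lambda => p A mA; rewrite !lambdaE {lambda lambdaE}.
have p0 : pi 0 = 0 by rewrite -[X in pi X](subrr 0) tpiB subrr.
have int1 (n : int) : pi (n%:~R *: (1, 0)) = 0.
  rewrite -p0; apply/tpi_eq; exists n, 0.
  by rewrite add0r; congr (_, _); [exact: mulr1|exact: mulr0].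
have int2 (n : int) : pi (n%:~R *: (0, 1)) = 0.
  rewrite -p0; apply/tpi_eq; exists 0, n.
  by rewrite add0r; congr (_, _); [exact: mulr0|exact: mulr1].
have inv1 t (B : set (borel (torus R))) : measurable B ->
    c1 (+%R (pi (t *: (1, 0))) @^-1` B) = c1 B by move=> mB; exact: circle_translate.
have inv2 t (B : set (borel (torus R))) : measurable B ->
    c2 (+%R (pi (t *: (0, 1))) @^-1` B) = c2 B by move=> mB; exact: circle_translate.
clearbody c1 c2.
set x := repr p; have -> : p = pi (x.1 *: (1, 0)) + pi (x.2 *: (0, 1)).
  rewrite -tpiD -[LHS]tpiK; congr pi; rewrite [LHS]surjective_pairing.
  congr (_, _); first by apply/esym/(etrans _ (mulr1 x.1)); rewrite /= [X in _ + X]mulr0 addr0.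
  by apply/esym/(etrans _ (mulr1 x.2)); rewrite /= [X in X + _]mulr0 add0r.
set p1 := pi _; set p2 := pi _.
have mt q : measurable (+%R q @^-1` A : set (borel (torus R))).
  by rewrite -[X in measurable X]setTI; exact: measurable_translate.
rewrite (_ : +%R (p1 + p2) @^-1` A = +%R p2 @^-1` (+%R p1 @^-1` A)); last first.
  by apply/funext => q; rewrite /preimage /= addrA.
rewrite (convolution_translate c1 (mt p1) (inv2 x.2)).
by rewrite (convolutionC _ _ (mt p1)) (convolution_translate c2 mA (inv1 x.1)) convolutionC.
Qed.

End HaarExistence.

(** * Null lines *)

Section Lines.
Context (R : realType).
Local Notation a := (alpha R).
Local Notation pi := (@tpi R).
Local Notation RU := (@rotU R).
Implicit Types (x y z : (R * R)%type) (p q : torus R) (i : dir).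

Definition line i : set (torus R) := [set p | in_Zalpha (lin i (repr p))].

Lemma in_ZalphaN (r : R) : in_Zalpha r -> in_Zalpha (- r).
Proof. by rewrite -sub0r; apply: in_ZalphaB; exact: (in_Zalpha_int _ 0). Qed.

Lemma in_Zalpha_addr (r s : R) : in_Zalpha s -> in_Zalpha (r + s) <-> in_Zalpha r.
Proof.
move=> hs; split=> h; last by rewrite -[s]opprK; exact/in_ZalphaB/in_ZalphaN.
by rewrite -[r](addrK s); exact: in_ZalphaB.
Qed.

Lemma line_add i x s : in_Zalpha s.1 -> in_Zalpha s.2 ->
  in_Zalpha (lin i (x + s)) <-> in_Zalpha (lin i x).
Proof. by move=> s1 s2; rewrite linD; apply/in_Zalpha_addr/lin_in_Zalpha. Qed.

Lemma line_tpi i x : line i (pi x) <-> in_Zalpha (lin i x).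
Proof.
rewrite /line /=; have /tpi_eq[z1 [z2 ->]] := tpiK (pi x).
by apply: line_add; exact: in_Zalpha_int.
Qed.

Lemma line_rotU i n p : line i (RU n p) <-> line i p.
Proof.
rewrite -[p]tpiK rotU_tpi !line_tpi; apply: line_add => /=.
  by exists n.1, 0; rewrite addr0.
by exists n.2, 0; rewrite addr0.
Qed.

(** A countable union of compact segments: the lines of irrational slope are
    dense in the torus. *)
Lemma measurable_line i : measurable (line i : set (borel (torus R))).
Proof.
pose Q : set (R * R) := `[0, 1]%classic `*` `[0, 1]%classic.
pose seg (s : Z2) := pi @` (Q `&` [set x | lin i x = a * s.1%:~R + s.2%:~R]).
have -> : line i = \bigcup_s seg s.
  apply/seteqP; split=> [p|p [s _ [x [_ /= xs] <-]]]; last first.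
    by apply/line_tpi; exists s.1, s.2.
  have : [set: torus R] p by [].
  rewrite torus_square => -[x Qx <-] /line_tpi[n [m nm]].
  by exists (n, m) => //; exists x.
apply: countable_bigcupT_measurable => [|s]; first exact: countableP.
apply: closed_borel; apply: (compact_closed (@hausdorff_torus R)).
apply: continuous_compact; first exact/continuous_subspaceT/continuous_tpi.
apply: compact_closedI; first by apply: compact_setX; exact: segment_compact.
have /continuous_closedP cl := @continuous_lin R i.
exact: (cl _ (@closed_eq _ _)).
Qed.

(** The translates of a line by e / (k + 2), for a vector e with lin i e =
    1, are pairwise disjoint because a rational number in Z[alpha] is an
    integer. *)
Lemma haar_line (mu : probability (borel (torus R)) R) i :
  haar_probability mu -> mu (line i) = 0%E.
Proof.
move=> hmu; pose e : R * R := if i is dX then (1, 0) else (0, 1).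
have le (r : R) : lin i (r *: e) = r.
  by rewrite linZ /e; case: i {e} => /=; rewrite ?mulr0 ?addr0 ?add0r mulr1.
pose T k := +%R (pi ((k.+2%:R^-1 : R) *: e)) @^-1` line i.
have mT k : measurable (T k : set (borel (torus R))).
  by rewrite -[X in measurable X]setTI; apply: measurable_translate => //; exact: measurable_line.
have TE k x : T k (pi x) <-> in_Zalpha (k.+2%:R^-1 + lin i x).
  by rewrite /T /preimage /= -tpiD line_tpi linD le.
have tT : trivIset setT T.
  move=> k l _ _ [p []]; rewrite -[p]tpiK !TE => hk hl.
  have := in_ZalphaB hk hl; rewrite opprD addrACA subrr addr0 => -[n [m e1]].
  have kl0 : (k.+2%:R : R) != 0 /\ (l.+2%:R : R) != 0 by rewrite !pnatr_eq0.
  have e2 : a * (n * k.+2%:Z * l.+2%:Z)%:~R = (l.+2%:Z - k.+2%:Z - m * k.+2%:Z * l.+2%:Z)%:~R.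
    rewrite !(rmorphB, rmorphM) /= -!pmulrn.
    have -> : a * (n%:~R * k.+2%:R * l.+2%:R) =
      (a * n%:~R + m%:~R) * (k.+2%:R * l.+2%:R) - m%:~R * k.+2%:R * l.+2%:R by ring.
    rewrite -e1; case: kl0; move: (k.+2%:R : R) (l.+2%:R : R) => K L K0 L0.
    by field; rewrite K0 L0.
  move: (e2); rewrite (alpha_irrational e2) mulr0 => /esym/eqP.
  rewrite intr_eq0 => /eqP e3.
  have [m0|m0] := eqVneq m 0; first by move: e3; rewrite m0 !mul0r; lia.
  have : (1 <= absz m)%N by lia.
  have : (absz m * (k.+2 * l.+2) < k.+2 + l.+2)%N.
    have -> : (absz m * (k.+2 * l.+2))%N = absz (l.+2%:Z - k.+2%:Z).
      by rewrite (_ : l.+2%:Z - k.+2%:Z = m * k.+2%:Z * l.+2%:Z) ?abszM ?mulnA //; lia.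
    lia.
  nia.
have muT k : mu (T k) = mu (line i) by apply: hmu; exact: measurable_line.
have fin : mu (line i) \is a fin_num by apply: fin_num_measure; exact: measurable_line.
have bound N : (N%:R * fine (mu (line i)) <= 1)%R.
  have -> : (N%:R * fine (mu (line i)))%R = (\sum_(k < N) fine (mu (line i)))%R.
    by rewrite sumr_const card_ord mulr_natl.
  rewrite -lee_fin -sumEFin; under eq_bigr => k _ do rewrite fineK // -(muT k).
  rewrite -measure_bigsetU //; apply: probability_le1.
  by apply: bigsetU_measurable => k _.
rewrite -(fineK fin); congr (_%:E); apply/eqP; rewrite eq_le fine_ge0 // andbT.
rewrite leNgt; apply/negP => c0.
have := bound (Num.bound (fine (mu (line i)))^-1); apply/negP; rewrite -ltNge.
by rewrite -ltr_pdivrMr // div1r; apply: archi_boundP; rewrite invr_ge0 ltW.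
Qed.

Definition singular : set (torus R) := [set p | exists i, line i p].

Lemma singular_bigcup : singular = line dX `|` line dY `|` line dS `|` line dG.
Proof.
apply/seteqP; split=> [p [[] h]|p [[[]|]|] h]; last 4 first.
- by exists dX. - by exists dY. - by exists dS. - by exists dG.
- by left; left; left. - by left; left; right. - by left; right. - by right.
Qed.

Lemma measurable_singular : measurable (singular : set (borel (torus R))).
Proof.
rewrite singular_bigcup.
by do ?[exact: measurable_line|apply: (@measurableU _ (borel (torus R)))].
Qed.

Lemma haar_singular (mu : probability (borel (torus R)) R) :
  haar_probability mu -> mu singular = 0%E.
Proof.
move=> hmu; apply/eqP; rewrite eq_le measure_ge0 andbT singular_bigcup.
have U (A B : set (borel (torus R))) : measurable A -> measurable B ->
    mu A = 0%E -> mu B = 0%E -> mu (A `|` B) = 0%E.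
  move=> mA mB A0 B0; apply/eqP; rewrite eq_le measure_ge0 andbT.
  have AB : (mu A + mu B = 0)%E by rewrite A0 B0 adde0.
  by rewrite -AB; exact: measureU2.
have mL := measurable_line; have L0 i := haar_line i hmu.
by rewrite !U //; do ?[exact: mL|apply: measurableU].
Qed.

Lemma singular_tpi x : singular (pi x) <-> exists i, in_Zalpha (lin i x).
Proof. by split=> -[i /line_tpi h]; exists i. Qed.

Lemma singular_rotU n p : singular (RU n p) <-> singular p.
Proof. by split=> -[i h]; exists i; move: h => /line_rotU. Qed.

End Lines.

(** * Coding of the points of the torus *)

Section Coding.
Context (R : realType).
Local Notation a := (alpha R).
Local Notation pi := (@tpi R).
Local Notation P := (@partitionU R).
Local Notation RU := (@rotU R).
Local Notation sigma := (@shift_action tilesU).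
Local Notation Omega := (wang_shift tilesU).
Local Notation f := (symbolic_factor P RU).
Implicit Types (x y z v d : (R * R)%type) (w : config tilesU) (p q : torus R) (N : nat).

(** An equivariant section of the factor map, which inverts it outside of
    the singular points. *)
Definition coding p : config tilesU := code (repr p) (1, 1).

Lemma coding_tpi x : coding (pi x) = code x (1, 1).
Proof. by apply: code_eq; [exact: transversal11|exact: tpiK]. Qed.

Lemma coding_Omega p : Omega (coding p).
Proof. exact: code_wang (transversal11 R). Qed.

Lemma factor_coding p : f (coding p) = p.
Proof. by rewrite /coding factor_code ?tpiK //; exact: transversal11. Qed.

Lemma coding_rotU n p : coding (RU n p) = sigma n (coding p).
Proof. by rewrite -[p]tpiK rotU_tpi !coding_tpi shift_code. Qed.

Lemma coding_factor w : Omega w -> ~ singular (f w) -> coding (f w) = w.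
Proof.
move=> Ow; rewrite -[f w]tpiK => /singular_tpi ns.
have [j wj] := factor_fiber Ow (esym (tpiK (f w))).
rewrite coding_tpi [in RHS]wj; apply: code_direction.
- exact: transversal_dir8.
- exact: transversal11.
- by move=> i hi; case: ns; exists i.
Qed.

Lemma coding_tile p k u : coding p k = u ->
  exists m : nat, forall n, (m <= n)%N ->
    P u (pi (orbit 0 k.1 k.2) + (pi (n.+1%:R^-1 *: (1, 1)) + p)).
Proof.
have tv := transversal11 R; set x := repr p.
rewrite -[p in coding p]tpiK coding_tpi => /codeE-/(_ tv)/(tile_partitionU tv).
move=> /(toward_scale tv) [e /= e0 he].
exists (Num.bound e^-1) => n mn; rewrite -[p]tpiK -/x -!tpiD.
rewrite (_ : _ + _ = orbit x k.1 k.2 + n.+1%:R^-1 *: (1, 1)); last first.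
  by rewrite /orbit add0r [n.+1%:R^-1 *: _ + x]addrC addrA [_ + x]addrC.
have n0 : 0 < n.+1%:R^-1 :> R by rewrite invr_gt0 ltr0Sn.
apply: he => //=; rewrite sub0r normrN gtr0_norm // -[e]invrK ltf_pV2 ?posrE ?invr_gt0 ?ltr0Sn //.
apply: (lt_le_trans (archi_boundP _)); first by rewrite invr_ge0 ltW.
by rewrite ler_nat leqW.
Qed.

(** The condition that a displaced point sees u is a lower limit, as n tends
    to infinity, of the open conditions that the point moved by (1, 1) / (n
    + 1) sees u. *)
Lemma measurable_coordinate k u :
  measurable ([set p | coding p k = u] : set (borel (torus R))).
Proof.
pose F n : set (torus R) := [set p | P u (pi (orbit 0 k.1 k.2) + (pi (n.+1%:R^-1 *: (1, 1)) + p))].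
have -> : [set p | coding p k = u] = \bigcup_m \bigcap_(n in [set n | (m <= n)%N]) F n.
  apply/seteqP; split=> [p /coding_tile[m hm]|p [m _ hm]]; first by exists m.
  have [m' hm'] := coding_tile (erefl (coding p k)).
  have [_ tP _] := topological_partitionU R; apply: tP => //.
  exists (pi (orbit 0 k.1 k.2) + (pi ((maxn m m').+1%:R^-1 *: (1, 1)) + p)).
  by split; [apply: hm'|apply: hm]; rewrite /= ?leq_maxl ?leq_maxr.
apply: (@bigcupT_measurable _ (borel (torus R))) => m.
apply: (@bigcap_measurable _ (borel (torus R))) => [|n _]; first by exists m => /=.
apply: open_borel.
rewrite (_ : F n = +%R (pi (n.+1%:R^-1 *: (1, 1))) @^-1` (+%R (pi (orbit 0 k.1 k.2)) @^-1` P u)) //.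
by do 2 apply: open_translate; exact: open_partitionU.
Qed.

(** By induction on the number of coordinates on which the set depends. *)
Lemma measurable_local (l : seq Z2) (A : set (config tilesU)) :
  (forall w w', (forall k, k \in l -> w k = w' k) -> A w -> A w') ->
  measurable (coding @^-1` A : set (borel (torus R))).
Proof.
elim: l A => [|k l IH] A hA.
  have [[w Aw]|none] := pselect (exists w, A w).
    rewrite (_ : _ @^-1` _ = setT); first exact: measurableT.
    by apply/seteqP; split=> // p _; apply: hA Aw.
  rewrite (_ : _ @^-1` _ = set0); first exact: measurable0.
  by apply/seteqP; split=> // p Ap; case: none; exists (coding p).
pose upd u w : config tilesU := fun m => if m == k then u else w m.
have -> : coding @^-1` A = \bigcup_u ([set p | coding p k = u] `&`
    coding @^-1` [set w | A (upd u w)]).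
  apply/seteqP; split=> [p Ap|p [u _ [pk Ap]]].
    exists (coding p k) => //; split=> //; apply: hA Ap => m _.
    by rewrite /upd; case: eqP => [->|].
  apply: hA Ap => m _; rewrite /upd; case: eqP => [->|//]; exact: esym.
apply: (@countable_bigcupT_measurable _ (borel (torus R))); first exact: countableP.
move=> u; apply: (@measurableI _ (borel (torus R))); first exact: measurable_coordinate.
apply: IH => w w' ww' /=; apply: hA => m; rewrite inE /upd.
by case: eqP => //= _; exact: ww'.
Qed.

Lemma measurable_coding :
  measurable_fun setT (coding : borel (torus R) -> borel (config tilesU)).
Proof.
apply: measurable_borel => U oU; rewrite setTI.
have -> : coding @^-1` U = \bigcup_N coding @^-1` [set w | forall w', agree N w w' -> U w'].
  apply/seteqP; split=> [p Up|p [N _ h]]; last exact: h.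
  by have /nbhs_configP[N hN] := open_nbhs_nbhs (conj oU Up); exists N.
apply: (@bigcupT_measurable _ (borel (torus R))) => N.
apply: (@measurable_local (box N)) => w w' ww' h w'' w'w''; apply: h => k kN.
by rewrite w'w'' // ww' //; exact: ball1_box.
Qed.

Lemma measurable_Omega : measurable (Omega : set (borel (config tilesU))).
Proof. by apply: closed_borel; have [] := subshift_Omega. Qed.

Lemma measurable_factor :
  measurable_fun (Omega : set (borel (config tilesU))) (f : borel (config tilesU) -> borel (torus R)).
Proof.
apply: measurable_borel => U oU.
pose W := [set w' | exists w N, agree N w w' /\
  forall w'', Omega w'' -> agree N w w'' -> U (f w'')].
have -> : Omega `&` f @^-1` U = Omega `&` W.
  apply/seteqP; split=> w [Ow]; last by move=> [w1 [N [ww1 h]]]; split=> //; exact: h.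
  move=> Uw; split=> //.
  have [N hN] := factor_open Ow (open_nbhs_nbhs (conj oU Uw)).
  by exists w, N.
apply: (@measurableI _ (borel (config tilesU))); first exact: measurable_Omega.
apply: open_borel; rewrite openE => w' [w [N [ww' h]]].
apply: filterS (nbhs_agree N w') => w'' w'w''; exists w, N; split=> // k kN.
by rewrite w'w'' // ww'.
Qed.

End Coding.

(** * Unique ergodicity and isomorphism *)

Section Ergodic.
Context (R : realType).
Local Notation pi := (@tpi R).
Local Notation P := (@partitionU R).
Local Notation RU := (@rotU R).
Local Notation sigma := (@shift_action tilesU).
Local Notation Omega := (wang_shift tilesU).
Local Notation f := (symbolic_factor P RU).
Local Notation S := (borel (config tilesU)).
Local Notation M := (borel (torus R)).
Implicit Types (w : config tilesU) (p q : torus R).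

Lemma pushforward_probability d d' (T : measurableType d) (T' : measurableType d')
    (mu : probability T R) (g : T -> T') : measurable_fun setT g ->
  exists nu : probability T' R, forall B, nu B = mu (g @^-1` B).
Proof.
move=> mg; pose h : {mfun T >-> T'} := HB.pack g (isMeasurableFun.Build _ _ _ _ g mg).
by exists (distribution mu h).
Qed.

Lemma probability_full d (T : measurableType d) (mu : probability T R) (X A : set T) :
  measurable X -> mu X = 1%E -> measurable A -> mu (X `&` A) = mu A.
Proof.
move=> mX X1 mA; have mC : mu (~` X) = 0%E by rewrite probability_setC // X1 subee.
rewrite -[in RHS](setIT A) -(setUv X) setIUr measureU; last 3 first.
- exact: measurableI.
- by apply: measurableI => //; exact: measurableC.
- by rewrite setIACA setICr setI0.
rewrite setIC -[LHS]adde0; congr (_ + _)%E; apply/esym/eqP.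
rewrite eq_le measure_ge0 andbT -mC; apply: le_measure; rewrite ?inE //.
- by apply: measurableI => //; exact: measurableC.
- exact: measurableC.
Qed.

Lemma Omega_shift n w : Omega (sigma n w) <-> Omega w.
Proof.
have [_ iO] := subshift_Omega; split=> Ow; last by apply: iO; exists w.
by apply: (iO (- n)); exists (sigma n w) => //; rewrite -shift_actionD addNr shift_action0.
Qed.

Lemma factor_shift n w : Omega w -> f (sigma n w) = RU n (f w).
Proof. by have [_ _] := factor_mapU R; exact. Qed.

Lemma invariant_coding : exists nu : probability S R, invariant_probability sigma Omega nu.
Proof.
have [mu hmu] := haar_exists R.
have [nu nuE] := pushforward_probability mu (@measurable_coding R).
exists nu; split=> [|n A mA]; rewrite !nuE.
  rewrite (_ : _ @^-1` _ = setT) ?probability_setT //.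
  by apply/seteqP; split=> // p _; exact: coding_Omega.
rewrite -(hmu (pi (orbit 0 n.1 n.2)) (@coding R @^-1` A)).
  by congr (mu _); apply/funext => p; rewrite /preimage /= -coding_rotU rotU_translate.
by rewrite -[X in measurable X]setTI; exact: measurable_coding.
Qed.

Section Invariant.
Context (nu : probability S R) (inu : invariant_probability sigma Omega nu).

Lemma measurable_factor_preimage (B : set M) : measurable B ->
  measurable (Omega `&` f @^-1` B : set S).
Proof. by move=> mB; apply: measurable_factor => //; exact: measurable_Omega. Qed.

(** The image of nu under the factor map is invariant under the rotations,
    hence under all the translations. *)
Lemma factor_haar : exists2 lambda : probability M R, haar_probability lambda &
  forall B : set M, measurable B -> lambda B = nu (Omega `&` f @^-1` B).
Proof.
have [nu1 inv] := inu; have mO := measurable_Omega; have mf := measurable_factor_preimage.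
(* f is continuous on Omega only, a set of full measure *)
pose g w : M := if `[< Omega w >] then f w else 0.
have gE B : g @^-1` B = (Omega `&` f @^-1` B) `|` (~` Omega `&` [set w : S | B 0]).
  apply/seteqP; split=> w; rewrite /preimage /= /g.
    by case: asboolP => Ow h; [left|right].
  by case: asboolP => Ow [[]|[]].
have mg : measurable_fun setT (g : S -> M).
  move=> _ B mB; rewrite setTI gE; apply: measurableU; first exact: mf.
  apply: measurableI; first exact: measurableC.
  have [B0|B0] := pselect (B 0).
    by rewrite (_ : [set _ | _] = setT) //; apply/seteqP; split.
  by rewrite (_ : [set _ | _] = set0) //; apply/seteqP; split.
have [lambda lE] := pushforward_probability nu mg.
have {}lE (B : set M) : measurable B -> lambda B = nu (Omega `&` f @^-1` B).
  move=> mB; rewrite lE -(probability_full mO nu1); last first.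
    by rewrite -[X in measurable X]setTI; exact: mg.
  congr (nu _); rewrite gE setIUr setIA setIid setIA setICr set0I setU0 //.
exists lambda => //; apply: rotation_haar => n A mA.
rewrite !lE //; last first.
  rewrite (_ : RU n @^-1` A = +%R (pi (orbit 0 n.1 n.2)) @^-1` A).
    by rewrite -[X in measurable X]setTI; exact: measurable_translate.
  by apply/funext => q; rewrite /preimage /= rotU_translate.
rewrite -(inv n _ (mf _ mA)); congr (nu _); apply/seteqP; split=> w [].
  by move=> Ow h; split; [exact/Omega_shift|rewrite /= factor_shift].
by move=> /Omega_shift Ow; rewrite /= factor_shift.
Qed.

Lemma generic_full (lambda : probability M R) : haar_probability lambda ->
  (forall B : set M, measurable B -> lambda B = nu (Omega `&` f @^-1` B)) ->
  nu (Omega `&` f @^-1` (~` @singular R)) = 1%E.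
Proof.
move=> hl lE; rewrite -lE; last by apply: measurableC; exact: measurable_singular.
by rewrite probability_setC ?haar_singular ?sube0 //; exact: measurable_singular.
Qed.

(** nu is carried by the configurations over nonsingular points; there
    coding inverts the factor map, so nu is the image under coding of the
    Haar probability. *)
Lemma invariant_unique (lambda : probability M R) : haar_probability lambda ->
  forall A, measurable A -> nu A = lambda (@coding R @^-1` A).
Proof.
have [lambda' hl' lE] := factor_haar; move=> hl A mA.
have mcA : measurable (@coding R @^-1` A : set M).
  by rewrite -[X in measurable X]setTI; exact: measurable_coding.
rewrite (haar_unique hl hl' mcA) lE //.
have mG : measurable (~` @singular R : set M).
  by apply: measurableC; exact: measurable_singular.
have X1 := generic_full hl' lE; have mX := measurable_factor_preimage mG.
rewrite -[LHS](probability_full mX X1 mA) -[RHS](probability_full mX X1).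
  congr (nu _); apply/seteqP; split=> w [[Ow Gw]] /=.
    by move=> Aw; split=> //; split=> //; rewrite coding_factor.
  by move=> [_]; rewrite coding_factor.
exact: measurable_factor_preimage.
Qed.

Lemma factor_isomorphism : exists lambda : probability M R,
  haar_probability lambda /\ isomorphic_mps sigma nu RU lambda.
Proof.
have [lambda hl lE] := factor_haar; exists lambda; split=> //.
have mG : measurable (~` @singular R : set M).
  by apply: measurableC; exact: measurable_singular.
have X1 := generic_full hl lE; have mX := measurable_factor_preimage mG.
exists (Omega `&` f @^-1` (~` @singular R)), (~` @singular R), f; split.
- split=> // n _ [w [Ow Gw] <-]; split; first exact/Omega_shift.
  by rewrite /preimage /= factor_shift // => /singular_rotU.
- split=> //; last by rewrite lE.
  by move=> n _ [p Gp <-] /singular_rotU.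
- split; last by move=> n w [Ow _]; exact: factor_shift.
  split=> [w []|w w'|p Gp] //.
    move=> /set_mem[Ow Gw] /set_mem[Ow' Gw'] ww'.
    by rewrite -(coding_factor Ow Gw) -(coding_factor Ow' Gw') ww'.
  exists (coding p); last exact: factor_coding.
  by split; [exact: coding_Omega|rewrite /= factor_coding].
- split.
    apply: (@measurable_funS _ _ _ _ (Omega : set S)) => //.
    - exact: measurable_Omega.
    - exact: measurable_factor.
  move=> A mA AX; rewrite (_ : f @` A = ~` @singular R `&` @coding R @^-1` A).
    apply: measurableI => //.
    by rewrite -[X in measurable X]setTI; exact: measurable_coding.
  apply/seteqP; split=> [_ [w Aw <-]|p [Gp Ap]].
    by have [Ow Gw] := AX _ Aw; split=> //; rewrite /preimage /= coding_factor.
  by exists (coding p) => //; exact: factor_coding.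
- move=> B mB; rewrite lE // -[RHS](probability_full mX X1).
    by congr (nu _); apply/seteqP; split=> w; [move=> [[? ?] ?]|move=> [[? ?] [_ ?]]].
  exact: measurable_factor_preimage.
Qed.

End Invariant.

Lemma strictly_ergodic_Omega : strictly_ergodic R sigma Omega.
Proof.
split; last exact: minimal_Omega R.
have [nu inu] := invariant_coding; exists nu; split=> // nu' inu' A mA.
have [lambda hl] := haar_exists R.
by rewrite (invariant_unique inu' hl) // (invariant_unique inu hl).
Qed.

End Ergodic.

Theorem theorem2 (R : realType) :
  let P := @partitionU R in
  let RU := @rotU R in
  let X := symbolic_system P RU in
  let sigma := @shift_action tilesU in
  let Omega := wang_shift tilesU in
  let f := symbolic_factor P RU in
  [/\ [/\ minimal sigma X, aperiodic sigma X & X = Omega],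
      markov_partition P RU,
      maximal_equicontinuous_factor Omega sigma RU,
      factor_map Omega sigma RU f /\
      fiber_cardinalities Omega f [set 1; 2; 8]%N &
      strictly_ergodic R sigma Omega /\
      forall nu : probability (borel (config tilesU)) R,
        invariant_probability sigma Omega nu ->
        exists lambda : probability (borel (torus R)) R,
          haar_probability lambda /\ isomorphic_mps sigma nu RU lambda].
Proof.
move=> P RU X sigma Omega f; split.
- rewrite /X /P /RU symbolic_systemE.
  by split=> //; [exact: minimal_Omega R|exact: aperiodic_Omega R].
- exact: markov_partitionU.
- exact: maximal_equicontinuous_factorU.
- by split; [exact: factor_mapU|exact: fiber_cardinalitiesU].
- split; first exact: strictly_ergodic_Omega.
  by move=> nu; exact: factor_isomorphism.
Qed.
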